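(* Let $f$ and $c_i$ ($i\in\mathcal{E}\cup\mathcal{I}$) be polynomials in $\mathbb{R}[x]$, $x=(x_1,\dots,x_n)$, where $\mathcal{E},\mathcal{I}$ are disjoint finite index sets, and consider the problem $$f_{\min}:=\min f(x)\quad\text{s.t. } c_i(x)=0\ (i\in\mathcal{E}),\ c_j(x)\ge 0\ (j\in\mathcal{I}).$$ Let $\mathcal{K}$, $\mathcal{K}_c$ be the sets of critical pairs and critical points (defined in the context). Suppose $\mathcal{K}_c\neq\emptyset$ and that Assumption A holds with polynomials $p_i$, and let $\phi,\psi$, $f_c$, $f_k$, $f_k'$ be as defined in the context. If (i) $\mathrm{IQ}(c_{eq},c_{in})+\mathrm{IQ}(\phi,\psi)$ is archimedean, or (ii) $\mathrm{IQ}(c_{eq},c_{in})$ is archimedean, or (iii) Assumption B holds, then $f_k=f_k'=f_c$ for all $k$ sufficiently large. Consequently, if the minimum value $f_{\min}$ is achieved at a critical point (i.e., at a feasible point $u\in\mathcal{K}_c$), then $f_k=f_k'=f_{\min}$ for all $k$ sufficiently large provided one of (i)–(iii) holds.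
   Context: Notation: $\mathbb{R}[x]_d$ is the space of real polynomials of degree $\le d$; $\Sigma[x]$ is the cone of sums of squares of polynomials and $\Sigma[x]_d=\Sigma[x]\cap\mathbb{R}[x]_d$. Write $c_{eq}=(c_i)_{i\in\mathcal{E}}$, $c_{in}=(c_j)_{j\in\mathcal{I}}$. Critical pairs: $\mathcal{K}=\{(x,\lambda)\in\mathbb{R}^n\times\mathbb{R}^{\mathcal{E}\cup\mathcal{I}} : c_i(x)=0\ (i\in\mathcal{E}),\ \lambda_jc_j(x)=0\ (j\in\mathcal{I}),\ \nabla f(x)=\sum_{i\in\mathcal{E}\cup\mathcal{I}}\lambda_i\nabla c_i(x)\}$, and $\mathcal{K}_c=\{u:\exists\lambda,\ (u,\lambda)\in\mathcal{K}\}$ (the real critical points). Assumption A: for each $i\in\mathcal{E}\cup\mathcal{I}$ there is a polynomial $p_i\in\mathbb{R}[x]$ such that $\lambda_i=p_i(x)$ for all $(x,\lambda)\in\mathcal{K}$. Given such $p_i$, define the polynomial tuples $\phi=\big(\nabla f-\sum_{i\in\mathcal{E}\cup\mathcal{I}}p_i\nabla c_i,\ (p_jc_j)_{j\in\mathcal{I}}\big)$ (the $n$ entries of the vector followed by the products $p_jc_j$) and $\psi=(p_j)_{j\in\mathcal{I}}$. Let $f_c$ be the optimal value of $\min f(x)$ s.t. $c_{eq}(x)=0,\ c_{in}(x)\ge0,\ \phi(x)=0,\ \psi(x)\ge0$, with $f_c=+\infty$ if this problem is infeasible. For tuples $h=(h_1,\dots,h_s)$, $g=(g_1,\dots,g_t)$: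 $\mathrm{Ideal}(h)=\sum h_i\mathbb{R}[x]$, $\mathrm{Ideal}(h)_{2k}=\sum h_i\mathbb{R}[x]_{2k-\deg h_i}$; $\mathrm{Qmod}(g)=\Sigma[x]+\sum g_i\Sigma[x]$, $\mathrm{Qmod}(g)_{2k}=\Sigma[x]_{2k}+\sum g_i\Sigma[x]_{2k-\deg g_i}$; $\mathrm{IQ}(h,g)=\mathrm{Ideal}(h)+\mathrm{Qmod}(g)$ and $\mathrm{IQ}(h,g)_{2k}=\mathrm{Ideal}(h)_{2k}+\mathrm{Qmod}(g)_{2k}$. A set $\mathrm{IQ}(h,g)$ (or a sum of such sets) is archimedean if it contains a polynomial $p$ such that $\{x\in\mathbb{R}^n:p(x)\ge0\}$ is compact. Assumption B: there exists $\rho\in\mathrm{Qmod}(c_{in},\psi)$ such that for every $u\in\mathcal{K}_c$ with $f(u)<f_c$ one has $\rho(u)<0$. Moment relaxations: for $y=(y_\alpha)_{\alpha\in\mathbb{N}^n_{2k}}$ (indexed by exponents with $|\alpha|\le 2k$), let $\langle\sum f_\alpha x^\alpha,y\rangle=\sum f_\alpha y_\alpha$. For $q\in\mathbb{R}[x]_{2k}$ the localizing matrix $L_q^{(k)}(y)$ is the symmetric matrix with $\mathrm{vec}(a_1)^TL_q^{(k)}(y)\mathrm{vec}(a_2)=\langle qa_1a_2,y\rangle$ for all $a_1,a_2\in\mathbb{R}[x]_{k-\lceil\deg(q)/2\rceil}$ (vec = coefficient vector); $M_k(y)=L_1^{(k)}(y)$; for a tuple $q$, $L_q^{(k)}(y)$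 is the block diagonal matrix of the $L_{q_i}^{(k)}(y)$. Define $f_k'=\min\langle f,y\rangle$ s.t. $\langle1,y\rangle=1$, $M_k(y)\succeq0$, $L_{c_{eq}}^{(k)}(y)=0$, $L_{c_{in}}^{(k)}(y)\succeq0$, $L_\phi^{(k)}(y)=0$, $L_\psi^{(k)}(y)\succeq0$, $y\in\mathbb{R}^{\mathbb{N}^n_{2k}}$; and $f_k=\max\gamma$ s.t. $f-\gamma\in\mathrm{IQ}(c_{eq},c_{in})_{2k}+\mathrm{IQ}(\phi,\psi)_{2k}$. *)

(* Defs.v *)
From HB Require Import structures.
From mathcomp Require Import all_boot all_order all_algebra.
From mathcomp Require Import mpoly.
From mathcomp Require Import all_classical all_reals all_analysis.

Set Implicit Arguments.
Unset Strict Implicit.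
Unset Printing Implicit Defensive.

Import Order.TTheory GRing.Theory Num.Theory.
Import numFieldNormedType.Exports.
Local Open Scope ring_scope.

Section POP.
Variables (R : realType) (n : nat).
Local Notation P := {mpoly R[n]}.
Local Notation pt := ('I_n -> R).

(* degree of a polynomial (deg 0 = 0, msize p = deg p + 1 for p <> 0) *)
Definition pdeg (p : P) : nat := (msize p).-1.

Definition deg_le (d : nat) (p : P) : Prop := (msize p <= d.+1)%N.

(* p in R[x]_{D - deg q}; this space is {0} when deg q > D *)
Definition deg_le_sub (D : nat) (q p : P) : Prop :=
  if (pdeg q <= D)%N then deg_le (D - pdeg q) p else p = 0.

Definition SOS (p : P) : Prop := exists s : seq P, p = \sum_(q <- s) q ^+ 2.

Definition SOS_sub (D : nat) (q p : P) : Prop := SOS p /\ deg_le_sub D q p.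

Definition IQ (s t : nat) (h : 'I_s -> P) (g : 'I_t -> P) (p : P) : Prop :=
  exists (a : 'I_s -> P) (s0 : P) (sg : 'I_t -> P),
    SOS s0 /\ (forall j, SOS (sg j)) /\
    p = \sum_(i < s) h i * a i + s0 + \sum_(j < t) g j * sg j.

Definition Qmod (t : nat) (g : 'I_t -> P) (p : P) : Prop :=
  exists (s0 : P) (sg : 'I_t -> P),
    SOS s0 /\ (forall j, SOS (sg j)) /\ p = s0 + \sum_(j < t) g j * sg j.

Definition IQ_trunc (k : nat) (s t : nat) (h : 'I_s -> P) (g : 'I_t -> P) (p : P)
  : Prop :=
  exists (a : 'I_s -> P) (s0 : P) (sg : 'I_t -> P),
    (forall i, deg_le_sub k.*2 (h i) (a i)) /\
    (SOS s0 /\ deg_le k.*2 s0) /\ (forall j, SOS_sub k.*2 (g j) (sg j)) /\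
    p = \sum_(i < s) h i * a i + s0 + \sum_(j < t) g j * sg j.

(* a set of polynomials is archimedean if it contains p with {x | p(x) >= 0} compact;
   points of R^n are identified with row vectors 'rV[R]_n for the topology *)
Definition archimedean (S : P -> Prop) : Prop :=
  exists p, S p /\ compact [set v : 'rV[R]_n | 0 <= p.@[fun i => v ord0 i]].

Variables (mE mI : nat) (f : P) (cE : 'I_mE -> P) (cI : 'I_mI -> P).

Definition crit_pair (x : pt) (lE : 'I_mE -> R) (lI : 'I_mI -> R) : Prop :=
  (forall i, (cE i).@[x] = 0) /\
  (forall j, lI j * (cI j).@[x] = 0) /\
  (forall l : 'I_n, (f^`M(l)).@[x] =
      \sum_(i < mE) lE i * ((cE i)^`M(l)).@[x] +
      \sum_(j < mI) lI j * ((cI j)^`M(l)).@[x]).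

Definition crit_point (u : pt) : Prop := exists lE lI, crit_pair u lE lI.

Definition feasible (x : pt) : Prop :=
  (forall i, (cE i).@[x] = 0) /\ (forall j, 0 <= (cI j).@[x]).

Definition fmin : \bar R := ereal_inf [set (f.@[x])%:E | x in feasible].

Definition assumptionA (pE : 'I_mE -> P) (pI : 'I_mI -> P) : Prop :=
  forall x lE lI, crit_pair x lE lI ->
    (forall i, lE i = (pE i).@[x]) /\ (forall j, lI j = (pI j).@[x]).

Variables (pE : 'I_mE -> P) (pI : 'I_mI -> P).

Definition phi (i : 'I_(n + mI)) : P :=
  match fintype.split i with
  | inl l => f^`M(l) - \sum_(i < mE) pE i * (cE i)^`M(l)
                     - \sum_(j < mI) pI j * (cI j)^`M(l)
  | inr j => pI j * cI j
  end.

Definition psi (j : 'I_mI) : P := pI j.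

Definition feasible_c (x : pt) : Prop :=
  feasible x /\ (forall i, (phi i).@[x] = 0) /\ (forall j, 0 <= (psi j).@[x]).

Definition fc : \bar R := ereal_inf [set (f.@[x])%:E | x in feasible_c].

Definition assumptionB : Prop :=
  exists rho : P,
    Qmod (fun j : 'I_(mI + mI) =>
            match fintype.split j with inl j' => cI j' | inr j' => psi j' end) rho /\
    forall u, crit_point u -> ((f.@[u])%:E < fc)%E -> rho.@[u] < 0.

Definition fk (k : nat) : \bar R :=
  ereal_sup [set gamma%:E | gamma in
    [set gamma : R | exists p1 p2, f - gamma%:MP = p1 + p2 /\
        IQ_trunc k cE cI p1 /\ IQ_trunc k phi psi p2]].

(* y in R^{N^n_{2k}}, encoded as a function on all monomials vanishing above degree 2k *)
Definition riesz (y : 'X_{1..n} -> R) (p : P) : R :=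
  \sum_(m <- msupp p) p@_m * y m.

(* localizing matrix L_q^{(k)}(y) (index set: polynomials of degree <= k - ceil(deg q/2);
   empty when ceil(deg q /2) > k). vec(a1)^T L vec(a2) = <q a1 a2, y>. *)
Definition loc_dom (k : nat) (q a : P) : Prop :=
  (uphalf (pdeg q) <= k)%N /\ deg_le (k - uphalf (pdeg q)) a.

Definition loc_psd (k : nat) (q : P) (y : 'X_{1..n} -> R) : Prop :=
  forall a, loc_dom k q a -> 0 <= riesz y (q * a * a).

Definition loc_zero (k : nat) (q : P) (y : 'X_{1..n} -> R) : Prop :=
  forall a1 a2, loc_dom k q a1 -> loc_dom k q a2 -> riesz y (q * a1 * a2) = 0.

Definition mom_feasible (k : nat) (y : 'X_{1..n} -> R) : Prop :=
  (forall m, (k.*2 < mdeg m)%N -> y m = 0) /\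
  riesz y 1 = 1 /\
  loc_psd k 1 y /\
  (forall i, loc_zero k (cE i) y) /\
  (forall j, loc_psd k (cI j) y) /\
  (forall i, loc_zero k (phi i) y) /\
  (forall j, loc_psd k (psi j) y).

Definition fk' (k : nat) : \bar R :=
  ereal_inf [set (riesz y f)%:E | y in mom_feasible k].

End POP.

(* Main.v *)
Require Import Defs.
From HB Require Import structures.
From mathcomp Require Import all_boot all_order all_algebra.
From mathcomp Require Import all_field.
From mathcomp Require Import polyrcf.
From mathcomp Require Import complex.
From mathcomp Require Import mpoly.
From mathcomp Require Import all_classical all_reals all_analysis.
From mathcomp Require Import ring lra zify.

(** Let J be the ideal generated by the equations (c_eq, phi) and M = J + Qmod(c_in, psi).

    If p is a prime ideal containing J and f were transcendental over R modulo p, there would be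
    an R-derivation D, preserving p, with D f not in p. But modulo J the gradient of f is
    sum p_i grad c_i, and modulo p each c_i or its multiplier p_i vanishes, so D f lies in p.
    Hence q(f) lies in J for some nonzero univariate q.

    Write q = q_- q_+, where q_- has all its real roots below f_c and q_+ has none there. No
    feasible critical point satisfies q_-(f) = 0, so -1 lies in M + (q_-(f)): by Putinar's theorem
    in the archimedean cases, by the Positivstellensatz under Assumption B. Multiplying by
    q_+(f)^2 gives -q_+(f)^2 in M. Given eps > 0, the univariate polynomial
    t - f_c + eps + C q_+(t)^2 is positive on R for C large, hence a sum of two squares; evaluated
    at f this exhibits f - f_c + eps as an element of M with multipliers of degree independent of
    eps, so the hierarchy is exact at a fixed order. When f_c is infinite, -1 lies in M itself.

    The Positivstellensatz is proved by extending a proper preordering to a prime cone, embedding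
    the (countable) subring generated by the data in a real closed field, and carrying the signs of
    finitely many polynomials back to R by Hoermander's elimination.

    At a minimizer that is a critical point the multipliers are unique by Assumption A, and they
    are nonnegative as limits of the multipliers of penalised problems; hence f_c = f_min. *)

Set Implicit Arguments.
Unset Strict Implicit.
Unset Printing Implicit Defensive.

Import Order.TTheory GRing.Theory Num.Theory.
Import numFieldNormedType.Exports.
Local Open Scope ring_scope.

(** * Sign diagrams of univariate polynomials *)

Section SignDiagrams.

(** Algebraicity must hold modulo J itself, not modulo a radical, since q(f) later serves as an
    equation of M. The values q(f), q nonzero, form a multiplicative set; were J to miss it, an
    ideal maximal among those containing J and missing it would be prime, with f transcendental
    modulo it. The derivation has values in the polynomial ring, not in a fraction field, so each
    extension step clears a denominator outside the prime.

    Only bounds r < f_c are certified, and one order must serve them all: the degree has to stay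
    bounded, while the constant C may blow up as eps tends to 0.

    In the Positivstellensatz the real closed field of the cone need not be comparable with R. Only
    finitely many coefficients c matter, so the cone is pulled back to Z[c][x]; this ring is
    countable, and Z[c] maps to both fields with the same signs because nonnegative reals are
    squares.

    Uniqueness of the multipliers makes the gradients of the active constraints independent at the
    minimizer, which replaces a constraint qualification; nearby multipliers are then rational
    functions of the point. *)

Lemma noroot_sgz (K : rcfType) (p : {poly K}) (x y : K) : x <= y ->
  (forall t, x <= t <= y -> ~~ root p t) -> sgz p.[x] = sgz p.[y].
Proof.
move=> xy nr; have : 0 < p.[x] * p.[y].
  rewrite ltNge; apply/negP => /(polyrcf.poly_ivt xy)[t].
  by rewrite in_itv /= => /nr/negP.
case: (sgzP p.[x]) => [->|hx|hx]; first by rewrite mul0r ltxx.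
  by rewrite pmulr_rgt0 // => hy; rewrite gtr0_sgz.
by rewrite nmulr_rgt0 // => hy; rewrite ltr0_sgz.
Qed.

Lemma sgz_far_right (K : rcfType) (p : {poly K}) : p != 0 ->
  exists B, forall b, B <= b -> sgz p.[b] = sgz (lead_coef p).
Proof.
move=> p0; exists (cauchy_bound p) => b hb.
by rewrite -sgz_sgr (sgp_pinftyP (ge_cauchy_bound p0)) ?in_itv /= ?hb // /sgp_pinfty sgz_sgr.
Qed.

Lemma sgz_far_left (K : rcfType) (p : {poly K}) : p != 0 ->
  exists B, forall b, b <= B -> sgz p.[b] = (-1) ^+ (size p).-1 * sgz (lead_coef p).
Proof.
move=> p0; exists (- cauchy_bound p) => b hb.
rewrite -sgz_sgr (sgp_minftyP (le_cauchy_bound p0)) ?in_itv //=.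
by rewrite /sgp_minfty sgz_sgr sgzM sgzX sgzN1.
Qed.

Lemma seq_argmin (K : realDomainType) (T : eqType) (key : T -> K) (P : pred T)
    (s : seq T) : has P s ->
  exists2 z, z \in s & P z /\ forall t, t \in s -> P t -> key z <= key t.
Proof.
elim: s => // a s IH /=; case: (boolP (has P s)) => [/IH[z zs [Pz zm]] _|nP].
  case: (boolP (P a && (key a <= key z))) => [/andP[Pa az]|na].
    exists a; first by rewrite mem_head.
    split=> // t; rewrite in_cons => /orP[/eqP->//|ts Pt].
    exact: le_trans az (zm t ts Pt).
  exists z; first by rewrite in_cons zs orbT.
  split=> // t; rewrite in_cons => /orP[/eqP-> Pa|]; last exact: zm.
  by move: na; rewrite Pa /= -ltNge => /ltW.
rewrite orbF => Pa; exists a; first by rewrite mem_head.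
split=> // t; rewrite in_cons => /orP[/eqP->//|ts Pt].
by case/hasP: nP; exists t.
Qed.

(** A list of pairs marks points on two ordered lines at once, and two points are compared by their
    positions among the marks. Both strict comparisons are recorded, so coincidence with a mark is
    compared as well. *)
Definition same_cell (K1 K2 : realDomainType) (zs : seq (K1 * K2)) x1 x2 :=
  forall z, z \in zs -> (x1 < z.1) = (x2 < z.2) /\ (z.1 < x1) = (z.2 < x2).

Definition order_iso (K1 K2 : realDomainType) (zs : seq (K1 * K2)) :=
  forall z, z \in zs -> same_cell zs z.1 z.2.

Definition swap_pair (T1 T2 : Type) (z : T1 * T2) := (z.2, z.1).

Lemma same_cell_swap (K1 K2 : realDomainType) (zs : seq (K1 * K2)) x1 x2 :
  same_cell zs x1 x2 -> same_cell (map (@swap_pair _ _) zs) x2 x1.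
Proof. by move=> h z /mapP[t /h[h1 h2] ->]; split. Qed.

Lemma order_iso_swap (K1 K2 : realDomainType) (zs : seq (K1 * K2)) :
  order_iso zs -> order_iso (map (@swap_pair _ _) zs).
Proof. by move=> h z /mapP[t /h ht ->]; apply: same_cell_swap. Qed.

Lemma same_cell_eq (K1 K2 : realDomainType) (zs : seq (K1 * K2)) x1 x2 z :
  same_cell zs x1 x2 -> z \in zs -> (x1 == z.1) = (x2 == z.2).
Proof. by move=> h /h[h1 h2]; rewrite !eq_le !leNgt h1 h2. Qed.

Lemma order_iso_cons (K1 K2 : realDomainType) (zs : seq (K1 * K2)) z :
  order_iso zs -> same_cell zs z.1 z.2 -> order_iso (z :: zs).
Proof.
move=> oz sz t; rewrite in_cons => /orP[/eqP->|tz] u; rewrite in_cons.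
  by case/orP=> [/eqP->|/sz//]; rewrite !ltxx.
by case/orP=> [/eqP->|/(oz _ tz)//]; have [-> ->] := sz _ tz.
Qed.

(** The endpoint is the nearest mark on the right, or a far point when there is none. The signs
    enter as arbitrary functions so that the left-hand version follows by negating both lines. *)
Lemma right_endpoint (K1 K2 : realDomainType) (zs : seq (K1 * K2)) x1 x2
    (s1 : K1 -> int) (s2 : K2 -> int) :
  order_iso zs -> same_cell zs x1 x2 ->
  (forall z, z \in zs -> s1 z.1 = s2 z.2) ->
  (forall B1 B2, exists b1 b2, [/\ B1 < b1, B2 < b2 & s1 b1 = s2 b2]) ->
  exists b1 b2, [/\ x1 < b1, x2 < b2, s1 b1 = s2 b2,
    forall z, z \in zs -> x1 < z.1 -> b1 <= z.1 &
    forall z, z \in zs -> x2 < z.2 -> b2 <= z.2].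
Proof.
move=> oz sz ss far; case: (boolP (has (fun z : K1 * K2 => x1 < z.1) zs)) => [|nh].
  case/(seq_argmin fst) => z zz [xz zm]; exists z.1, z.2; have [h1 h2] := sz _ zz.
  split=> //; first by rewrite -h1.
  - exact: ss.
  - move=> t tz; have [<- _] := sz _ tz; move=> /(zm _ tz).
    by rewrite !leNgt; have [_ ->] := oz _ zz _ tz.
have [b1 [b2 [h1 h2 h3]]] := far x1 x2; exists b1, b2; split=> //.
  by move=> z zz xz; case/hasP: nh; exists z.
move=> z zz; have [<- _] := sz _ zz => xz; by case/hasP: nh; exists z.
Qed.

Lemma left_endpoint (K1 K2 : realDomainType) (zs : seq (K1 * K2)) x1 x2
    (s1 : K1 -> int) (s2 : K2 -> int) :
  order_iso zs -> same_cell zs x1 x2 ->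
  (forall z, z \in zs -> s1 z.1 = s2 z.2) ->
  (forall B1 B2, exists b1 b2, [/\ b1 < B1, b2 < B2 & s1 b1 = s2 b2]) ->
  exists b1 b2, [/\ b1 < x1, b2 < x2, s1 b1 = s2 b2,
    forall z, z \in zs -> z.1 < x1 -> z.1 <= b1 &
    forall z, z \in zs -> z.2 < x2 -> z.2 <= b2].
Proof.
move=> oz sz ss far; pose opp2 (z : K1 * K2) := (- z.1, - z.2).
have [||||b1 [b2 [h1 h2 h3 h4 h5]]] :=
  @right_endpoint K1 K2 (map opp2 zs) (- x1) (- x2) (s1 \o -%R) (s2 \o -%R).
- by move=> z /mapP[t tz ->] z' /mapP[t' tz' ->] /=; rewrite !ltrN2; have [-> ->] := oz _ tz _ tz'.
- by move=> z /mapP[t tz ->] /=; rewrite !ltrN2; have [-> ->] := sz _ tz.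
- by move=> z /mapP[t tz ->] /=; rewrite !opprK ss.
- move=> B1 B2; have [b1 [b2 [h1 h2 h3]]] := far (- B1) (- B2).
  by exists (- b1), (- b2); rewrite /= !opprK; split=> //; rewrite ltrNr.
exists (- b1), (- b2); split=> //; rewrite 1?ltrNl // => z zz hz; rewrite lerNr.
  by apply: (h4 (opp2 z)); [apply: map_f | rewrite ltrN2].
by apply: (h5 (opp2 z)); [apply: map_f | rewrite ltrN2].
Qed.

(** If [x1] is not a mark, the partners of the marks below it precede those of the marks above it,
    and density leaves room between the two groups. *)
Lemma same_cell_exists (K1 K2 : realFieldType) (zs : seq (K1 * K2)) x1 :
  order_iso zs -> exists x2, same_cell zs x1 x2.
Proof.
move=> oz; case: (boolP (has (fun z : K1 * K2 => x1 == z.1) zs)) => [/hasP[z zz /eqP->]|nh].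
  by exists z.2; apply: oz.
have ne z : z \in zs -> (x1 < z.1) = ~~ (z.1 < x1).
  move=> zz; rewrite -leNgt lt_neqAle; case: eqVneq => // e.
  by case/hasP: nh; exists z; rewrite // e.
pose lo := [seq z <- zs | z.1 < x1]; pose hi := [seq z <- zs | x1 < z.1].
have [m lom mhi] : exists2 m, forall z, z \in lo -> z.2 < m & forall z, z \in hi -> m < z.2.
  have lohi z t : z \in lo -> t \in hi -> z.2 < t.2.
    rewrite !mem_filter => /andP[h1 zz] /andP[h2 tz].
    by have [<- _] := oz _ zz _ tz; apply: lt_trans h2.
  have [loE|[l lz lm]] : lo = [::] \/ exists2 z, z \in lo & forall t, t \in lo -> t.2 <= z.2.
    case E : lo => [|a s]; [by left | right; rewrite -E].
    have : has xpredT lo by rewrite E.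
    case/(seq_argmin (fun z => - z.2)) => z zz [_ zm]; exists z => // t /zm.
    by rewrite lerN2; apply.
  - have [hiE|[h hz hm]] : hi = [::] \/ exists2 z, z \in hi & forall t, t \in hi -> z.2 <= t.2.
      case E : hi => [|a s]; [by left | right; rewrite -E].
      have : has xpredT hi by rewrite E.
      by case/(seq_argmin snd) => z zz [_ zm]; exists z => // t /zm; apply.
    + by exists 0; rewrite ?loE ?hiE.
    + exists (h.2 - 1); rewrite ?loE // => z /hm; apply: lt_le_trans.
      by rewrite ltrBlDr ltrDl.
  -
    have [hiE|[h hz hm]] : hi = [::] \/ exists2 z, z \in hi & forall t, t \in hi -> z.2 <= t.2.
      case E : hi => [|a s]; [by left | right; rewrite -E].
      have : has xpredT hi by rewrite E.
      by case/(seq_argmin snd) => z zz [_ zm]; exists z => // t /zm; apply.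
    + exists (l.2 + 1); rewrite ?hiE // => z /lm h; apply: le_lt_trans h _.
      by rewrite ltrDl.
    + exists ((l.2 + h.2) / 2) => z.
        by move=> /lm h'; apply: le_lt_trans h' (midf_lt (lohi _ _ lz hz)).1.
      by move=> /hm; apply: lt_le_trans; rewrite (midf_lt (lohi _ _ lz hz)).2.
exists m => z zz; rewrite ne //; case: ltP => hz /=.
  by have := lom z; rewrite mem_filter hz zz => /(_ isT) h; rewrite h ltNge ltW.
have hx : x1 < z.1 by rewrite ne // -leNgt.
by have := mhi z; rewrite mem_filter hx zz => /(_ isT) h; rewrite h [z.2 < m]ltNge ltW.
Qed.

End SignDiagrams.

(** * Extending a sign diagram by one polynomial whose derivative is already decided *)

Section OneMorePolynomial.

Definition captures (K1 K2 : rcfType) (zs : seq (K1 * K2)) (p1 : {poly K1}) (p2 : {poly K2}) :=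
  (forall x, root p1 x -> exists2 z, z \in zs & z.1 = x) /\
  (forall x, root p2 x -> exists2 z, z \in zs & z.2 = x).

Definition same_sign_on (K1 K2 : rcfType) (zs : seq (K1 * K2)) (p1 : {poly K1}) (p2 : {poly K2}) :=
  forall z, z \in zs -> sgz p1.[z.1] = sgz p2.[z.2].

Definition same_far_signs (K1 K2 : rcfType) (p1 : {poly K1}) (p2 : {poly K2}) :=
  (forall B1 B2, exists b1 b2, [/\ B1 < b1, B2 < b2 & sgz p1.[b1] = sgz p2.[b2]]) /\
  (forall B1 B2, exists b1 b2, [/\ b1 < B1, b2 < B2 & sgz p1.[b1] = sgz p2.[b2]]).

Lemma same_far_signsP (K1 K2 : rcfType) (p1 : {poly K1}) (p2 : {poly K2}) :
  p1 != 0 -> p2 != 0 -> size p1 = size p2 ->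
  sgz (lead_coef p1) = sgz (lead_coef p2) -> same_far_signs p1 p2.
Proof.
move=> p10 p20 sz sl; split=> B1 B2.
  have [[C1 h1] [C2 h2]] := (sgz_far_right p10, sgz_far_right p20).
  exists (Num.max B1 C1 + 1), (Num.max B2 C2 + 1).
  by rewrite !(le_lt_trans _ (ltr_pwDr _ (lexx _))) ?le_max ?lexx // h1 ?h2 //;
    rewrite ler_wpDr ?le_max ?lexx ?orbT.
have [[C1 h1] [C2 h2]] := (sgz_far_left p10, sgz_far_left p20).
exists (Num.min B1 C1 - 1), (Num.min B2 C2 - 1).
rewrite !ltrBlDr !ltr_pwDr ?ge_min ?lexx // h1 ?h2 ?sz ?sl //.
  by rewrite lerBlDr ler_wpDr // ge_min lexx orbT.
by rewrite lerBlDr ler_wpDr // ge_min lexx orbT.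
Qed.

Lemma cell_endpoints (K1 K2 : rcfType) (zs : seq (K1 * K2)) (p1 : {poly K1}) (p2 : {poly K2}) x1 x2 :
  order_iso zs -> same_cell zs x1 x2 -> same_sign_on zs p1 p2 -> same_far_signs p1 p2 ->
  (forall z, z \in zs -> z.1 != x1) ->
  exists a1 a2 b1 b2, [/\ a1 < x1 < b1, a2 < x2 < b2,
    sgz p1.[a1] = sgz p2.[a2], sgz p1.[b1] = sgz p2.[b2] &
    forall z, z \in zs -> ~~ (a1 < z.1 < b1) /\ ~~ (a2 < z.2 < b2)].
Proof.
move=> oz sz ss [fr fl] nz.
have [a1 [a2 [h1 h2 h3 h4 h5]]] := @left_endpoint _ _ _ _ _ (fun x => sgz p1.[x]) (fun x => sgz p2.[x]) oz sz ss fl.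
have [b1 [b2 [k1 k2 k3 k4 k5]]] := @right_endpoint _ _ _ _ _ (fun x => sgz p1.[x]) (fun x => sgz p2.[x]) oz sz ss fr.
exists a1, a2, b1, b2; rewrite h1 h2 k1 k2; split=> // z zz; split.
  apply/negP => /andP[az zb]; have := nz _ zz; case: ltgtP => // hz.
    by have := h4 _ zz hz; rewrite leNgt az.
  by have := k4 _ zz hz; rewrite leNgt zb.
apply/negP => /andP[az zb]; have := nz _ zz; rewrite eq_sym (same_cell_eq sz zz).
rewrite eq_sym; case: ltgtP => // hz.
  by have := h5 _ zz hz; rewrite leNgt az.
by have := k5 _ zz hz; rewrite leNgt zb.
Qed.

Lemma same_cell_within (K1 K2 : realDomainType) (zs : seq (K1 * K2)) x1 x2 y2 a2 b2 :
  same_cell zs x1 x2 -> a2 < x2 < b2 -> a2 < y2 < b2 ->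
  (forall z, z \in zs -> ~~ (a2 < z.2 < b2)) -> same_cell zs x1 y2.
Proof.
move=> sz /andP[ax xb] /andP[ay yb] nz z zz; have [-> ->] := sz _ zz.
have := nz _ zz; rewrite negb_and -!leNgt => /orP[za|bz].
  by rewrite (le_lt_trans za ax) (le_lt_trans za ay) !ltNge !ltW // (le_lt_trans za).
by rewrite (lt_le_trans xb bz) (lt_le_trans yb bz) !ltNge !ltW // (lt_le_trans _ bz).
Qed.

(** All roots of the derivative are marks, so it keeps its sign between the endpoints around [c1],
    and by the mean value theorem [p1] has opposite signs at the two endpoints. [p2] shares these
    signs and vanishes in between by the intermediate value theorem. *)
Lemma transfer_root (K1 K2 : rcfType) (zs : seq (K1 * K2)) (p1 : {poly K1}) (p2 : {poly K2}) c1 :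
  order_iso zs -> same_sign_on zs p1 p2 -> same_far_signs p1 p2 ->
  captures zs p1^`() p2^`() ->
  root p1 c1 -> (forall z, z \in zs -> z.1 != c1) ->
  exists2 c2, root p2 c2 & same_cell zs c1 c2.
Proof.
move=> oz ss ff [cap _] rc nz; have [x2 sz] := same_cell_exists c1 oz.
have [a1 [a2 [b1 [b2 [/andP[h1 h2] h2' h3 h4 h5]]]]] := cell_endpoints oz sz ss ff nz.
have pc0 : p1.[c1] = 0 by apply/eqP.
have nroot t : a1 < t < b1 -> ~~ root p1^`() t.
  by move=> tab; apply/negP => /cap[z zz zt]; have [] := h5 _ zz; rewrite zt tab.
have [r rac er] := poly_mvt p1 h1; have [s scb es] := poly_mvt p1 h2.
move: rac scb; rewrite !in_itv /= => /andP[ar rc'] /andP[cs sb].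
have rs : r <= s by rewrite ltW // (lt_trans rc').
have sg : sgz p1^`().[r] = sgz p1^`().[s].
  apply: noroot_sgz => // t /andP[rt ts]; apply: nroot.
  by rewrite (lt_le_trans ar rt) (le_lt_trans ts sb).
have sr : sgz p1^`().[r] = - sgz p1.[a1].
  by rewrite -sgzN -[- _]add0r -pc0 er sgzM (gtr0_sgz (_ : 0 < c1 - a1)) ?subr_gt0 ?mulr1.
have ss' : sgz p1^`().[s] = sgz p1.[b1].
  by rewrite -[p1.[b1]]subr0 -pc0 es sgzM (gtr0_sgz (_ : 0 < b1 - c1)) ?subr_gt0 ?mulr1.
have /andP[ax xb] := h2'; have ab2 : a2 <= b2 by rewrite ltW // (lt_trans ax xb).
have pneg : p2.[a2] * p2.[b2] < 0.
  have r0 : p1^`().[r] != 0.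
    by have := nroot r; rewrite ar (lt_trans rc' h2) => /(_ isT); rewrite /root.
  rewrite -sgz_lt0 sgzM -h3 -h4 -ss' -sg -[sgz p1.[a1]]opprK -sr mulNr oppr_lt0.
  by rewrite -expr2 exprn_even_gt0 //= sgz_eq0.
have [c2] := polyrcf.poly_ivtoo ab2 pneg; rewrite in_itv /= => cab rc2; exists c2 => //.
by apply: same_cell_within sz h2' cab _ => z /h5[].
Qed.

Lemma transfer_roots (K1 K2 : rcfType) (p1 : {poly K1}) (p2 : {poly K2}) (s : seq K1) (zs : seq (K1 * K2)) :
  order_iso zs -> same_sign_on zs p1 p2 -> same_far_signs p1 p2 ->
  captures zs p1^`() p2^`() -> all (root p1) s ->
  exists zs', [/\ {subset zs <= zs'}, order_iso zs', same_sign_on zs' p1 p2,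
    forall z, z \in zs' -> z \in zs \/ root p1 z.1 &
    forall x, x \in s -> exists2 z, z \in zs' & z.1 = x].
Proof.
move=> oz ss ff cap; elim: s => [_|c s IH /= /andP[rc /IH[zs' [sub oz' ss' new cs]]]].
  by exists zs; split=> // z; left.
case: (boolP (has (fun z : K1 * K2 => z.1 == c) zs')) => [/hasP[z zz /eqP e]|nh].
  exists zs'; split=> // x; rewrite in_cons => /orP[/eqP->|/cs//].
  by exists z.
have cap' : captures zs' p1^`() p2^`().
  by split=> x; [move=> /cap.1 | move=> /cap.2]; case=> z /sub; exists z.
have [c2 rc2 sc2] : exists2 c2, root p2 c2 & same_cell zs' c c2.
  apply: transfer_root rc _ => // z zz; apply/negP => e; case/hasP: nh; by exists z.
exists ((c, c2) :: zs'); split.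
- by move=> z /sub zz; rewrite in_cons zz orbT.
- exact: order_iso_cons.
- by move=> z; rewrite in_cons => /orP[/eqP-> /=|/ss'//]; rewrite (eqP rc) (eqP rc2) !sgz0.
- by move=> z; rewrite in_cons => /orP[/eqP-> /=|/new//]; right.
- move=> x; rewrite in_cons => /orP[/eqP->|/cs[z zz e]].
    by exists (c, c2); rewrite ?mem_head.
  by exists z; rewrite // in_cons zz orbT.
Qed.

(** The unmarked roots of [p1] are transferred to the second line, then those of [p2] to the first
    with the lines swapped. New marks are placed only at roots, a fact that the elimination
    reuses. *)
Lemma capture_roots (K1 K2 : rcfType) (p1 : {poly K1}) (p2 : {poly K2}) (zs : seq (K1 * K2)) :
  p1 != 0 -> p2 != 0 ->
  order_iso zs -> same_sign_on zs p1 p2 -> same_far_signs p1 p2 ->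
  captures zs p1^`() p2^`() ->
  exists zs', [/\ {subset zs <= zs'}, order_iso zs', same_sign_on zs' p1 p2,
    forall z, z \in zs' -> z \in zs \/ root p1 z.1 & captures zs' p1 p2].
Proof.
move=> p10 p20 oz ss ff cap.
have rootsE (K : rcfType) (p : {poly K}) : p != 0 -> forall x, (x \in rootsR p) = root p x.
  by move=> /roots_on_rootsR h x; rewrite -h in_itv.
have [|zs' [sub oz' ss' new cs]] := @transfer_roots _ _ p1 p2 (rootsR p1) zs oz ss ff cap.
  by apply/allP => x; rewrite rootsE.
have cap' : captures (map (@swap_pair _ _) zs') p2^`() p1^`().
  split=> x; [move=> /cap.2 | move=> /cap.1]; case=> z /sub zz e;
  by exists (swap_pair z); rewrite ?map_f.
have [|||//||zs2 [sub2 oz2 ss2 new2 cs2]] :=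
    @transfer_roots _ _ p2 p1 (rootsR p2) (map (@swap_pair _ _) zs').
- exact: order_iso_swap.
- by move=> z /mapP[t tz ->]; rewrite /= ss'.
- by case: ff => [f1 f2]; split=> B1 B2; [have := f1 B2 B1 | have := f2 B2 B1];
  case=> b2 [b1 [u v w]]; exists b1, b2.
- by apply/allP => x; rewrite rootsE.
have sub2' : {subset zs' <= map (@swap_pair _ _) zs2}.
  move=> z zz; apply/mapP; exists (swap_pair z); last by case: z {zz}.
  by apply: sub2; apply: map_f.
exists (map (@swap_pair _ _) zs2); split.
- by move=> z /sub /sub2'.
- exact: order_iso_swap.
- by move=> z /mapP[t tz ->]; rewrite /= ss2.
- move=> z /mapP[t tz ->]; have [/mapP[u uz ->]|rt] := new2 _ tz.
    by case: u uz => u1 u2 /=; apply: new.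
  right; rewrite /root -sgz_eq0 /= -ss2 //; by rewrite sgz_eq0.
- split=> x.
    rewrite -rootsE // => /cs[z /sub2' zz e]; by exists z.
  rewrite -rootsE // => /cs2[z zz e]; by exists (swap_pair z); rewrite ?map_f.
Qed.

Definition decides (K1 K2 : rcfType) (zs : seq (K1 * K2)) (p1 : {poly K1}) (p2 : {poly K2}) :=
  forall x1 x2, same_cell zs x1 x2 -> sgz p1.[x1] = sgz p2.[x2].

(** Off the marks neither polynomial vanishes on the cell, so its sign there is the sign at an
    endpoint that is not a root. The endpoints cannot both be roots: Rolle would give a root of the
    derivative inside, hence a mark. *)
Lemma captures_decides (K1 K2 : rcfType) (p1 : {poly K1}) (p2 : {poly K2}) (zs : seq (K1 * K2)) :
  order_iso zs -> same_sign_on zs p1 p2 -> same_far_signs p1 p2 ->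
  captures zs p1^`() p2^`() -> captures zs p1 p2 -> decides zs p1 p2.
Proof.
move=> oz ss ff cap' [cap1 cap2] x1 x2 sz.
case: (boolP (has (fun z : K1 * K2 => z.1 == x1) zs)) => [/hasP[z zz e]|nh].
  have := same_cell_eq sz zz; rewrite eq_sym e => /esym/eqP->.
  by rewrite -(eqP e) ss.
have nz z : z \in zs -> z.1 != x1.
  by move=> zz; apply/negP => e; case/hasP: nh; exists z.
have [a1 [a2 [b1 [b2 [/andP[h1 h2] /andP[k1 k2] h3 h4 h5]]]]] := cell_endpoints oz sz ss ff nz.
have nr1 t : a1 < t < b1 -> ~~ root p1 t.
  by move=> tab; apply/negP => /cap1[z zz zt]; have [] := h5 _ zz; rewrite zt tab.
have nr2 t : a2 < t < b2 -> ~~ root p2 t.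
  by move=> tab; apply/negP => /cap2[z zz zt]; have [] := h5 _ zz; rewrite zt tab.
have zero1 (a : K1) (b : K2) : sgz p1.[a] = sgz p2.[b] -> root p1 a = root p2 b.
  by move=> e; rewrite /root -sgz_eq0 e sgz_eq0.
case: (boolP (root p1 b1)) => rb.
  case: (boolP (root p1 a1)) => ra.
    have [|c] := poly_rolle (lt_trans h1 h2) (_ : p1.[a1] = p1.[b1]).
      by rewrite (eqP ra) (eqP rb).
    rewrite in_itv /= => cab /eqP /cap'.1[z zz e].
    by have [] := h5 _ zz; rewrite e cab.
  have ra2 : ~~ root p2 a2 by rewrite -(zero1 a1).
  rewrite -(noroot_sgz (ltW h1)) -?(noroot_sgz (ltW k1)) //.
    move=> t /andP[]; rewrite le_eqVlt => /orP[/eqP<-//|at'] tx.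
    by rewrite nr2 // at' (le_lt_trans tx k2).
  move=> t /andP[]; rewrite le_eqVlt => /orP[/eqP<-//|at'] tx.
  by rewrite nr1 // at' (le_lt_trans tx h2).
have rb2 : ~~ root p2 b2 by rewrite -(zero1 b1).
rewrite (noroot_sgz (ltW h2)) ?(noroot_sgz (ltW k2)) //.
  move=> t /andP[xt]; rewrite le_eqVlt => /orP[/eqP->//|tb].
  by rewrite nr2 // tb (lt_le_trans k1 xt).
move=> t /andP[xt]; rewrite le_eqVlt => /orP[/eqP->//|tb].
by rewrite nr1 // tb (lt_le_trans h1 xt).
Qed.

End OneMorePolynomial.

(** * Elimination of one variable *)

Section Projection.
Variable C : comNzRingType.
Implicit Types (p g b : {poly C}) (G Bs : seq {poly C}).

Definition truncp p := \poly_(i < (size p).-1) p`_i.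

(* Multiplying the pseudo-remainder by the same power of the leading coefficient makes it
   equal, at the roots of g, to p times a square. *)
Definition square_rem p g := (lead_coef g ^+ Pdiv.CommonRing.rscalp p g) *: Pdiv.CommonRing.rmodp p g.

(** Each nonconstant polynomial finds in the tail what determines its signs: its derivative for
    monotonicity, its truncation in case the leading coefficient specialises to 0, and its
    remainders for its signs at the roots of polynomials of the tail. *)
Fixpoint closed_list G : Prop :=
  if G is p :: G' then
    closed_list G' /\ ((1 < size p)%N ->
      [/\ p^`() \in G', truncp p \in G' &
          forall g, g \in G' -> (1 < size g)%N -> square_rem p g \in G'])
  else True.

Lemma size_square_rem p g : g != 0 -> (size (square_rem p g) < size g)%N.
Proof. by move=> g0; apply: leq_ltn_trans (size_scale_leq _ _) _; rewrite Pdiv.CommonRing.ltn_rmodp. Qed.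

Lemma closed_list_cat (bs G : seq {poly C}) : closed_list G ->
  (forall b, b \in bs -> [/\ b^`() \in G, truncp b \in G &
     forall g, g \in bs ++ G -> (1 < size g)%N -> square_rem b g \in G]) ->
  closed_list (bs ++ G).
Proof.
move=> cG; elim: bs => //= b bs IH H; split.
  apply: IH => c cb; have [|h1 h2 h3] := H c; first by rewrite in_cons cb orbT.
  by split=> // g gG; apply: h3; rewrite in_cons gG orbT.
have [|h1 h2 h3] := H b; first by rewrite mem_head.
move=> _; rewrite !mem_cat h1 h2 !orbT; split=> // g gG sg.
by rewrite mem_cat h3 ?orbT // in_cons gG orbT.
Qed.

(** Induction on the size bound. Polynomials of top size go to the front, and everything they
    require of the tail is smaller. [Bs] holds the larger polynomials already set aside, whose
    remainders by polynomials still to be generated must be included too. *)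
Lemma closed_list_exists s Bs G : (forall g, g \in G -> (size g <= s)%N) ->
  exists G', [/\ closed_list G', {subset G <= G'},
    forall g, g \in G' -> (size g <= s)%N &
    forall b g, b \in Bs -> g \in G' -> (1 < size g)%N -> square_rem b g \in G'].
Proof.
elim: s Bs G => [|s IH] Bs G sG.
  exists G; split=> // [|b g _ /sG]; last by case: (size g).
  by elim: G sG => //= p G IH sG; split; [apply: IH => g gG; apply: sG; rewrite in_cons gG orbT|
    have := sG p; rewrite mem_head => /(_ isT); case: (size p)].
pose bs := [seq g : {poly C} <- G | size g == s.+1].
have bsP b : b \in bs -> size b = s.+1 by rewrite mem_filter => /andP[/eqP].
have bs0 b : b \in bs -> b != 0 by move=> /bsP e; rewrite -size_poly_gt0 e.
pose G1 := [seq g : {poly C} <- G | (size g <= s)%N] ++ [seq b^`() | b <- bs] ++ [seq truncp b | b <- bs]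
   ++ [seq square_rem b b' | b <- Bs ++ bs, b' <- bs].
have [g|G' [cG' sub sG' rG']] := IH (Bs ++ bs) G1.
  rewrite !mem_cat => /or4P[||/mapP[b bb ->]|].
  - by rewrite mem_filter => /andP[].
  - by case/mapP=> b bb ->; rewrite -ltnS -(bsP b bb) lt_size_deriv // bs0.
  - by apply: leq_trans (size_poly _ _) _; rewrite (bsP b bb).
  - case/allpairsP=> [[b b'] /= [_ bb' ->]].
    by rewrite -ltnS -(bsP _ bb') size_square_rem // bs0.
have derG b : b \in bs -> b^`() \in G'.
  by move=> bb; apply: sub; rewrite !mem_cat (map_f (@deriv _)) // orbT.
have truG b : b \in bs -> truncp b \in G'.
  by move=> bb; apply: sub; rewrite !mem_cat (map_f truncp) // !orbT.
have remG b g : b \in Bs ++ bs -> g \in bs ++ G' -> (1 < size g)%N -> square_rem b g \in G'.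
  move=> bb; rewrite mem_cat => /orP[gb _|gG sg]; last exact: rG'.
  apply: sub; rewrite !mem_cat; apply/orP; right; apply/orP; right; apply/orP; right.
  by apply/allpairsP; exists (b, g).
exists (bs ++ G'); split.
- apply: closed_list_cat => // b bb; split; [exact: derG|exact: truG|] => g gG sg.
  by apply: remG => //; rewrite mem_cat bb orbT.
- move=> g gG; have := sG g gG; rewrite leq_eqVlt ltnS mem_cat => /orP[sg|sg].
    by rewrite mem_filter sg gG.
  by rewrite (sub g) ?orbT // mem_cat mem_filter sg gG.
- by move=> g; rewrite mem_cat => /orP[/bsP->//|/sG'/leqW].
- move=> b g bB gG sg; rewrite mem_cat remG ?orbT //; by rewrite mem_cat bB.
Qed.

Section Evaluations.
Variables (K1 K2 : rcfType) (chi1 : {rmorphism C -> K1}) (chi2 : {rmorphism C -> K2}).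

Lemma map_truncp (K : rcfType) (chi : {rmorphism C -> K}) p :
  chi (lead_coef p) = 0 -> map_poly chi p = map_poly chi (truncp p).
Proof.
move=> l0; apply/polyP => i; rewrite !coef_map /= coef_poly.
case: ltnP => // hi; rewrite [RHS]raddf0.
have [e|ne] := eqVneq i (size p).-1; first by rewrite e -lead_coefE l0.
rewrite nth_default ?raddf0 //; move: hi ne; case: (size p) => //= m.
by rewrite leq_eqVlt => /orP[/eqP->|//]; rewrite eqxx.
Qed.

Lemma sgz_square_rem (K : rcfType) (chi : {rmorphism C -> K}) p g y :
  chi (lead_coef g) != 0 -> root (map_poly chi g) y ->
  sgz (map_poly chi (square_rem p g)).[y] = sgz (map_poly chi p).[y].
Proof.
move=> l0 /eqP ry; have := congr1 (fun q => (map_poly chi q).[y]) (Pdiv.ComRing.rdivp_eq g p).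
rewrite rmorphD rmorphM /= map_polyZ /= !hornerE ry mulr0 add0r => e.
rewrite /square_rem map_polyZ /= hornerE -e mulrA sgzM -expr2 gtr0_sgz ?mul1r //.
by rewrite exprn_even_gt0 //= rmorphXn expf_neq0.
Qed.

(** The last clause drives the induction: at each mark some [g] of the tail vanishes with nonzero
    leading coefficient, so the new polynomial [p] has there the sign of [square_rem p g], which the
    tail already decides. *)
Lemma sign_diagram_exists G : closed_list G ->
  (forall g, g \in G -> sgz (chi1 (lead_coef g)) = sgz (chi2 (lead_coef g))) ->
  exists zs : seq (K1 * K2), [/\ order_iso zs,
    forall g, g \in G -> decides zs (map_poly chi1 g) (map_poly chi2 g),
    forall g, g \in G -> map_poly chi1 g != 0 ->
       captures zs (map_poly chi1 g) (map_poly chi2 g) &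
    forall z, z \in zs -> exists2 g, g \in G &
       [/\ (1 < size g)%N, chi1 (lead_coef g) != 0 & root (map_poly chi1 g) z.1]].
Proof.
elim: G => [_ _|p G IH /= [cG cp] sl]; first by exists [::]; split.
have [//||zs [oz dz cz tz]] := IH; first by move=> g gG; apply: sl; rewrite in_cons gG orbT.
have slp : sgz (chi1 (lead_coef p)) = sgz (chi2 (lead_coef p)) by apply: sl; rewrite mem_head.
have l0 : (chi1 (lead_coef p) == 0) = (chi2 (lead_coef p) == 0).
  by rewrite -sgz_eq0 slp sgz_eq0.
have tz' z : z \in zs -> exists2 g, g \in p :: G &
    [/\ (1 < size g)%N, chi1 (lead_coef g) != 0 & root (map_poly chi1 g) z.1].
  by move=> /tz[g gG h]; exists g; rewrite // in_cons gG orbT.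
case: (leqP (size p) 1) => [sp|sp].
  have pE : p = (lead_coef p)%:P by rewrite (size1_polyC sp) lead_coefC.
  exists zs; split=> // g; rewrite in_cons => /orP[/eqP->|/[dup] gG].
  - by rewrite pE !map_polyC => x1 x2 _; rewrite !hornerC.
  - exact: dz.
  - rewrite pE !map_polyC /= polyC_eq0 => c0; split=> x; rewrite rootC => /eqP e.
      by rewrite e eqxx in c0.
    by rewrite l0 e eqxx in c0.
  - exact: cz.
have [dG tG rG] := cp sp.
case: (eqVneq (chi1 (lead_coef p)) 0) => [e1|ne1].
  have e2 : chi2 (lead_coef p) = 0 by apply/eqP; rewrite -l0 e1.
  exists zs; split=> // g; rewrite in_cons => /orP[/eqP->|/[dup] gG].
  - by rewrite (map_truncp e1) (map_truncp e2); apply: dz.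
  - exact: dz.
  - by rewrite (map_truncp e1) (map_truncp e2); apply: cz.
  - exact: cz.
have ne2 : chi2 (lead_coef p) != 0 by rewrite -l0.
have p10 : map_poly chi1 p != 0 by rewrite -lead_coef_eq0 lead_coef_map_eq.
have p20 : map_poly chi2 p != 0 by rewrite -lead_coef_eq0 lead_coef_map_eq.
have ff : same_far_signs (map_poly chi1 p) (map_poly chi2 p).
  apply: same_far_signsP => //; first by rewrite !size_map_poly_id0.
  by rewrite !lead_coef_map_eq.
have ss : same_sign_on zs (map_poly chi1 p) (map_poly chi2 p).
  move=> z zz; have [g gG [sg lg rg]] := tz z zz.
  have lg2 : chi2 (lead_coef g) != 0.
    by rewrite -sgz_eq0 -sl ?sgz_eq0 // in_cons gG orbT.
  have rg2 : root (map_poly chi2 g) z.2.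
    by rewrite /root -sgz_eq0 -(dz g gG z.1 z.2 (oz _ zz)) sgz_eq0.
  rewrite -(sgz_square_rem p lg rg) -(sgz_square_rem p lg2 rg2).
  exact: dz (rG g gG sg) _ _ (oz _ zz).
have cd : captures zs (map_poly chi1 p)^`() (map_poly chi2 p)^`().
  rewrite !deriv_map; apply: cz => //; rewrite -deriv_map.
  have [m em] : exists m, size p = m.+2 by move: sp; case: (size p) => [|[|m]] // _; exists m.
  apply: contraNneq ne1 => d0; have := congr1 (fun q : {poly K1} => q`_m) d0.
  by rewrite coef0 coef_deriv coef_map lead_coefE em => /eqP; rewrite mulrn_eq0.
have [zs' [sub oz' ss' new cap]] := capture_roots p10 p20 oz ss ff cd.
have dmono q1 q2 : decides zs q1 q2 -> decides zs' q1 q2.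
  by move=> h x1 x2 sx; apply: h => z /sub /sx.
have cmono (q1 : {poly K1}) (q2 : {poly K2}) : captures zs q1 q2 -> captures zs' q1 q2.
  by case=> h1 h2; split=> x; [move=> /h1 | move=> /h2]; case=> z /sub; exists z.
exists zs'; split=> //.
- move=> g; rewrite in_cons => /orP[/eqP->|/dz/dmono//].
  by apply: captures_decides => //; apply: cmono.
- by move=> g; rewrite in_cons => /orP[/eqP->//|/cz h /h/cmono].
- move=> z /new[/tz'//|rz]; by exists p; rewrite ?mem_head.
Qed.

End Evaluations.

(** [H] consists of the leading coefficients of a closed list containing [G]: their signs fix the
    effective degrees and the behaviour at infinity, and the rest of the diagram follows along the
    list. *)
Lemma sign_projection G : exists H : seq C,
  forall (K1 K2 : rcfType) (chi1 : {rmorphism C -> K1}) (chi2 : {rmorphism C -> K2}),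
  (forall h, h \in H -> sgz (chi1 h) = sgz (chi2 h)) ->
  forall x1, exists x2, forall g, g \in G ->
    sgz (map_poly chi1 g).[x1] = sgz (map_poly chi2 g).[x2].
Proof.
have [|G' [cG sub _ _]] := @closed_list_exists (\max_(g <- G) size (polyseq g)) [::] G.
  by move=> g gG; rewrite (big_rem g gG) leq_maxl.
exists (map (@lead_coef C) G') => K1 K2 chi1 chi2 HH x1.
have [|zs [oz dz _ _]] := sign_diagram_exists (chi1 := chi1) (chi2 := chi2) cG.
  by move=> g gG; apply: HH; apply: map_f.
have [x2 sx] := same_cell_exists x1 oz; exists x2 => g /sub/dz; exact.
Qed.

End Projection.

(** * Elimination of all variables *)

Section MultivariateTransfer.

Lemma mmap_muni (C K : comNzRingType) (chi : {rmorphism C -> K}) n (v : 'I_n.+1 -> K)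
    (p : {mpoly C[n.+1]}) :
  mmap chi v p =
  (map_poly (mmap chi (fun i => v (widen_ord (leqnSn n) i))) (muni p)).[v ord_max].
Proof.
rewrite muniE rmorph_sum /= horner_sum [LHS]/mmap; apply: eq_bigr => m _.
rewrite map_polyZ /= map_polyXn hornerZ hornerXn mmapZ mmapX /mmap1.
rewrite big_ord_recr /= -mulrA; congr (_ * (_ * _)).
by apply: eq_bigr => i _; rewrite mnmE.
Qed.

(** The last variable is eliminated over the ring of polynomials in the others, and the induction is
    applied to the polynomials so obtained. [H] is chosen before the fields, so it serves every pair
    of specialisations. *)
Lemma sign_transfer n (C : comNzRingType) (G : seq {mpoly C[n]}) : exists H : seq C,
  forall (K1 K2 : rcfType) (chi1 : {rmorphism C -> K1}) (chi2 : {rmorphism C -> K2}),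
  (forall h, h \in H -> sgz (chi1 h) = sgz (chi2 h)) ->
  forall v1, exists v2, forall g, g \in G -> sgz (mmap chi1 v1 g) = sgz (mmap chi2 v2 g).
Proof.
elim: n C G => [|n IH] C G.
  exists [seq g@_0%MM | g : {mpoly C[0]} <- G] => K1 K2 chi1 chi2 HH v1.
  exists (fun=> 0) => g gG; rewrite [g]nvar0_mpolyC !mmapC; apply: HH.
  exact: map_f.
have [H1 h1] := sign_projection [seq muni g | g : {mpoly C[n.+1]} <- G].
have [H h] := IH C H1; exists H => K1 K2 chi1 chi2 HH v1.
pose w1 i := v1 (widen_ord (leqnSn n) i).
have [w2 hw] := h _ _ _ _ HH w1.
have [x2 hx] := h1 _ _ (mmap chi1 w1) (mmap chi2 w2) hw (v1 ord_max).
pose v2 (i : 'I_n.+1) := if unlift ord_max i is Some j then w2 j else x2.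
have v2w i : v2 (widen_ord (leqnSn n) i) = w2 i.
  rewrite /v2 (_ : widen_ord _ i = lift ord_max i) ?liftK //.
  by apply/val_inj; rewrite /= /bump leqNgt ltn_ord.
have v2m : v2 ord_max = x2 by rewrite /v2 unlift_none.
exists v2 => g gG; rewrite !mmap_muni v2m hx ?map_f //; congr (sgz _.[_]).
by apply: eq_map_poly => q; rewrite /mmap /mmap1; under [RHS]eq_bigr do under eq_bigr do rewrite v2w.
Qed.

End MultivariateTransfer.

(** * Real closed fields from prime cones *)

Section ZornAbove.
Local Open Scope classical_set_scope.

Lemma Zorn_above (T : Type) (good : set T -> Prop) (A : set T) : good A ->
  (forall F : set (set T), F !=set0 -> (forall X, F X -> good X) ->
     total_on F subset -> good (\bigcup_(X in F) X)) ->
  exists M, [/\ A `<=` M, good M & forall B, M `<=` B -> good B -> B `<=` M].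
Proof.
move=> gA chain; have [|X [gX mX]] := @Zorn_bigcup T (fun X => good (A `|` X)).
  move=> F FP tF; have [->|/set0P[X0 FX0]] := eqVneq F set0.
    by rewrite bigcup_set0 setU0.
  have -> : A `|` \bigcup_(X in F) X = \bigcup_(X in [set A `|` Y | Y in F]) X.
    apply/seteqP; split=> [x [Ax|[Y FY Yx]]|x [_ [Y FY <-]] [Ax|Yx]].
    - by exists (A `|` X0); [exists X0 | left].
    - by exists (A `|` Y); [exists Y | right].
    - by left.
    - by right; exists Y.
  apply: chain; first by exists (A `|` X0), X0.
    by move=> _ [Y FY <-]; apply: FP.
  move=> _ _ [Y FY <-] [Z FZ <-]; have [YZ|ZY] := tF _ _ FY FZ.
    by left; apply: setUS.
  by right; apply: setUS.
exists (A `|` X); split=> // B AXB gB.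
have AB : A `<=` B by move=> x Ax; apply: AXB; left.
have XB : X `<=` B by move=> x Xx; apply: AXB; right.
apply: contrapT => nB; apply: (mX B); last by have -> : A `|` B = B by apply/setUidPr.
by split=> // BX; apply: nB => x /BX; right.
Qed.

End ZornAbove.

Section FieldCones.
Local Open Scope classical_set_scope.
Variable K : fieldType.
Implicit Types P Q : set K.

(* The positive cones of preordered subfields of K; the subfield is P - P. *)
Record field_cone P : Prop := FieldCone {
  fcone0 : P 0;
  fcone1 : P 1;
  fconeD : forall x y, P x -> P y -> P (x + y);
  fconeM : forall x y, P x -> P y -> P (x * y);
  fconeV : forall x, P x -> P x^-1;
  fcone_sqrB : forall x y, P x -> P y -> P ((x - y) ^+ 2);
  fconeN1 : ~ P (- 1) }.

Lemma invr_sqr (z : K) : z^-1 = z * (z ^+ 2)^-1.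
Proof. by have [->|z0] := eqVneq z 0; rewrite ?invr0 ?mul0r //; field. Qed.

Lemma field_cone_maximal P : field_cone P ->
  exists M, [/\ P `<=` M, field_cone M & forall B, M `<=` B -> field_cone B -> B `<=` M].
Proof.
move=> cP; apply: Zorn_above => // F [X0 FX0] gF tF.
have both x y : (\bigcup_(X in F) X) x -> (\bigcup_(X in F) X) y ->
    exists2 X, F X & X x /\ X y.
  move=> [X FX Xx] [Y FY Yy]; have [XY|YX] := tF _ _ FX FY.
    by exists Y => //; split=> //; apply: XY.
  by exists X => //; split=> //; apply: YX.
split.
- by exists X0 => //; apply: fcone0 (gF _ FX0).
- by exists X0 => //; apply: fcone1 (gF _ FX0).
- by move=> x y hx hy; have [X FX [Xx Xy]] := both _ _ hx hy; exists X => //; apply: fconeD (gF _ FX) _ _ Xx Xy.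
- by move=> x y hx hy; have [X FX [Xx Xy]] := both _ _ hx hy; exists X => //; apply: fconeM (gF _ FX) _ _ Xx Xy.
- by move=> x [X FX Xx]; exists X => //; apply: fconeV (gF _ FX) _ Xx.
- by move=> x y hx hy; have [X FX [Xx Xy]] := both _ _ hx hy; exists X => //; apply: fcone_sqrB (gF _ FX) _ _ Xx Xy.
- by move=> [X FX]; apply: fconeN1 (gF _ FX).
Qed.

(** For a = x - y with -a outside P, the set P + aP is again a cone, so it equals P by maximality
    and contains a. It is closed under inverses because z^-1 = z (z^2)^-1 and z^2 has its inverse in
    P; and -1 = x + a y would put -a = (1 + x)/y into P. *)
Lemma maximal_field_cone_total P : field_cone P ->
  (forall B, P `<=` B -> field_cone B -> B `<=` P) ->
  forall x y, P x -> P y -> P (x - y) \/ P (y - x).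
Proof.
move=> cP mP p q Pp Pq; set a := p - q.
have [Pa|nPa] := pselect (P a); first by left.
have [PNa|nPNa] := pselect (P (q - p)); first by right.
pose Q := [set z | exists x y, [/\ P x, P y & z = x + a * y]].
have PQ : P `<=` Q by move=> x Px; exists x, 0; rewrite mulr0 addr0; split=> //; apply: (fcone0 cP).
have Qdiff z : Q z -> exists u v, [/\ P u, P v & z = u - v].
  move=> [x [y [Px Py ->]]]; exists (x + p * y), (q * y).
  by split; [apply: (fconeD cP) => //; apply: (fconeM cP)|apply: (fconeM cP)|rewrite /a; ring].
suff cQ : field_cone Q.
  by left; apply: (mP _ PQ cQ); exists 0, 1; rewrite mulr1 add0r; split=> //;
    [apply: (fcone0 cP)|apply: (fcone1 cP)].
have a2 : P (a ^+ 2) by apply: (fcone_sqrB cP).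
split.
- exact: PQ (fcone0 cP).
- exact: PQ (fcone1 cP).
- move=> _ _ [x [y [Px Py ->]]] [x' [y' [Px' Py' ->]]].
  exists (x + x'), (y + y'); split; [exact: (fconeD cP)|exact: (fconeD cP)|ring].
- move=> _ _ [x [y [Px Py ->]]] [x' [y' [Px' Py' ->]]].
  exists (x * x' + a ^+ 2 * (y * y')), (x * y' + x' * y); split; last by ring.
    by apply: (fconeD cP); [apply: (fconeM cP)|apply: (fconeM cP) => //; apply: (fconeM cP)].
  by apply: (fconeD cP); apply: (fconeM cP).
- move=> z Qz; have [u [v [Pu Pv ez]]] := Qdiff _ Qz; have [x [y [Px Py ez']]] := Qz.
  have Pw : P (z ^+ 2)^-1 by apply: (fconeV cP); rewrite ez //; apply: (fcone_sqrB cP).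
  exists (x * (z ^+ 2)^-1), (y * (z ^+ 2)^-1); split; [exact: (fconeM cP)|exact: (fconeM cP)|].
  by rewrite invr_sqr {1}ez'; ring.
- move=> z z' /Qdiff[u [v [Pu Pv ->]]] /Qdiff[u' [v' [Pu' Pv' ->]]]; apply: PQ.
  have -> : u - v - (u' - v') = (u + v') - (u' + v) by ring.
  by apply: (fcone_sqrB cP) => //; apply: (fconeD cP).
- move=> [x [y [Px Py e]]]; have [y0|y0] := eqVneq y 0.
    by apply: (fconeN1 cP); rewrite e y0 mulr0 addr0.
  apply: nPNa; have -> : q - p = (1 + x) * y^-1.
    by apply: (mulIf y0); rewrite mulfVK // -[x](addrK (a * y)) -e /a; ring.
  by apply: (fconeM cP); [apply: (fconeD cP) => //; apply: (fcone1 cP)|apply: (fconeV cP)].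
Qed.

End FieldCones.

Lemma size_sqr_modp (F : fieldType) (p q : {poly F}) : p != 0 ->
  (size ((q %% p) ^+ 2)%R <= size p + size p - 3)%N.
Proof.
move=> p0; apply: leq_trans (size_polyMleq _ _) _.
have : (size (q %% p)%R < size p)%N by rewrite ltn_modp.
by move: (size (q %% p)%R) (size p) => u v; lia.
Qed.

(** In degrees: a product of degree at most 2 deg p - 2 leaves a cofactor of degree below deg p.
    This makes the induction on the size of p possible. *)
Lemma size_cofactor (F : fieldType) (g p : {poly F}) : g != 0 -> p != 0 -> (2 < size p)%N ->
  (size (g * p)%R <= size p + size p - 3)%N -> (size g < size p)%N.
Proof. by move=> g0 p0; rewrite size_mul //; move: (size g) (size p) => u v; lia. Qed.

(** * The subfield ordered by a maximal cone is real closed *)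

Section RealClosure.
Local Open Scope classical_set_scope.
Variables (K : closedFieldType) (P : set K).
Hypothesis cP : field_cone P.
Hypothesis mP : forall B, P `<=` B -> field_cone B -> B `<=` P.

Let total_P := maximal_field_cone_total cP mP.

Definition cone_field : {pred K} := fun x => `[< P x \/ P (- x) >].

Lemma cone_fieldP x : reflect (P x \/ P (- x)) (x \in cone_field).
Proof. exact: asboolP. Qed.

Lemma cone_field_closed : divring_closed cone_field.
Proof.
split.
- by apply/cone_fieldP; left; apply: (fcone1 cP).
- move=> x y /cone_fieldP[Px|Px] /cone_fieldP[Py|Py]; apply/cone_fieldP.
  + by rewrite opprB; apply: total_P.
  + by left; apply: (fconeD cP).
  + by right; rewrite opprB addrC -[y]opprK opprK; rewrite addrC; apply: (fconeD cP).
  + by have := total_P Px Py; rewrite opprK opprB opprK [- x + y]addrC addrC [- y + x]addrC; tauto.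
- move=> x y hx hy; have hV : P (y^-1) \/ P (- y^-1).
    by case/cone_fieldP: hy => h; [left|right]; rewrite -?invrN; apply: (fconeV cP).
  case/cone_fieldP: hx => h; apply/cone_fieldP; case: hV => hV.
  + by left; apply: (fconeM cP).
  + by right; rewrite -mulrN; apply: (fconeM cP).
  + by right; rewrite -mulNr; apply: (fconeM cP).
  + by left; rewrite -mulrNN; apply: (fconeM cP).
Qed.

HB.instance Definition _ := GRing.isDivringClosed.Build K cone_field cone_field_closed.

Inductive cone_elt := ConeElt x & x \in cone_field.
Definition cone_val (u : cone_elt) := let: ConeElt x _ := u in x.

HB.instance Definition _ := [isSub for cone_val].
HB.instance Definition _ := [Choice of cone_elt by <:].
HB.instance Definition _ := [SubChoice_isSubIntegralDomain of cone_elt by <:].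
HB.instance Definition _ := [SubIntegralDomain_isSubField of cone_elt by <:].
Definition cone_le (x y : cone_elt) := `[< P (val y - val x) >].
Definition cone_norm (x : cone_elt) := if cone_le 0 x then x else - x.

Lemma cone_le0 x : cone_le 0 x = `[< P (val x) >].
Proof. by rewrite /cone_le /= subr0. Qed.

Lemma cone_anti (x : K) : P x -> P (- x) -> x = 0.
Proof.
move=> Px PNx; apply/eqP/negPn/negP => x0; apply: (fconeN1 cP).
have -> : -1 = - x * x^-1 by rewrite mulNr divff.
by apply: (fconeM cP) => //; apply: (fconeV cP).
Qed.

Fact cone_le0_add x y : cone_le 0 x -> cone_le 0 y -> cone_le 0 (x + y).
Proof. by rewrite !cone_le0 => /asboolP hx /asboolP hy; apply/asboolP/(fconeD cP). Qed.
Fact cone_le0_mul x y : cone_le 0 x -> cone_le 0 y -> cone_le 0 (x * y).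
Proof. by rewrite !cone_le0 => /asboolP hx /asboolP hy; apply/asboolP/(fconeM cP). Qed.
Fact cone_le0_anti x : cone_le 0 x -> cone_le x 0 -> x = 0.
Proof.
rewrite cone_le0 /cone_le /= sub0r => /asboolP hx /asboolP hy.
exact/val_inj/cone_anti.
Qed.
Fact cone_sub_ge0 x y : cone_le 0 (y - x) = cone_le x y.
Proof. by rewrite cone_le0. Qed.
Fact cone_le0_total x : cone_le 0 x || cone_le x 0.
Proof.
rewrite cone_le0 /cone_le /= sub0r; have /cone_fieldP := valP x.
by case=> h; apply/orP; [left|right]; apply/asboolP.
Qed.
Fact cone_normN x : cone_norm (- x) = cone_norm x.
Proof.
rewrite /cone_norm; have := cone_le0_total x.
have -> : cone_le 0 (- x) = cone_le x 0 by rewrite -[RHS]cone_sub_ge0 sub0r.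
case: ifP => h2; case: ifP => h1 //=; last by rewrite opprK.
by rewrite (cone_le0_anti h1 h2) oppr0.
Qed.
Fact cone_ge0_norm x : cone_le 0 x -> cone_norm x = x.
Proof. by rewrite /cone_norm => ->. Qed.

HB.instance Definition _ := Num.IntegralDomain_isLeReal.Build cone_elt
  cone_le0_add cone_le0_mul cone_le0_anti cone_sub_ge0 cone_le0_total
  cone_normN cone_ge0_norm (fun _ _ => erefl).

Local Notation L := cone_elt.

Lemma cone_ge0E (x : L) : (0 <= x) = `[< P (val x) >].
Proof. exact: cone_le0. Qed.

(** The weights are kept because a positive element of the ordered field is not yet known to be a
    square. *)
Definition weighted_sos (h : {poly L}) := exists2 s : seq (L * {poly L}),
  all (fun t => 0 <= t.1) s & h = \sum_(t <- s) t.1 *: t.2 ^+ 2.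

Lemma weighted_sosD h h' : weighted_sos h -> weighted_sos h' -> weighted_sos (h + h').
Proof.
by case=> s s0 -> [s' s0' ->]; exists (s ++ s'); rewrite ?all_cat ?s0 // big_cat.
Qed.

Lemma weighted_sosZ c h : 0 <= c -> weighted_sos (c *: h ^+ 2).
Proof. by move=> c0; exists [:: (c, h)]; rewrite /= ?c0 // big_seq1. Qed.

Lemma weighted_sosM h h' : weighted_sos h -> weighted_sos h' -> weighted_sos (h * h').
Proof.
case=> s s0 -> [s' s0' ->]; elim: s s0 => [|t s IH] /=.
  by rewrite big_nil mul0r; exists [::]; rewrite ?big_nil.
case/andP=> t0 /IH h1; rewrite big_cons mulrDl; apply: weighted_sosD => //.
elim: s' s0' {IH h1} => [|t' s' IH] /=.
  by rewrite big_nil mulr0; exists [::]; rewrite ?big_nil.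
case/andP=> t0' /IH h1; rewrite big_cons mulrDr; apply: weighted_sosD => //.
have -> : t.1 *: t.2 ^+ 2 * (t'.1 *: t'.2 ^+ 2) = (t.1 * t'.1) *: (t.2 * t'.2) ^+ 2.
  by rewrite -scalerAl -scalerAr scalerA exprMn.
by apply: weighted_sosZ; apply: mulr_ge0.
Qed.

Lemma weighted_sos_horner_ge0 h x : weighted_sos h -> 0 <= h.[x].
Proof.
case=> s /allP s0 ->; rewrite horner_sum big_seq; apply: sumr_ge0 => t ts.
by rewrite hornerZ horner_exp mulr_ge0 ?s0 ?sqr_ge0.
Qed.

Let ev (alpha : K) (h : {poly L}) : K := (map_poly val h).[alpha].

Let evD alpha h h' : ev alpha (h + h') = ev alpha h + ev alpha h'.
Proof. by rewrite /ev rmorphD hornerD. Qed.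
Let evB alpha h h' : ev alpha (h - h') = ev alpha h - ev alpha h'.
Proof. by rewrite /ev rmorphB hornerD hornerN. Qed.
Let evM alpha h h' : ev alpha (h * h') = ev alpha h * ev alpha h'.
Proof. by rewrite /ev rmorphM hornerM. Qed.
Let evC alpha c : ev alpha c%:P = val c.
Proof. by rewrite /ev map_polyC hornerC. Qed.

Let evZ alpha c h : ev alpha (c *: h) = val c * ev alpha h.
Proof. by rewrite -mul_polyC evM evC. Qed.
Let ev_sum alpha (s : seq (L * {poly L})) F :
  ev alpha (\sum_(t <- s) F t) = \sum_(t <- s) ev alpha (F t).
Proof. by apply: big_morph; [apply: evD | rewrite -[0]/(0%:P) evC]. Qed.

Lemma irreducible_root_dvdp (p h : {poly L}) alpha : irreducible_poly p ->
  ev alpha p = 0 -> ev alpha h = 0 -> (p %| h)%R.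
Proof.
move=> irr ep eh; apply/negPn/negP => nd.
have : coprimep p h by rewrite irreducible_poly_coprime.
case/Bezout_eq1_coprimepP => [[u v] /= e].
have := congr1 (ev alpha) e; rewrite evD !evM ep eh !mulr0 addr0 evC => /esym/eqP.
by rewrite oner_eq0.
Qed.

Lemma irreducible_ev_inv (p h : {poly L}) alpha : irreducible_poly p -> ev alpha p = 0 ->
  exists h', ev alpha h' = (ev alpha h)^-1.
Proof.
move=> irr ep; case: (boolP (p %| h)) => [/dvdpP[q ->]|nd].
  by exists 0; rewrite evM ep mulr0 invr0 -[0]/(0%:P) evC.
have : coprimep p h by rewrite irreducible_poly_coprime.
case/Bezout_eq1_coprimepP => [[u v] /= e]; exists v.
have := congr1 (ev alpha) e; rewrite evD !evM ep mulr0 add0r evC => e1.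
have h0 : ev alpha h != 0 by apply: contra_eq_neq e1 => ->; rewrite mulr0 eq_sym oner_neq0.
by apply: (mulIf h0); rewrite mulVf.
Qed.

(* If the ordering did not extend to L(alpha), then -1 would be a weighted sum of squares of
   polynomials modulo p, and the cofactor of p would be a polynomial of smaller degree with
   a sign change. *)
Lemma sign_change_reducible (p : {poly L}) a b : (2 < size p)%N -> p.[a] * p.[b] < 0 ->
  (forall q : {poly L}, (size q < size p)%N -> q.[a] * q.[b] < 0 -> exists c, root q c) ->
  ~ irreducible_poly p.
Proof.
move=> sp pab IH irr; have p0 := irredp_neq0 irr.
have /closed_rootP[alpha ra] : size (map_poly val p) != 1.
  by rewrite size_map_poly; case: (size p) sp => [|[|[]]].
have ep : ev alpha p = 0 by apply/eqP.
(* Values at alpha of weighted sums of squares: the candidate for an extension of the cone P to the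
   field generated by alpha. *)
pose Q := [set z | exists2 h, weighted_sos h & z = ev alpha h].
have sqQ h : Q (ev alpha h ^+ 2).
  by exists (1 *: h ^+ 2); [apply: weighted_sosZ|rewrite scale1r !expr2 evM].
have QV z : (exists h, z = ev alpha h) -> Q (z^-1 ^+ 2).
  by move=> [h ->]; have [h' <-] := irreducible_ev_inv h irr ep; apply: sqQ.
have PQ : P `<=` Q.
  move=> x Px; have Lx : x \in cone_field by apply/cone_fieldP; left.
  exists (ConeElt Lx)%:P; last by rewrite evC.
  have -> : (ConeElt Lx)%:P = ConeElt Lx *: 1 ^+ 2 by rewrite expr1n alg_polyC.
  by apply: weighted_sosZ; rewrite cone_ge0E; apply/asboolP.
have cQ : field_cone Q.
  split.
  - exact: PQ (fcone0 cP).
  - exact: PQ (fcone1 cP).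
  - by move=> _ _ [h wh ->] [h' wh' ->]; exists (h + h'); rewrite ?evD //; apply: weighted_sosD.
  - by move=> _ _ [h wh ->] [h' wh' ->]; exists (h * h'); rewrite ?evM //; apply: weighted_sosM.
  - move=> _ [h wh ->]; have [|h' wh' e] := QV (ev alpha h); first by exists h.
    exists (h * h'); first exact: weighted_sosM.
    by rewrite evM -e exprVn invr_sqr.
  - by move=> _ _ [h wh ->] [h' wh' ->]; rewrite -evB.
  - move=> [h [s s0 hE] e].
    pose h' := \sum_(t <- s) t.1 *: (t.2 %% p) ^+ 2.
    have wh' : weighted_sos h'.
      exists [seq (t.1, t.2 %% p) | t <- s]; last by rewrite big_map.
      by rewrite all_map.
    have dh : (p %| 1 + h').
      apply: (irreducible_root_dvdp irr ep).
      rewrite evD evC; suff -> : ev alpha h' = ev alpha h by rewrite -e addrN.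
      rewrite hE /h' !ev_sum; apply: eq_bigr => t _; rewrite !evZ !expr2 !evM.
      suff -> : ev alpha (t.2 %% p) = ev alpha t.2 by [].
      by rewrite {2}(divp_eq t.2 p) evD evM ep mulr0 add0r.
    have [g gE] := dvdpP _ _ dh.
    have pos x : 0 < (1 + h').[x].
      by rewrite hornerD hornerC ltr_pwDl // weighted_sos_horner_ge0.
    have g0 : g != 0.
      by apply: contraTneq (pos 0) => g0; rewrite gE g0 mul0r horner0 ltxx.
    have szh : (size (1 + h' : {poly L})%R <= size p + size p - 3)%N.
      apply: leq_trans (size_polyD _ _) _; rewrite size_poly1 geq_max.
      apply/andP; split; first by lia.
      apply: (big_ind (fun q : {poly L} => (size q <= (size p + size p) - 3)%N)).
      - by rewrite size_poly0.
      - by move=> q q' sq sq'; apply: leq_trans (size_polyD _ _) _; rewrite geq_max sq.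
      - move=> t _; apply: leq_trans (size_scale_leq _ _) _.
        exact: size_sqr_modp.
    have szg : (size g < size p)%N.
      by apply: size_cofactor g0 p0 sp _; rewrite -gE.
    have [|c rc] := IH g szg; last first.
      by have := pos c; rewrite gE hornerM (eqP rc) mul0r ltxx.
    have := mulr_gt0 (pos a) (pos b); rewrite gE !hornerM mulrACA => h1.
    by rewrite -(nmulr_lgt0 _ pab) // mulrC.
have : P alpha \/ P (- alpha).
  have e2 : (2 : L) != 0 by rewrite pnatr_eq0.
  have eX : ev alpha 'X = alpha by rewrite /ev map_polyX hornerX.
  (* This writes alpha as a difference of two squares of [Q], which lies inside [P] by maximality.
     So alpha belongs to the ordered subfield, and [p], of degree at least 2, has a linear factor
     there. *)
  have E : alpha = ev alpha (2^-1 *: ('X + 1)) ^+ 2 - ev alpha (2^-1 *: ('X - 1)) ^+ 2.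
    rewrite !expr2 -!evM -evB -!scalerAl -!scalerAr !scalerA -scalerBr evZ.
    have -> : ('X + 1) * ('X + 1) - ('X - 1) * ('X - 1) = (2 * 2) *: 'X :> {poly L}.
      by rewrite -mul_polyC polyCM -[2%:P]/(2%:R%:P) polyC_natr; ring.
    by rewrite evZ eX mulrA -rmorphM /= -invfM mulVf ?mulf_neq0 // mul1r.
  have /mP sub := PQ; have {}sub := sub cQ.
  have PA := sub _ (sqQ (2^-1 *: ('X + 1))); have PB := sub _ (sqQ (2^-1 *: ('X - 1))).
  by rewrite E opprB; apply: total_P.
move/cone_fieldP => La.
have rp : root p (ConeElt La).
  by rewrite /root -(inj_eq val_inj) -[val _]/(val (p.[_])) -horner_map /=; apply/eqP.
have := irr.2 ('X - (ConeElt La)%:P); rewrite size_XsubC => /(_ isT).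
rewrite dvdp_XsubCl rp => /(_ isT) /eqp_size; rewrite size_XsubC => e.
by rewrite -e in sp.
Qed.

(** Induction on the size: a linear polynomial is solved explicitly, a larger one is reducible, and
    one of its two factors must change sign between a and b. *)
Lemma sign_change_root (p : {poly L}) a b : a <= b -> p.[a] * p.[b] < 0 ->
  exists2 c, a <= c <= b & root p c.
Proof.
move=> ab; have [m] := ubnP (size p); elim: m p => // m IH p; rewrite ltnS => sp pab.
have [sp3|sp3] := ltnP 2 (size p); last first.
  have pE : p = p`_1 *: 'X + (p`_0)%:P.
    apply/polyP => -[|[|i]]; rewrite !coefE ?mulr0 ?add0r ?mulr1 ?addr0 //.
    by rewrite nth_default // (leq_trans sp3).
  have l0 : p`_1 != 0.
    apply: contraTneq pab => e; rewrite pE e scale0r add0r !hornerE -leNgt.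
    by rewrite -expr2 sqr_ge0.
  have pxE x : p.[x] = p`_1 * (x - (- p`_0 / p`_1)).
    by rewrite {1}pE !hornerE; field.
  exists (- p`_0 / p`_1); last by rewrite /root pxE subrr mulr0.
  move: pab; rewrite !pxE mulrACA pmulr_rlt0 -?expr2 ?exprn_even_gt0 // => h.
  have ha : a - - p`_0 / p`_1 < 0.
    by rewrite ltNge; apply/negP => h'; move: h; rewrite ltNge mulr_ge0 // (le_trans h') // lerB.
  by move: h; rewrite nmulr_rlt0 // subr_gt0 => hb; move: ha; rewrite subr_lt0 => ha; rewrite !ltW.
have red : ~ irreducible_poly p.
  apply: (sign_change_reducible sp3 pab) => q sq qab.
  by have [|c _ rc] := IH q _ qab; [apply: leq_trans sq sp|exists c].
have [q [q1 qp nqp]] : exists q : {poly L}, [/\ size q != 1, q %| p & ~~ (q %= p)].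
  apply: contrapT => nq; apply: red; split; first exact: leq_trans sp3.
  by move=> q q1 qp; apply/negPn/negP => nqp; apply: nq; exists q.
have p0 : p != 0 by rewrite -size_poly_gt0 (leq_trans _ sp3).
have [r pE] := dvdpP _ _ qp.
have q0 : q != 0 by apply: contraNneq p0 => q0; rewrite pE q0 mulr0.
have r0 : r != 0 by apply: contraNneq p0 => r0; rewrite pE r0 mul0r.
have sq : (size q < size p)%N by rewrite ltn_neqAle dvdp_leq // andbT dvdp_size_eqp.
have sr : (size r < size p)%N.
  rewrite pE size_mul //; move: q1; rewrite -size_poly_gt0 in q0.
  case: (size q) q0 => [|[|k]] // _ _; by rewrite !addnS /= ltnS leq_addr.
have : r.[a] * r.[b] * (q.[a] * q.[b]) < 0 by rewrite mulrACA -!hornerM -pE.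
have [qab _|qab h] := ltP (q.[a] * q.[b]) 0.
  have [|c cab rc] := IH q _ qab; first exact: leq_trans sq sp.
  by exists c; rewrite // pE rootM rc orbT.
have rab : r.[a] * r.[b] < 0.
  by rewrite ltNge; apply/negP => h'; move: h; rewrite ltNge mulr_ge0.
have [|c cab rc] := IH r _ rab; first exact: leq_trans sr sp.
by exists c; rewrite // pE rootM rc.
Qed.

Lemma cone_real_closed : Num.real_closed_axiom L.
Proof.
move=> p a b ab /andP[pa pb].
have [ra|ra] := boolP (root p a); first by exists a; rewrite ?lexx.
have [rb|rb] := boolP (root p b); first by exists b; rewrite ?lexx ?andbT.
apply: sign_change_root => //; rewrite nmulr_rlt0; last by rewrite lt_neqAle pa andbT.
by rewrite lt_neqAle eq_sym pb andbT.
Qed.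

HB.instance Definition _ := Num.RealField_isClosed.Build cone_elt cone_real_closed.

Lemma maximal_cone_rcf : exists (L : rcfType) (j : {rmorphism L -> K}),
  forall x, P x -> exists2 y, 0 <= y & j y = x.
Proof.
exists cone_elt, (\val : {rmorphism L -> K}) => x Px.
have Lx : x \in cone_field by apply/cone_fieldP; left.
by exists (ConeElt Lx : L); rewrite // cone_ge0E; apply/asboolP.
Qed.

End RealClosure.

Lemma field_cone_rcf (K : closedFieldType) (P : set K) : field_cone P ->
  exists (L : rcfType) (j : {rmorphism L -> K}), forall x, P x -> exists2 y, 0 <= y & j y = x.
Proof.
move=> /field_cone_maximal[M [PM cM mM]].
have [L [j hj]] := maximal_cone_rcf cM mM.
by exists L, j => x /PM/hj.
Qed.

(** * Residue fields of prime ideals in countable rings *)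

Record prime_ideal (B : comNzRingType) (I : set B) : Prop := PrimeIdeal {
  pideal0 : I 0;
  pidealD : forall a b, I a -> I b -> I (a + b);
  pidealM : forall a b, I b -> I (a * b);
  pideal1 : ~ I 1;
  pideal_prime : forall a b, I (a * b) -> I a \/ I b }.

Section ResidueField.
Local Open Scope quotient_scope.
Variables (B : comNzRingType) (code : B -> nat) (I : set B).
Hypothesis code_inj : injective code.
Hypothesis pI : prime_ideal I.

Let Ip : {pred B} := fun b => `[< I b >].

Let IpP b : reflect (I b) (b \in Ip).
Proof. exact: asboolP. Qed.

Lemma residue_ideal_closed : idealr_closed Ip.
Proof.
split; first exact/IpP/(pideal0 pI).
  by apply/IpP/(pideal1 pI).
by move=> a u v /IpP hu /IpP hv; apply/IpP/(pidealD pI) => //; apply: (pidealM pI).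
Qed.

Lemma residue_ideal_prime : prime_idealr_closed Ip.
Proof.
move=> u v /IpP/(pideal_prime pI)[h|h]; apply/orP; [left|right]; exact/IpP.
Qed.

HB.instance Definition _ := isIdealr.Build B Ip residue_ideal_closed.
HB.instance Definition _ := isPrimeIdealrClosed.Build B Ip residue_ideal_prime.

Definition residue_ring := {ideal_quot Ip}.
HB.instance Definition _ := GRing.ComNzRing.on residue_ring.

(** Units and inverses are chosen classically, only to give the residue domain the structure from
    which its fraction field is formed. *)
Definition residue_unit : {pred residue_ring} := fun x => `[< exists y, y * x = 1 >].

Definition residue_inv (x : residue_ring) : residue_ring :=
  if pselect (exists y, y * x = 1) is left h then sval (cid h) else x.

Lemma residue_mulVx : {in residue_unit, left_inverse 1 residue_inv *%R}.
Proof.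
move=> x /asboolP h; rewrite /residue_inv; case: pselect => // h'.
by case: (cid h').
Qed.

Lemma residue_unitPl x y : y * x = 1 -> residue_unit x.
Proof. by move=> e; apply/asboolP; exists y. Qed.

Lemma residue_inv_out : {in [predC residue_unit], residue_inv =1 id}.
Proof.
move=> x; rewrite inE => /asboolPn h; rewrite /residue_inv; by case: pselect.
Qed.

HB.instance Definition _ := GRing.ComNzRing_hasMulInverse.Build residue_ring
  residue_mulVx residue_unitPl residue_inv_out.
HB.instance Definition _ := GRing.ComUnitRing_isIntegral.Build residue_ring
  (@Quotient.rquot_IdomainAxiom B Ip).

Definition residue_field := {fraction residue_ring}.
HB.instance Definition _ := GRing.Field.on residue_field.

(** Coding the chosen representatives of numerator and denominator makes the residue field
    countable, the condition under which its algebraic closure is taken. *)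
Definition residue_code (x : residue_field) : nat :=
  pickle (code (repr (frac (repr x)).1), code (repr (frac (repr x)).2)).

Lemma residue_code_inj : injective residue_code.
Proof.
move=> x y /(pcan_inj pickleK) [] /code_inj e1 /code_inj e2.
rewrite -[x]reprK -[y]reprK; congr (\pi _); apply: val_inj => /=.
have {e1} e1 : (frac (repr x)).1 = (frac (repr y)).1.
  by rewrite -[LHS]reprK -[RHS]reprK e1.
have {e2} e2 : (frac (repr x)).2 = (frac (repr y)).2.
  by rewrite -[LHS]reprK -[RHS]reprK e2.
by case: (frac (repr x)) (frac (repr y)) e1 e2 => [? ?] [? ?] /= -> ->.
Qed.

Definition residue_decode (k : nat) : option residue_field :=
  if pselect (exists x, residue_code x = k) is left h then Some (sval (cid h)) else None.

Lemma residue_codeK : pcancel residue_code residue_decode.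
Proof.
move=> x; rewrite /residue_decode; case: pselect => [h|[]]; last by exists x.
by case: (cid h) => y /= /residue_code_inj ->.
Qed.

HB.instance Definition _ := Choice_isCountable.Build residue_field residue_codeK.

Lemma residue_closed_field : exists (K : closedFieldType) (chi : {rmorphism B -> K}),
  forall b, chi b = 0 <-> I b.
Proof.
have [K [j _]] := countable_algebraic_closure residue_field.
exists K, (j \o (@FracField.tofrac residue_ring) \o \pi_residue_ring)%FUN => b /=.
have -> : (j (@FracField.tofrac residue_ring (\pi_residue_ring b)) = 0) <-> (b \in Ip).
  rewrite (rwP eqP) fmorph_eq0 tofrac_eq0.
  by rewrite -(rmorph0 (\pi_residue_ring : {rmorphism B -> _})) -Quotient.idealrBE subr0.
by split=> /IpP.
Qed.

End ResidueField.

(** * Preorderings, prime cones and their real closed fields *)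

Section PrimeCones.
Local Open Scope classical_set_scope.
Variable A : comNzRingType.
Implicit Types (T P : set A) (a b : A).

Record preordering T : Prop := Preordering {
  preordX : forall a, T (a ^+ 2);
  preordD : forall a b, T a -> T b -> T (a + b);
  preordM : forall a b, T a -> T b -> T (a * b) }.

Record prime_cone P : Prop := PrimeCone {
  pconeD : forall a b, P a -> P b -> P (a + b);
  pconeM : forall a b, P a -> P b -> P (a * b);
  pcone_total : forall a, P a \/ P (- a);
  pconeN1 : ~ P (- 1);
  pcone_prime : forall a b, P (a * b) -> P (- (a * b)) ->
    P a /\ P (- a) \/ P b /\ P (- b) }.

Lemma preord0 T : preordering T -> T 0.
Proof. by move=> pT; have := preordX pT 0; rewrite expr0n. Qed.

Lemma preord1 T : preordering T -> T 1.
Proof. by move=> pT; have := preordX pT 1; rewrite expr1n. Qed.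

Definition adjoin T a : set A := [set x | exists s t, [/\ T s, T t & x = s + a * t]].

Lemma adjoin_sub T a : T 0 -> T `<=` adjoin T a.
Proof. by move=> T0 x Tx; exists x, 0; rewrite mulr0 addr0. Qed.

Lemma adjoin_gen T a : T 0 -> T 1 -> adjoin T a a.
Proof. by move=> T0 T1; exists 0, 1; rewrite mulr1 add0r. Qed.

Lemma preordering_adjoin T a : preordering T -> preordering (adjoin T a).
Proof.
move=> pT; split.
- by move=> x; apply: adjoin_sub (preord0 pT) _ (preordX pT _).
- move=> _ _ [s [t [Ts Tt ->]]] [s' [t' [Ts' Tt' ->]]]; exists (s + s'), (t + t').
  by split; [apply: (preordD pT)|apply: (preordD pT)|ring].
- move=> _ _ [s [t [Ts Tt ->]]] [s' [t' [Ts' Tt' ->]]].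
  exists (s * s' + a ^+ 2 * (t * t')), (s * t' + s' * t); split; last by ring.
    apply: (preordD pT); first exact: (preordM pT).
    by apply: (preordM pT); [apply: (preordX pT)|apply: (preordM pT)].
  by apply: (preordD pT); apply: (preordM pT).
Qed.

(** A proper preordering P that is maximal is a prime cone: if a lies outside P, then -1 is in P +
    aP. Two such identities, for a and -a or for two elements outside the support, multiply to an
    expression of -1 in P. *)
Lemma prime_cone_above T : preordering T -> ~ T (- 1) ->
  exists2 P, T `<=` P & prime_cone P.
Proof.
move=> pT T1; have [|F [X0 FX0] gF tF|P [TP [pP P1] mP]] :=
    @Zorn_above A (fun X => preordering X /\ ~ X (- 1)) T; first by [].
  have both x y : (\bigcup_(X in F) X) x -> (\bigcup_(X in F) X) y ->
      exists2 X, F X & X x /\ X y.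
    move=> [X FX Xx] [Y FY Yy]; have [XY|YX] := tF _ _ FX FY.
      by exists Y => //; split=> //; apply: XY.
    by exists X => //; split=> //; apply: YX.
  split; last by move=> [X FX]; apply: (gF _ FX).2.
  split.
  - by move=> a; exists X0 => //; apply: preordX (gF _ FX0).1 _.
  - move=> a b ha hb; have [X FX [Xa Xb]] := both _ _ ha hb; exists X => //.
    exact: preordD (gF _ FX).1 _ _ Xa Xb.
  - move=> a b ha hb; have [X FX [Xa Xb]] := both _ _ ha hb; exists X => //.
    exact: preordM (gF _ FX).1 _ _ Xa Xb.
have ext a : ~ P a -> adjoin P a (- 1).
  move=> na; apply: contrapT => no; apply: na; have [P0 P1'] := (preord0 pP, preord1 pP).
  apply: (mP (adjoin P a)); last exact: adjoin_gen.
    exact: adjoin_sub.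
  by split=> //; apply: preordering_adjoin.
have tot a : P a \/ P (- a).
  have [|na] := pselect (P a); [by left | right].
  apply: contrapT => nNa; have [s [t [Ps Pt e]]] := ext _ na.
  have [s' [t' [Ps' Pt' e']]] := ext _ nNa; apply: P1.
  have -> : - 1 = s + s' + s * s' + a ^+ 2 * (t * t').
    have e1 : a * t = - 1 - s by rewrite e addrC addKr.
    have e2 : a * t' = 1 + s'.
      by rewrite -[a * t']opprK -mulNr -[- a * t'](addKr s') -e'; ring.
    by rewrite expr2 mulrACA e1 e2; ring.
  apply: (preordD pP).
    by apply: (preordD pP); [apply: (preordD pP)|apply: (preordM pP)].
  by apply: (preordM pP); [apply: (preordX pP)|apply: (preordM pP)].
exists P => //; split=> //; [exact: preordD|exact: preordM|].
have inv a : ~ (P a /\ P (- a)) -> exists c s, P s /\ a * c = 1 + s.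
  move=> na; have [na'|na'] : ~ P a \/ ~ P (- a) by apply/not_andP.
    by have [s [t [Ps Pt e]]] := ext _ na'; exists (- t), s; split=> //;
      rewrite mulrN -[1]opprK e; ring.
  by have [s [t [Ps Pt e]]] := ext _ na'; exists t, s; split=> //; rewrite -[1]opprK e; ring.
move=> a b Pab PNab; have [|na] := pselect (P a /\ P (- a)); [by left | right].
apply: contrapT => nb; have [c [s [Ps e]]] := inv _ na; have [d [s' [Ps' e']]] := inv _ nb.
apply: P1; have -> : - 1 = s + s' + s * s' - a * b * (c * d).
  by rewrite mulrACA e e'; ring.
apply: (preordD pP); first by apply: (preordD pP); [apply: (preordD pP)|apply: (preordM pP)].
by have [h|h] := tot (c * d); [rewrite -mulNr|rewrite -mulrN]; apply: (preordM pP).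
Qed.

Lemma prime_cone_sqr P a : prime_cone P -> P (a ^+ 2).
Proof.
by move=> pP; have [h|h] := pcone_total pP a; [|rewrite -sqrrN]; apply: (pconeM pP).
Qed.

Lemma prime_cone0 P : prime_cone P -> P 0.
Proof. by move=> pP; have := prime_cone_sqr 0 pP; rewrite expr0n. Qed.

Lemma prime_cone1 P : prime_cone P -> P 1.
Proof. by move=> pP; have := prime_cone_sqr 1 pP; rewrite expr1n. Qed.

Lemma prime_cone_support P : prime_cone P -> prime_ideal [set a | P a /\ P (- a)].
Proof.
move=> pP; split=> /=.
- by rewrite oppr0; split; apply: prime_cone0.
- by move=> a b [ha ha'] [hb hb']; rewrite opprD; split; apply: (pconeD pP).
- move=> a b [hb hb']; have [h|h] := pcone_total pP a.
    by rewrite -mulrN; split; apply: (pconeM pP).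
  by rewrite -mulNr -mulrNN; split; apply: (pconeM pP).
- by case=> _; apply: (pconeN1 pP).
- by move=> a b [h1 h2]; apply: pcone_prime.
Qed.

End PrimeCones.

(** B is mapped to an algebraically closed field with kernel the support of P. Fractions with
    numerator in P and denominator in P outside the support form a cone there, and a real closed
    subfield above this cone contains the image of B, because every b has b or -b in P. *)
Lemma prime_cone_rcf (B : comNzRingType) (code : B -> nat) (P : set B) :
  injective code -> prime_cone P ->
  exists (L : rcfType) (chi : {rmorphism B -> L}), forall b, P b <-> 0 <= chi b.
Proof.
move=> cinj pP; have [K [chi kerchi]] := residue_closed_field cinj (prime_cone_support pP).
have nz b : ~ P (- b) -> chi b != 0.
  by move=> nb; apply/negP => /eqP /kerchi[_].
pose Q : set K := fun x => exists a b, [/\ P a, P b, ~ P (- b) & x = chi a / chi b].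
have PM b b' : P b -> P b' -> ~ P (- b) -> ~ P (- b') -> ~ P (- (b * b')).
  move=> Pb Pb' nb nb' h; have [] := pcone_prime pP (pconeM pP Pb Pb') h; by case.
have sub b : P b -> Q (chi b).
  move=> Pb; exists b, 1; rewrite rmorph1 divr1; split=> //; first exact: prime_cone1.
  exact: (pconeN1 pP).
have cQ : field_cone Q.
  split.
  - by rewrite -(rmorph0 chi); apply/sub/(prime_cone0 pP).
  - by rewrite -(rmorph1 chi); apply/sub/(prime_cone1 pP).
  - move=> _ _ [a [b [Pa Pb nb ->]]] [c [d [Pc Pd nd ->]]].
    exists (a * d + c * b), (b * d); split; [|exact: (pconeM pP)|exact: PM|].
      by apply: (pconeD pP); apply: (pconeM pP).
    by rewrite rmorphD !rmorphM addf_div ?nz.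
  - move=> _ _ [a [b [Pa Pb nb ->]]] [c [d [Pc Pd nd ->]]].
    exists (a * c), (b * d); split; [exact: (pconeM pP)|exact: (pconeM pP)|exact: PM|].
    by rewrite !rmorphM mulf_div.
  - move=> _ [a [b [Pa Pb nb ->]]]; have [Na|nNa] := pselect (P (- a)).
      have /kerchi -> : P a /\ P (- a) by [].
      by rewrite mul0r invr0 -(rmorph0 chi); apply/sub/(prime_cone0 pP).
    by exists b, a; rewrite invf_div.
  - move=> _ _ [a [b [Pa Pb nb ->]]] [c [d [Pc Pd nd ->]]].
    exists ((a * d - c * b) ^+ 2), ((b * d) ^+ 2).
    split; [exact: prime_cone_sqr|exact: prime_cone_sqr| |].
      by have Pbd := pconeM pP Pb Pd; rewrite expr2; apply: (PM) => //; apply: PM.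
    have [b0 d0] := (nz _ nb, nz _ nd).
    by rewrite !rmorphXn rmorphB !rmorphM /=; field; apply/andP.
  - move=> [a [b [Pa Pb nb e]]]; apply: (nb).
    have h : chi (a + b) = 0.
      by rewrite rmorphD; apply: (mulIf (invr_neq0 (nz _ nb))); rewrite mulrDl -e divff ?nz // mul0r addNr.
    have /kerchi[_ h2] := h; have -> : - b = a - (a + b) by ring.
    exact: (pconeD pP).
have [L [j hj]] := field_cone_rcf cQ.
have ex b : exists y, j y = chi b.
  have [/sub/hj[y _ e]|/sub/hj[y _ e]] := pcone_total pP b; first by exists y.
  by exists (- y); rewrite rmorphN e rmorphN opprK.
have [g gE] := boolp.choice ex; have jI := fmorph_inj j.
have gB : zmod_morphism g by move=> a b; apply: jI; rewrite rmorphB !gE rmorphB.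
have gM : monoid_morphism g.
  by split=> [|a b]; apply: jI; rewrite ?rmorph1 ?rmorphM !gE ?rmorph1 ?rmorphM.
pose gA := GRing.isZmodMorphism.Build _ _ g gB; pose gC := GRing.isMonoidMorphism.Build _ _ g gM.
pose G : {rmorphism B -> L} := HB.pack g gA gC.
have pos b : P b -> 0 <= g b.
  by move=> /sub/hj[y y0 e]; rewrite (_ : g b = y) //; apply: jI; rewrite gE e.
exists L, G => b; split; first exact: pos.
move=> gb; have [//|Nb] := pcone_total pP b.
have gb0 : g b = 0.
  by apply/eqP; rewrite eq_le gb -oppr_ge0 -[- g b](rmorphN G) pos.
by have /kerchi[] : chi b = 0 by rewrite -gE gb0 rmorph0.
Qed.

(** * The Positivstellensatz *)

Section Positivstellensatz.
Local Open Scope classical_set_scope.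

Lemma mpoly_rmorph_ext n (R : comNzRingType) (S : comNzRingType)
    (F G : {rmorphism {mpoly R[n]} -> S}) :
  (forall c, F c%:MP = G c%:MP) -> (forall i, F 'X_i = G 'X_i) -> F =1 G.
Proof.
move=> hC hX p; rewrite [p]mpolyE !rmorph_sum; apply: eq_bigr => m _.
rewrite -mul_mpolyC !rmorphM hC mpolyXE_id !rmorph_prod; congr (_ * _).
by apply: eq_bigr => i _; rewrite !rmorphXn hX.
Qed.

Lemma mpoly_alg_ind n (R : comNzRingType) (E : {mpoly R[n]} -> Prop) :
  (forall c, E c%:MP) -> (forall i, E 'X_i) ->
  (forall g h, E g -> E h -> E (g + h)) -> (forall g h, E g -> E h -> E (g * h)) ->
  forall g, E g.
Proof.
move=> EC EX ED EM g; have E1 : E 1 by exact: (EC 1).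
rewrite [g]mpolyE; apply: (big_ind E) => [|//|m _]; first by rewrite -(mpolyC0 n R).
rewrite -mul_mpolyC; apply: (EM) => //; rewrite mpolyXE_id.
apply: (big_ind E) => // i _; elim: (m i) => [|k IHk]; first by rewrite expr0.
by rewrite exprS; apply: EM.
Qed.

Lemma mpoly_code n (K : comNzRingType) (code : K -> nat) : injective code ->
  exists code' : {mpoly K[n]} -> nat, injective code'.
Proof.
move=> ci; exists (fun p => pickle [seq (m, code p@_m) | m <- msupp p]).
move=> p q /(pcan_inj pickleK) e; apply/mpolyP => m.
have sub (p1 p2 : {mpoly K[n]}) :
    [seq (m, code p1@_m) | m <- msupp p1] = [seq (m, code p2@_m) | m <- msupp p2] ->
    m \in msupp p1 -> p1@_m = p2@_m.
  move=> e' mp; have : (m, code p1@_m) \in [seq (m, code p2@_m) | m <- msupp p2].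
    by rewrite -e'; apply/mapP; exists m.
  by case/mapP => m' _ [<-] /ci.
have [mp|mp] := boolP (m \in msupp p); first exact: sub.
have [mq|mq] := boolP (m \in msupp q); first exact/esym/sub.
by rewrite !memN_msupp_eq0.
Qed.

Lemma prime_cone_preimage (A B : comNzRingType) (theta : {rmorphism B -> A}) (P : set A) :
  prime_cone P -> prime_cone [set b | P (theta b)].
Proof.
move=> pP; split=> /= [a b|a b|a||a b].
- by rewrite rmorphD; apply: (pconeD pP).
- by rewrite rmorphM; apply: (pconeM pP).
- by rewrite rmorphN; apply: (pcone_total pP).
- by rewrite rmorphN rmorph1; apply: (pconeN1 pP).
- by rewrite !rmorphN rmorphM; apply: (pcone_prime pP).
Qed.

(** The parameters [c] list all coefficients of the polynomials, so that each polynomial is a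
    specialisation of one over Z[c_1, ..., c_m], a countable ring. *)
Lemma mpoly_parameters (R : rcfType) n (gs : seq {mpoly R[n]}) :
  exists (m : nat) (c : 'I_m -> R), forall g, g \in gs ->
    exists b : {mpoly {mpoly int[m]}[n]}, mmap ((@mpolyC n R) \o mmap intr c) (fun i => 'X_i) b = g.
Proof.
pose s := flatten [seq [seq g@_mm | mm <- msupp g] | g : {mpoly R[n]} <- gs].
exists (size s), (fun i => s`_i) => g gG.
pose idx (x : R) : {mpoly int[size s]} :=
  if insub (index x s) is Some i then 'X_i else 0.
exists (\sum_(mm <- msupp g) (idx g@_mm)%:MP * 'X_[mm]).
rewrite rmorph_sum /= [RHS]mpolyE big_seq [RHS]big_seq; apply: eq_bigr => mm mg.
have xs : g@_mm \in s.
  by apply/flattenP; exists [seq g@_mm | mm <- msupp g]; apply/mapP; [exists g | exists mm].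
rewrite rmorphM /= mmapC mmapX mmap1_id /= mul_mpolyC; congr (_ *: _).
rewrite /idx; case: insubP => [i _ iE|]; last by rewrite index_mem xs.
by rewrite mmapX mmap1U iE nth_index.
Qed.

(** The variables, read in the real closed field of a prime cone above T, form a point at which all
    of [gs] are nonnegative. Sign transfer turns it into a point of R^n. *)
Theorem positivstellensatz (R : rcfType) n (T : set {mpoly R[n]}) (gs : seq {mpoly R[n]}) :
  preordering T -> ~ T (- 1) -> (forall g, g \in gs -> T g) ->
  exists u : 'I_n -> R, forall g, g \in gs -> 0 <= g.@[u].
Proof.
move=> pT T1 gT; have [P TP pP] := prime_cone_above pT T1.
have [m [c cE]] := mpoly_parameters gs.
pose K0 : comNzRingType := {mpoly int[m]}.
pose iota : {rmorphism K0 -> R} := mmap intr c.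
pose theta : {rmorphism {mpoly K0[n]} -> {mpoly R[n]}} :=
  mmap ((@mpolyC n R) \o iota) (fun i => 'X_i).
have thetaC h : theta h%:MP = (iota h)%:MP by rewrite /theta /= mmapC.
have thetaX i : theta 'X_i = 'X_i by rewrite /theta /= mmapX mmap1U.
have [codeK codeK_inj] := @mpoly_code m int pickle (pcan_inj pickleK).
have [codeB codeB_inj] := @mpoly_code n K0 codeK codeK_inj.
have [L [chi chiE]] := prime_cone_rcf codeB_inj (prime_cone_preimage theta pP).
have [f fE] : exists f : {mpoly R[n]} -> {mpoly K0[n]}, forall g, g \in gs -> theta (f g) = g.
  have /boolp.choice[f fE] : forall g, exists b, g \in gs -> theta b = g.
    move=> g; have [gG|_] := boolP (g \in gs); last by exists 0.
    by have [b <-] := cE g gG; exists b.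
  by exists f.
have [H HE] := sign_transfer [seq f g | g <- gs].
pose chi1 : {rmorphism K0 -> L} := chi \o @mpolyC n K0.
(* Nonnegative reals are squares, so [P] orders the constants as R does. *)
have Ppos (r : R) : 0 <= r -> P r%:MP.
  move=> r0; rewrite -(sqr_sqrtr r0) rmorphXn; exact: prime_cone_sqr.
(* Strictness: if h had image 0 in L, the negative of the positive real [iota h] would be in [P],
   and dividing by this real would put -1 there. *)
have chi_pos h : 0 < iota h -> 0 < chi1 h.
  move=> h0; rewrite lt_neqAle; apply/andP; split; last first.
    by rewrite -chiE /= thetaC; apply/Ppos/ltW.
  apply/negP => /eqP e.
  have : P (theta (- h%:MP)) by apply/chiE; rewrite rmorphN -[chi _]/(chi1 h) -e oppr0.
  rewrite rmorphN thetaC => PN; apply: (pconeN1 pP).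
  have -> : -1 = (iota h)^-1%:MP * - (iota h)%:MP :> {mpoly R[n]}.
    by rewrite mulrN -mpolyCM mulVf ?gt_eqF.
  by apply: (pconeM pP) => //; apply: Ppos; rewrite invr_ge0 ltW.
have [h|u uE] := HE _ _ chi1 iota _ (fun i => chi 'X_i).
  move=> _; case: (sgzP (iota h)) => [e0|h0|h0].
  - suff -> : chi1 h = 0 by rewrite sgz0.
    have e1 : 0 <= chi1 h by rewrite -chiE /= thetaC e0; apply: Ppos.
    apply/eqP; rewrite eq_le e1 andbT -oppr_ge0 -rmorphN.
    by rewrite -chiE /= thetaC rmorphN e0 oppr0; apply: Ppos.
  - by rewrite gtr0_sgz ?chi_pos.
  - rewrite ltr0_sgz // -oppr_gt0 -rmorphN; apply: chi_pos.
    by rewrite rmorphN oppr_gt0.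
exists u => g gG; have := uE (f g) (map_f _ gG).
have -> : mmap chi1 (fun i => chi 'X_i) (f g) = chi (f g).
  apply: (mpoly_rmorph_ext (F := mmap chi1 (fun i => chi 'X_i)) (G := chi)) => [h|i] /=.
    by rewrite mmapC.
  by rewrite mmapX mmap1U.
have -> : mmap iota u (f g) = g.@[u].
  rewrite -{2}(fE g gG).
  apply: (mpoly_rmorph_ext (F := mmap iota u) (G := meval u \o theta)) => [h|i] /=.
    by rewrite mmapC -[mmap _ _ _]/(theta _) thetaC mevalC.
  by rewrite mmapX mmap1U -[mmap _ _ _]/(theta _) thetaX mevalXU.
move=> e; rewrite -sgz_ge0 -e sgz_ge0 -chiE /= fE //.
exact/TP/gT.
Qed.

End Positivstellensatz.

(** * Algebraicity of the objective on the critical variety *)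

Section Ideals.
Local Open Scope classical_set_scope.
Variable A : comNzRingType.
Implicit Types (I J W : set A).

Record ideal_set I : Prop := IdealSet {
  ideal0 : I 0;
  idealD : forall a b, I a -> I b -> I (a + b);
  idealM : forall a b, I b -> I (a * b) }.

Lemma prime_ideal_ideal I : prime_ideal I -> ideal_set I.
Proof. by case=> h1 h2 h3 _ _. Qed.

Lemma idealMl I a b : ideal_set I -> I a -> I (a * b).
Proof. by move=> hI Ia; rewrite mulrC; apply: idealM. Qed.

Lemma idealN I a : ideal_set I -> I a -> I (- a).
Proof. by move=> hI Ia; rewrite -mulN1r; apply: idealM. Qed.

Lemma idealB I a b : ideal_set I -> I a -> I b -> I (a - b).
Proof. by move=> hI Ia Ib; apply: idealD => //; apply: idealN. Qed.

Lemma ideal_sum I (T : Type) (r : seq T) (P : pred T) (F : T -> A) : ideal_set I ->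
  (forall t, P t -> I (F t)) -> I (\sum_(t <- r | P t) F t).
Proof.
by move=> hI hF; apply: big_ind => //; [apply: ideal0|move=> x y; apply: idealD].
Qed.

Lemma prime_ideal_avoiding J W : ideal_set J -> W 1 ->
  (forall a b, W a -> W b -> W (a * b)) -> (forall a, J a -> ~ W a) ->
  exists I, [/\ J `<=` I, prime_ideal I & forall a, I a -> ~ W a].
Proof.
move=> hJ W1 WM JW; have [|F [X0 FX0] gF tF|I [JI [hI IW] mI]] :=
    @Zorn_above A (fun X => ideal_set X /\ forall a, X a -> ~ W a) J; first by [].
  split; last by move=> a [X FX Xa]; apply: (gF _ FX).2.
  split.
  - by exists X0 => //; apply: ideal0 (gF _ FX0).1.
  - move=> a b [X FX Xa] [Y FY Yb]; have [XY|YX] := tF _ _ FX FY.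
      by exists Y => //; apply: idealD (gF _ FY).1 _ _ (XY _ Xa) Yb.
    by exists X => //; apply: idealD (gF _ FX).1 _ _ Xa (YX _ Yb).
  - by move=> a b [X FX Xb]; exists X => //; apply: idealM (gF _ FX).1 _ _ Xb.
have ext a : ~ I a -> exists i x, I i /\ W (i + a * x).
  move=> nIa; apply: contrapT => no; apply: nIa.
  pose I' := [set z | exists i x, I i /\ z = i + a * x].
  apply: (mI I') => //.
  - by move=> z Iz; exists z, 0; rewrite mulr0 addr0.
  - split; last by move=> _ [i [x [Ii ->]]] Wz; apply: no; exists i, x.
    split.
    + by exists 0, 0; rewrite mulr0 addr0; split=> //; apply: ideal0.
    + move=> _ _ [i [x [Ii ->]]] [j [y [Ij ->]]]; exists (i + j), (x + y).
      by split; [apply: idealD|ring].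
    + move=> b _ [i [x [Ii ->]]]; exists (b * i), (b * x).
      by split; [apply: idealM|ring].
  - by exists 0, 1; rewrite mulr1 add0r; split=> //; apply: ideal0.
exists I; split=> //; split; [exact: ideal0|exact: idealD|exact: idealM| |].
  by move=> /IW; apply.
move=> a b Iab; have [|na] := pselect (I a); [by left | right].
apply: contrapT => nb; have [i [x [Ii Wi]]] := ext _ na; have [j [y [Ij Wj]]] := ext _ nb.
apply: (IW ((i + a * x) * (j + b * y))); last exact: WM.
have -> : (i + a * x) * (j + b * y) = (j + b * y) * i + (a * x) * j + (x * y) * (a * b) by ring.
by apply: idealD => //; [apply: idealD => //; apply: idealM|apply: idealM].
Qed.

End Ideals.

(** * Extending derivations modulo a prime ideal *)

Section DerivationExtension.
Variables (C A : comNzRingType) (phi : {rmorphism C -> A}) (Delta : {additive C -> A}).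
Variables (I : set A) (x : A).
Hypothesis pI : prime_ideal I.
Hypothesis char0 : forall k a, I (a *+ k.+1) -> I a.
Hypothesis Leibniz : forall a b, Delta (a * b) = phi a * Delta b + phi b * Delta a.
Hypothesis Delta_ker : forall c, I (phi c) -> I (Delta c).
Implicit Types p q r s : {poly C}.

Let hI := prime_ideal_ideal pI.
Let ev q := (map_poly phi q).[x].

(** A leading term whose coefficient maps into I changes the value at x only by an element of I.
    Such terms are dropped until the leading coefficient survives modulo I. *)
Lemma annihilator_nonzero_lead q i : I (ev q) -> ~ I (phi q`_i) ->
  exists p, [/\ I (ev p), ~ I (phi (lead_coef p)) & (size p <= size q)%N].
Proof.
have [m] := ubnP (size q); elim: m q => // m IH q; rewrite ltnS => sq Iq nIi.
have [Il|nIl] := pselect (I (phi (lead_coef q))); last by exists q.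
have q0 : (0 < size q)%N.
  rewrite lt0n; apply: contra_notN nIi => /eqP s0.
  by rewrite nth_default ?s0 // rmorph0; apply: ideal0.
pose q' := q - (lead_coef q)%:P * 'X^((size q).-1).
have sq' : (size q' < size q)%N.
  rewrite -(prednK q0) ltnS; apply/leq_sizeP => j hj.
  rewrite coefB mul_polyC coefZ coefXn; have [->|ne] := eqVneq j (size q).-1.
    by rewrite mulr1 subrr.
  rewrite mulr0 subr0 nth_default // -(prednK q0); move: hj; rewrite leq_eqVlt eq_sym.
  by rewrite (negbTE ne).
have [|||p [h1 h2 h3]] := IH q'.
- exact: leq_trans sq' sq.
- rewrite /ev rmorphB rmorphM /= map_polyC /= map_polyXn hornerD hornerN hornerM hornerC.
  by apply: idealB => //; apply: idealMl.
- rewrite coefB mul_polyC coefZ rmorphB rmorphM /= => h; apply: nIi.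
  rewrite -[phi _](subrK (phi (lead_coef q) * phi ('X^((size q).-1))`_i)).
  by apply: idealD => //; apply: idealMl.
by exists p; split=> //; apply: leq_trans h3 (ltnW sq').
Qed.

(** The derivation of C[X], along evaluation at x, that extends w Delta and sends X to xi; w clears
    the denominator of the value that Delta would force on X. *)
Let E w xi q := w * (map_poly Delta q).[x] + xi * (map_poly phi q)^`().[x].

Let map_polyM_Delta q r : map_poly Delta (q * r) =
  map_poly phi q * map_poly Delta r + map_poly phi r * map_poly Delta q.
Proof.
apply/polyP => i; rewrite coefD [map_poly phi r * _]mulrC !coefM coef_map /= coefM raddf_sum.
rewrite -big_split /=; apply: eq_bigr => j _.
by rewrite !coef_map /= Leibniz [phi r`_ _ * _]mulrC.
Qed.

Lemma evaluation_derivationM w xi q r :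
  E w xi (q * r) = ev q * E w xi r + ev r * E w xi q.
Proof.
rewrite /E /ev map_polyM_Delta rmorphM /= derivM !hornerD !hornerM; ring.
Qed.

Lemma evaluation_derivationD w xi q r : E w xi (q + r) = E w xi q + E w xi r.
Proof. by rewrite /E !raddfD /= !hornerD; ring. Qed.

Lemma ideal_horner (p : {poly A}) y : (forall i, I p`_i) -> I p.[y].
Proof. by move=> h; rewrite horner_coef; apply: ideal_sum => // i _; apply: idealMl. Qed.

Lemma evaluation_derivation_coef w xi q : (forall i, I (phi q`_i)) -> I (E w xi q).
Proof.
move=> h; apply: idealD => //; apply: idealM => //; apply: ideal_horner => i.
  by rewrite coef_map /=; apply: Delta_ker.
by rewrite coef_deriv coef_map /= -mulr_natr; apply: idealMl.
Qed.

(* When x is algebraic modulo I, with minimal equation p, the value of the extended derivation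
   at x is forced up to the common factor w = p'(x). *)
Lemma derivation_extension : exists w xi, ~ I w /\ forall q, I (ev q) -> I (E w xi q).
Proof.
have [all|] := pselect (forall q, I (ev q) -> forall i, I (phi q`_i)).
  (* x is transcendental modulo I here: X may be sent anywhere, and 0 is taken. *)
  exists 1, 0; split; first exact: (pideal1 pI).
  by move=> q /all; apply: evaluation_derivation_coef.
move=> /existsNP[q0 /not_implyP[Iq0 /existsNP[i0 nI0]]].
pose good d := `[< exists p, [/\ I (ev p), ~ I (phi (lead_coef p)) & size p = d] >].
have exg : exists d, good d.
  have [p [h1 h2 _]] := annihilator_nonzero_lead Iq0 nI0.
  by exists (size p); apply/asboolP; exists p.
case: (ex_minnP exg) => d /asboolP[p [Ip nIl sp]] dmin.
have small q : I (ev q) -> (size q < d)%N -> forall i, I (phi q`_i).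
  move=> Iq sq i; apply: contrapT => nIi.
  have [r [h1 h2 h3]] := annihilator_nonzero_lead Iq nIi.
  have : good (size r) by apply/asboolP; exists r.
  by move=> /dmin; rewrite leqNgt (leq_ltn_trans h3 sq).
have d2 : (1 < d)%N.
  rewrite ltnNge; apply/negP => d1; apply: nIl; move: Ip.
  by rewrite /ev (size1_polyC (_ : size p <= 1)%N) ?sp // lead_coefC map_polyC hornerC.
exists (ev p^`()), (- (map_poly Delta p).[x]); split.
  (* If p'(x) were in I, minimality of d would send all coefficients of p' into I, in particular d -
     1 times the leading coefficient of p; [char0] removes the integer. *)
  move=> Iw; have := small _ Iw; rewrite -sp lt_size_deriv; last first.
    by rewrite -size_poly_gt0 sp ltnW.
  move=> /(_ isT d.-2); rewrite coef_deriv raddfMn /=.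
  have -> : d.-2.+1 = (size p).-1 by rewrite sp; case: (d) d2 => [|[]].
  rewrite -lead_coefE; move: d2; rewrite -sp; case: (size p) => [|[|k]] //= _.
  by move=> /char0.
set w := ev _; set xi := - _; move=> q Iq.
(* The value xi is chosen to kill p. Pseudo-division by p then reduces q to a remainder that is too
   short to have a coefficient outside the preimage of I. *)
have Ep : E w xi p = 0 by rewrite /E /xi /w /ev deriv_map; ring.
pose k := Pdiv.CommonRing.rscalp q p; pose l := lead_coef p ^+ k.
have e : l%:P * q = Pdiv.CommonRing.rdivp q p * p + Pdiv.CommonRing.rmodp q p.
  by rewrite mul_polyC; apply: Pdiv.ComRing.rdivp_eq.
set s := Pdiv.CommonRing.rdivp q p in e; set r := Pdiv.CommonRing.rmodp q p in e.
have evM a b : ev (a * b) = ev a * ev b by rewrite /ev rmorphM hornerM.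
have evD a b : ev (a + b) = ev a + ev b by rewrite /ev rmorphD hornerD.
have Ir : I (ev r).
  have -> : ev r = ev (l%:P * q) - ev (s * p) by rewrite e evD addrC addKr.
  by apply: idealB => //; rewrite evM; apply: idealM.
have IEr : I (E w xi r).
  apply: evaluation_derivation_coef; apply: small => //.
  by rewrite -sp Pdiv.CommonRing.ltn_rmodp -size_poly_gt0 sp ltnW.
have : I (ev l%:P * E w xi q).
  have -> : ev l%:P * E w xi q = E w xi s * ev p + E w xi r - E w xi l%:P * ev q.
    have := congr1 (E w xi) e; rewrite evaluation_derivationD !evaluation_derivationM Ep mulr0 add0r.
    by move=> e2; rewrite [E w xi s * _]mulrC -e2; ring.
  by apply: idealB => //; [apply: idealD => //; apply: idealM|apply: idealM].
move=> /(pideal_prime pI)[|//]; rewrite /ev map_polyC hornerC /= /l rmorphXn /=.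
elim: (k) => [|j IHj]; first by move=> /(pideal1 pI).
by rewrite exprS => /(pideal_prime pI)[|//].
Qed.

End DerivationExtension.

Section DerivationTower.
Variables (A : comNzRingType) (I : set A).
Hypothesis pI : prime_ideal I.
Hypothesis char0 : forall k a, I (a *+ k.+1) -> I a.

(** One polynomial variable is adjoined for each element of [xs]. The clearing factors multiply, and
    primality keeps their product outside I. *)
Lemma derivation_tower (C0 : comNzRingType) (phi0 : {rmorphism C0 -> A})
    (Delta0 : {additive C0 -> A}) (xs : seq A) :
  (forall a b, Delta0 (a * b) = phi0 a * Delta0 b + phi0 b * Delta0 a) ->
  (forall c, I (phi0 c) -> I (Delta0 c)) ->
  exists (C : comNzRingType) (phi : {rmorphism C -> A}) (Delta : {additive C -> A})
    (e : {rmorphism C0 -> C}) (w : A) (ys : seq C),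
  [/\ (forall a b, Delta (a * b) = phi a * Delta b + phi b * Delta a) /\
      (forall c, I (phi c) -> I (Delta c)),
      forall c, phi (e c) = phi0 c, forall c, Delta (e c) = w * Delta0 c,
      ~ I w & map phi ys = xs].
Proof.
move=> L0 K0; elim: xs => [|x xs [C [phi [Delta [e [w [ys [[L K] pe De nw pys]]]]]]]].
  exists C0, phi0, Delta0, (idfun : {rmorphism C0 -> C0}), 1, [::].
  by split=> // [c|]; [rewrite mul1r|apply: (pideal1 pI)].
have [w' [xi [nw' E]]] := derivation_extension x pI char0 L K.
pose D (q : {poly C}) := w' * (map_poly Delta q).[x] + xi * (map_poly phi q)^`().[x].
have Dadd : zmod_morphism D.
  by move=> q r; rewrite /D !raddfB /= !hornerD !hornerN; ring.
pose phi' : {rmorphism {poly C} -> A} := horner_eval x \o map_poly phi.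
pose DA := GRing.isZmodMorphism.Build _ _ D Dadd; pose D' : {additive {poly C} -> A} := HB.pack D DA.
exists {poly C}, phi', D', (polyC \o e : {rmorphism C0 -> {poly C}}), (w' * w),
  ('X :: map polyC ys); split.
- by split; [move=> a b; apply: evaluation_derivationM|move=> c; apply: E].
- by move=> c; rewrite /= /horner_eval map_polyC hornerC /= pe.
- move=> c; rewrite /= /D !map_polyC !hornerC /= De derivC horner0 mulr0 addr0; ring.
- by move=> /(pideal_prime pI)[].
- rewrite /= /horner_eval map_polyX hornerX; congr (_ :: _).
  rewrite -map_comp -pys; apply: eq_map => y /=.
  by rewrite map_polyC hornerC.
Qed.

End DerivationTower.

Section AlgebraicElements.
Variables (R : realFieldType) (n : nat).
Local Notation A := {mpoly R[n]}.

Lemma mpoly_derivationE (D : A -> A) :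
  {morph D : a b / a + b} -> (forall c, D c%:MP = 0) ->
  (forall a b, D (a * b) = a * D b + b * D a) ->
  forall g, D g = \sum_l g^`M(l) * D 'X_l.
Proof.
move=> DD DC DM; pose E g := D g = \sum_l g^`M(l) * D 'X_l.
have EC c : E c%:MP by rewrite /E DC big1 // => l _; rewrite mderivC mul0r.
have ED g h : E g -> E h -> E (g + h).
  move=> eg eh; rewrite /E DD eg eh -big_split; apply: eq_bigr => l _.
  by rewrite mderivD mulrDl.
have EM g h : E g -> E h -> E (g * h).
  move=> eg eh; rewrite /E DM eg eh !mulr_sumr -big_split; apply: eq_bigr => l _ /=.
  by rewrite mderivM; ring.
have EX i : E 'X_i.
  rewrite /E (bigD1 i) //= big1 => [|l li].
    have e : (U_(i) - U_(i) = 0 :> 'X_{1..n})%MM.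
      by apply/mnmP => j; rewrite mnmBE subnn mnm0E.
    by rewrite mderivX mnm1E eqxx e mpolyX0 scale1r mul1r addr0.
  by rewrite mderivX mnm1E eq_sym (negbTE li) scale0r mul0r.
exact: (mpoly_alg_ind EC EX ED EM).
Qed.

(** The starting point is d/dt on R[t], mapped to A by sending t to f. Transcendence says that only
    0 is mapped into I, so the derivation is compatible with I. It is extended to the variables and
    read back on A by substituting the new variables. *)
Lemma transcendental_derivation (I : set A) (f : A) : prime_ideal I ->
  (forall q : {poly R}, I (map_poly (@mpolyC n R) q).[f] -> q = 0) ->
  exists xi : 'I_n -> A,
    (forall g, I g -> I (\sum_l g^`M(l) * xi l)) /\ ~ I (\sum_l f^`M(l) * xi l).
Proof.
move=> pI tr; have hI := prime_ideal_ideal pI.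
have char0 k (a : A) : I (a *+ k.+1) -> I a.
  move=> h; have -> : a = (k.+1%:R^-1)%:MP * (a *+ k.+1).
    by rewrite mulrnAr -mulrnAl -rmorphMn /= -mulr_natr mulVf ?pnatr_eq0 // mpolyC1 mul1r.
  exact: idealM.
pose phi0 : {rmorphism {poly R} -> A} := horner_eval f \o map_poly (@mpolyC n R).
pose d0 (q : {poly R}) := phi0 q^`().
have d0add : zmod_morphism d0 by move=> q r; rewrite /d0 !raddfB.
pose dA := GRing.isZmodMorphism.Build _ _ d0 d0add.
pose Delta0 : {additive {poly R} -> A} := HB.pack d0 dA.
have [||C [phi [Delta [e [w [ys [[L K] pe De nw pys]]]]]]] :=
  @derivation_tower A I pI char0 {poly R} phi0 Delta0 [seq 'X_i | i <- enum 'I_n].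
- by move=> a b; rewrite /= /d0 derivM rmorphD !rmorphM /=; ring.
- by move=> c /tr ->; rewrite /= /d0 linear0 rmorph0; apply: ideal0.
pose y i := nth 0 ys (i : 'I_n).
have phiy i : phi (y i) = 'X_i.
  have sy : size ys = n by rewrite -(size_map phi) pys size_map size_enum_ord.
  rewrite /y -(nth_map 0 (phi 0)) ?sy // pys (nth_map i) ?size_enum_ord //.
  by rewrite nth_ord_enum.
pose ev : {rmorphism A -> C} := mmap (e \o polyC) y.
have evC c : ev c%:MP = e c%:P by rewrite /= mmapC.
have evX i : ev 'X_i = y i by rewrite /= mmapX mmap1U.
have evK g : phi (ev g) = g.
  apply: (mpoly_rmorph_ext (F := phi \o ev) (G := idfun)) => [c|i] /=.
    by rewrite -[mmap _ _ _]/(ev _) evC pe /= /horner_eval map_polyC hornerC.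
  by rewrite -[mmap _ _ _]/(ev _) evX.
pose D g := Delta (ev g).
have DE : forall g, D g = \sum_l g^`M(l) * D 'X_l.
  apply: mpoly_derivationE => [a b|c|a b]; rewrite /D.
  - by rewrite !raddfD.
  - by rewrite evC De /= /d0 derivC rmorph0 mulr0.
  - by rewrite rmorphM L !evK.
exists (fun l => D 'X_l); split=> [g Ig|]; rewrite -DE.
  by apply: K; rewrite evK.
(* t and f, read in the tower, have the same image f in A. Their derivatives therefore agree modulo
   I, and that of t is w. *)
have Iw : I (w - D f).
  have -> : w - D f = Delta (e 'X - ev f).
    by rewrite raddfB De /= /d0 derivX rmorph1 mulr1.
  by apply: K; rewrite rmorphB evK pe /= /horner_eval map_polyX hornerX subrr; apply: ideal0.
by move=> IDf; apply: nw; rewrite -(subrK (D f) w); apply: idealD.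
Qed.

End AlgebraicElements.

(** * Quadratic modules *)

Section QuadraticModules.
Local Open Scope classical_set_scope.
Variables (R : realType) (n : nat).
Local Notation A := {mpoly R[n]}.
Implicit Types (M Q T : set A) (g h : A).

Record quadratic_module M : Prop := QuadraticModule {
  qmod1 : M 1;
  qmodD : forall g h, M g -> M h -> M (g + h);
  qmodMX : forall g h, M h -> M (g ^+ 2 * h) }.

Lemma qmodX M g : quadratic_module M -> M (g ^+ 2).
Proof. by move=> qM; rewrite -[_ ^+ 2]mulr1; apply: qmodMX (qmod1 _). Qed.

Lemma qmod0 M : quadratic_module M -> M 0.
Proof. by move=> qM; have := qmodX 0 qM; rewrite expr0n. Qed.

Lemma qmodMC M (c : R) g : quadratic_module M -> 0 <= c -> M g -> M (c%:MP * g).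
Proof. by move=> qM c0 Mg; rewrite -(sqr_sqrtr c0) rmorphXn; apply: qmodMX. Qed.

Lemma qmodC M (c : R) : quadratic_module M -> 0 <= c -> M c%:MP.
Proof. by move=> qM c0; rewrite -[c%:MP]mulr1; apply: qmodMC (qmod1 _). Qed.

Lemma SOS_mul_qmod M s g : quadratic_module M -> SOS s -> M g -> M (s * g).
Proof.
move=> qM [l ->] Mg; rewrite mulr_suml; apply: (big_ind M) => [|a b|q _].
- exact: qmod0.
- exact: qmodD.
- exact: qmodMX.
Qed.

Lemma SOS_qmod M s : quadratic_module M -> SOS s -> M s.
Proof. by move=> qM hs; rewrite -[s]mulr1; apply: SOS_mul_qmod (qmod1 _). Qed.

Lemma SOS_X g : SOS (g ^+ 2).
Proof. by exists [:: g]; rewrite big_seq1. Qed.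

Lemma SOS_D g h : SOS g -> SOS h -> SOS (g + h).
Proof. by move=> [s ->] [t ->]; exists (s ++ t); rewrite big_cat. Qed.

Lemma SOS_0 : SOS (0 : A).
Proof. by exists [::]; rewrite big_nil. Qed.

Lemma SOS_M g h : SOS g -> SOS h -> SOS (g * h).
Proof.
move=> [s ->] [t ->]; rewrite mulr_suml; apply: (big_ind (@SOS R n)) => [|a b|q _].
- exact: SOS_0.
- exact: SOS_D.
rewrite mulr_sumr; apply: (big_ind (@SOS R n)) => [|a b|q' _].
- exact: SOS_0.
- exact: SOS_D.
by rewrite -exprMn; apply: SOS_X.
Qed.

Lemma preordering_SOS : preordering [set s : A | SOS s].
Proof. by split; [apply: SOS_X|apply: SOS_D|apply: SOS_M]. Qed.

Lemma preordering_qmod T : preordering T -> quadratic_module T.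
Proof.
move=> pT; split; [exact: preord1|exact: preordD|] => g h Th.
by apply: (preordM pT) => //; apply: preordX.
Qed.

(** Since g = ((g + 1)/2)^2 - ((g - 1)/2)^2, the elements lying in M with both signs form an ideal,
    although M itself is closed only under multiplication by squares. *)
Lemma qmod_supportM M g h : quadratic_module M -> M h -> M (- h) -> M (g * h).
Proof.
move=> qM Mh MNh; have -> : g * h = ((2^-1)%:MP * (g + 1)) ^+ 2 * h + ((2^-1)%:MP * (g - 1)) ^+ 2 * - h.
  transitivity ((4 * 2^-1 ^+ 2)%:MP * (g * h)).
    by rewrite (_ : 4 * 2^-1 ^+ 2 = 1 :> R) ?mul1r //; field.
  by rewrite rmorphM rmorphXn /= rmorph_nat; ring.
by apply: (qmodD qM); apply: (qmodMX qM).
Qed.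

Definition qmod_bounded M g := exists N : R, M (N%:MP - g) /\ M (N%:MP + g).

Definition norm2 : A := \sum_(i < n) 'X_i ^+ 2.

Definition qmod_archimedean M := exists N : R, M (N%:MP - norm2).

Lemma qmod_sqr_bound M g (N : R) : quadratic_module M -> 0 < N ->
  M (N%:MP - g) -> M (N%:MP + g) -> M ((N ^+ 2)%:MP - g ^+ 2).
Proof.
move=> qM N0 h1 h2.
have -> : (N ^+ 2)%:MP - g ^+ 2 = ((2 * N)^-1)%:MP *
    ((N%:MP + g) ^+ 2 * (N%:MP - g) + (N%:MP - g) ^+ 2 * (N%:MP + g)).
  have -> : (N%:MP + g) ^+ 2 * (N%:MP - g) + (N%:MP - g) ^+ 2 * (N%:MP + g) =
    (2 * N)%:MP * ((N ^+ 2)%:MP - g ^+ 2) by rewrite rmorphM rmorphXn /= rmorph_nat; ring.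
  by rewrite mulrA -rmorphM /= mulVf ?mul1r // gt_eqF // pmulr_rgt0.
apply: (qmodMC qM); first by rewrite invr_ge0 ltW // pmulr_rgt0.
by apply: (qmodD qM); apply: (qmodMX qM).
Qed.

Lemma qmod_bounded_pos M g : quadratic_module M -> qmod_bounded M g ->
  exists2 N : R, 0 < N & M (N%:MP - g) /\ M (N%:MP + g).
Proof.
move=> qM [N [h1 h2]]; have N0 : 0 <= `|N| + 1 - N.
  by rewrite addrAC addr_ge0 // subr_ge0 ler_norm.
exists (`|N| + 1); first by rewrite ltr_wpDl.
have e : (`|N| + 1)%:MP = (`|N| + 1 - N)%:MP + N%:MP :> A by rewrite -rmorphD subrK.
by rewrite e; split; rewrite -[X in M X]addrA; apply: (qmodD qM) => //; apply: qmodC.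
Qed.

(** Completing the square: h^2 - h + 1/4 = (h - 1/2)^2, used for h = g and h = -g. *)
Lemma qmod_bounded_of_sqr M g (K : R) : quadratic_module M -> M (K%:MP - g ^+ 2) ->
  qmod_bounded M g.
Proof.
move=> qM hK; exists (K + 2^-1 ^+ 2).
have e (h : A) : h ^+ 2 = g ^+ 2 -> M ((K + 2^-1 ^+ 2)%:MP - h).
  move=> hg; have -> : (K + 2^-1 ^+ 2)%:MP - h = (K%:MP - g ^+ 2) + (h - (2^-1)%:MP) ^+ 2.
    have -> : (h - (2^-1)%:MP) ^+ 2 = g ^+ 2 - (2 * 2^-1)%:MP * h + (2^-1 ^+ 2)%:MP.
      by rewrite -hg rmorphM rmorphXn /= rmorph_nat; ring.
    by rewrite mulfV ?pnatr_eq0 // mul1r rmorphD; ring.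
  by apply: (qmodD qM) => //; apply: qmodX.
by split; [apply: e|rewrite -[g in X in M (_ + X)]opprK; apply: e; rewrite sqrrN].
Qed.

(** Bounded elements form a subalgebra: products reduce to squares by polarisation, and squares are
    covered by [qmod_sqr_bound]. The variables are bounded because each square is dominated by
    |x|^2. *)
Lemma archimedean_bounded M g : quadratic_module M -> qmod_archimedean M -> qmod_bounded M g.
Proof.
move=> qM [N hN].
have bD g1 g2 : qmod_bounded M g1 -> qmod_bounded M g2 -> qmod_bounded M (g1 + g2).
  move=> [N1 [h1 h1']] [N2 [h2 h2']]; exists (N1 + N2); rewrite rmorphD /=; split.
    have -> : N1%:MP + N2%:MP - (g1 + g2) = (N1%:MP - g1) + (N2%:MP - g2) by ring.
    exact: (qmodD qM).
  by rewrite addrACA; apply: (qmodD qM).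
have bX g1 : qmod_bounded M g1 -> qmod_bounded M (g1 ^+ 2).
  move=> /(qmod_bounded_pos qM)[N1 N10 [h1 h1']]; exists (N1 ^+ 2).
  split; first exact: qmod_sqr_bound.
  by apply: (qmodD qM); [apply: qmodC; rewrite ?sqr_ge0|apply: qmodX].
have bZ (c : R) g1 : qmod_bounded M g1 -> qmod_bounded M (c%:MP * g1).
  move=> [N1 [h1 h1']]; have [c0|c0] := leP 0 c.
    exists (c * N1); rewrite rmorphM /= -mulrBr -mulrDr.
    by split; apply: qmodMC.
  have c0' : 0 <= - c by rewrite oppr_ge0 ltW.
  exists (- c * N1); have -> : c%:MP * g1 = - ((- c)%:MP * g1) by rewrite rmorphN mulNr opprK.
  by rewrite rmorphM /= opprK -mulrBr -mulrDr; split; apply: qmodMC.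
have bM g1 g2 : qmod_bounded M g1 -> qmod_bounded M g2 -> qmod_bounded M (g1 * g2).
  move=> b1 b2.
  have -> : g1 * g2 = (4^-1)%:MP * ((g1 + g2) ^+ 2 + (-1)%:MP * (g1 + (-1)%:MP * g2) ^+ 2).
    transitivity ((4^-1 * 4)%:MP * (g1 * g2)).
      by rewrite mulVf ?pnatr_eq0 // mul1r.
    by rewrite rmorphM /= rmorph_nat rmorphN rmorph1; ring.
  apply: (bZ); apply: (bD); first by apply/bX/bD.
  by apply: (bZ); apply: bX; apply: (bD) => //; apply: (bZ).
apply: mpoly_alg_ind => //.
  move=> c; exists `|c|; rewrite -rmorphB -rmorphD /=; split; apply: qmodC => //.
    by rewrite subr_ge0 ler_norm.
  by rewrite -[X in _ + X]opprK subr_ge0 -normrN ler_norm.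
move=> i; apply: (qmod_bounded_of_sqr (K := N)) => //.
have -> : N%:MP - 'X_i ^+ 2 = (N%:MP - norm2) + \sum_(j < n | j != i) 'X_j ^+ 2 :> A.
  by rewrite /norm2 (bigD1 i) //=; ring.
apply: (qmodD qM) => //; apply: (big_ind M) => [|a b|j _]; [exact: qmod0|exact: qmodD|exact: qmodX].
Qed.

Lemma maximal_qmod_total Q g : quadratic_module Q -> ~ Q (- 1) ->
  (forall B, Q `<=` B -> quadratic_module B /\ ~ B (- 1) -> B `<=` Q) -> Q g \/ Q (- g).
Proof.
move=> qQ Q1 mQ.
have ext a : ~ Q a -> exists q s, [/\ Q q, SOS s & - 1 = q + a * s].
  move=> na; apply: contrapT => no; apply: na.
  pose B := [set z | exists q s, [/\ Q q, SOS s & z = q + a * s]].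
  apply: (mQ B).
  - by move=> z Qz; exists z, 0; rewrite mulr0 addr0; split=> //; apply: SOS_0.
  - split=> //; split.
    + by exists 1, 0; rewrite mulr0 addr0; split; [apply: qmod1|apply: SOS_0|].
    + move=> _ _ [q [s [Qq Ss ->]]] [q' [s' [Qq' Ss' ->]]]; exists (q + q'), (s + s').
      by split; [apply: (qmodD qQ)|apply: SOS_D|ring].
    + move=> x _ [q [s [Qq Ss ->]]]; exists (x ^+ 2 * q), (x ^+ 2 * s).
      by split; [apply: (qmodMX qQ)|apply: SOS_M => //; apply: SOS_X|ring].
  - exists 0, 1; rewrite mulr1 add0r; split=> //; first exact: qmod0.
    by rewrite -(expr1n _ 2); apply: SOS_X.
have [|ng] := pselect (Q g); [by left | right].
apply: contrapT => nNg.
have [q1 [s1 [Qq1 [l1 e1] h1]]] := ext _ ng; have [q2 [s2 [Qq2 S2 h2]]] := ext _ nNg.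
have S1 : SOS s1 by exists l1.
have as1 : g * s1 = - (1 + q1) by rewrite opprD h1; ring.
have as2 : g * s2 = 1 + q2 by rewrite -[1]opprK h2; ring.
have Ns1 : Q (- s1).
  have -> : - s1 = s2 + s2 * q1 + s1 * q2.
    apply/eqP; rewrite -subr_eq0 -oppr_eq0; apply/eqP.
    transitivity (s2 * (1 + q1) + s1 * (1 + q2)); first by ring.
    by rewrite -as2 -[1 + q1]opprK -as1; ring.
  apply: (qmodD qQ); first apply: (qmodD qQ).
  - exact: SOS_qmod.
  - exact: SOS_mul_qmod.
  - exact: SOS_mul_qmod.
have Qgs : Q (g * s1).
  by apply: qmod_supportM => //; apply: SOS_qmod.
apply: Q1; have -> : -1 = g * s1 + q1 by rewrite as1; ring.
exact: (qmodD qQ).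
Qed.

(** In a maximal Q each variable is bounded, hence infinitely close, in the sense of [small], to a
    real [u i]. Small elements absorb products with bounded ones, so every g is infinitely close to
    g(u), and g(u) < 0 for some g in Q would put a negative constant into Q. *)
Theorem archimedean_qmod_point M : quadratic_module M -> qmod_archimedean M -> ~ M (- 1) ->
  exists u : 'I_n -> R, forall g, M g -> 0 <= g.@[u].
Proof.
move=> qM aM M1; have [|F [X0 FX0] gF tF|Q [MQ [qQ Q1] mQ]] :=
    @Zorn_above A (fun X => quadratic_module X /\ ~ X (- 1)) M; first by [].
  split; last by move=> [X FX]; apply: (gF _ FX).2.
  split.
  - by exists X0 => //; apply: qmod1 (gF _ FX0).1.
  - move=> a b [X FX Xa] [Y FY Yb]; have [XY|YX] := tF _ _ FX FY.
      by exists Y => //; apply: qmodD (gF _ FY).1 _ _ (XY _ Xa) Yb.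
    by exists X => //; apply: qmodD (gF _ FX).1 _ _ Xa (YX _ Yb).
  - by move=> a b [X FX Xb]; exists X => //; apply: qmodMX (gF _ FX).1 _ _ Xb.
have tot g : Q g \/ Q (- g) by apply: maximal_qmod_total.
have aQ : qmod_archimedean Q by case: aM => N /MQ; exists N.
have bdd g : qmod_bounded Q g by apply: archimedean_bounded.
have constQ (c : R) : Q c%:MP -> 0 <= c.
  move=> Qc; rewrite leNgt; apply/negP => c0; apply: Q1.
  have -> : -1 = (- c)^-1%:MP * c%:MP :> A.
    by rewrite -rmorphM /= invrN mulNr mulVf ?lt_eqF // rmorphN rmorph1.
  by apply: qmodMC => //; rewrite invr_ge0 oppr_ge0 ltW.
pose small g := forall e : R, 0 < e -> Q (e%:MP - g) /\ Q (e%:MP + g).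
pose u i := sup [set r : R | Q ('X_i - r%:MP)].
have uP i : small ('X_i - (u i)%:MP).
  have hs : has_sup [set r : R | Q ('X_i - r%:MP)].
    have [N [h1 h2]] := bdd 'X_i; split.
      by exists (- N) => /=; rewrite rmorphN opprK addrC.
    exists N => r /= Qr; rewrite -subr_ge0; apply: constQ.
    by rewrite rmorphB /= -[N%:MP](subrK 'X_i) -addrA; apply: (qmodD qQ).
  move=> e e0; split.
    have [h|h] := tot ('X_i - (u i + e)%:MP); last first.
      by move: h; rewrite rmorphD /=; congr Q; ring.
    have : u i + e <= u i by apply: sup_upper_bound.
    by rewrite gerDl leNgt e0.
  have [r Qr hr] := sup_adherent e0 hs.
  have -> : e%:MP + ('X_i - (u i)%:MP) = ('X_i - r%:MP) + (r - (u i - e))%:MP :> A.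
    by rewrite !rmorphB /=; ring.
  by apply: (qmodD qQ) => //; apply: qmodC; rewrite // subr_ge0 ltW.
have smallD g h : small g -> small h -> small (g + h).
  move=> sg sh e e0; have e20 : 0 < e / 2 by rewrite divr_gt0.
  have [g1 g2] := sg _ e20; have [h1 h2] := sh _ e20.
  have -> : e%:MP = (e / 2)%:MP + (e / 2)%:MP :> A by rewrite -rmorphD /= -splitr.
  by split; [rewrite opprD|]; rewrite addrACA; apply: (qmodD qQ).
have smallM g h : small g -> small (g * h).
  move=> sg e e0; have [N N0 [h1 h2]] := qmod_bounded_pos qQ (bdd h).
  (* The weight balances g h <= (t^-2 g^2 + t^2 h^2)/2: with |g| <= t sqrt(e) and |h| <= N =
     sqrt(e)/t, each half is at most e/2. *)
  pose t := Num.sqrt e / N; have t0 : 0 < t by rewrite divr_gt0 // sqrtr_gt0.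
  have d0 : 0 < t * Num.sqrt e by rewrite mulr_gt0 // sqrtr_gt0.
  have [g1 g2] := sg _ d0; have Qg := qmod_sqr_bound qQ d0 g1 g2.
  have Qh := qmod_sqr_bound qQ N0 h1 h2.
  have key (h' : A) : h' ^+ 2 = h ^+ 2 -> Q (e%:MP - g * h').
    move=> hh.
    have -> : e%:MP - g * h' = (2^-1)%:MP * (((t^-1)%:MP ^+ 2 * (((t * Num.sqrt e) ^+ 2)%:MP - g ^+ 2)
        + t%:MP ^+ 2 * ((N ^+ 2)%:MP - h ^+ 2)) + ((t^-1)%:MP * g - t%:MP * h') ^+ 2).
      have -> : (t^-1)%:MP ^+ 2 * (((t * Num.sqrt e) ^+ 2)%:MP - g ^+ 2)
        + t%:MP ^+ 2 * ((N ^+ 2)%:MP - h ^+ 2) + ((t^-1)%:MP * g - t%:MP * h') ^+ 2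
        = (t^-1 ^+ 2 * (t * Num.sqrt e) ^+ 2 + t ^+ 2 * N ^+ 2)%:MP - (2 * (t^-1 * t))%:MP * (g * h').
        by rewrite -hh !(rmorphXn, rmorphD, rmorphM) /= ?(rmorph_nat, rmorph1); ring.
      have -> : t^-1 ^+ 2 * (t * Num.sqrt e) ^+ 2 + t ^+ 2 * N ^+ 2 = 2 * e.
        rewrite -!exprMn mulrA mulVf ?gt_eqF // mul1r /t mulfVK ?gt_eqF //.
        by rewrite sqr_sqrtr ?ltW //; ring.
      rewrite mulVf ?gt_eqF // mulr1 mulrBr mulrA -!rmorphM /= mulrA mulVf ?pnatr_eq0 //.
      by rewrite mul1r mul1r.
    apply: (qmodMC qQ); first by rewrite invr_ge0.
    by apply: (qmodD qQ); [apply: (qmodD qQ); apply: (qmodMX qQ)|apply: qmodX].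
  split; first exact: key.
  by rewrite -[g * h]opprK -mulrN; apply: key; rewrite sqrrN.
have near g : small (g - (g.@[u])%:MP).
  move: g; apply: mpoly_alg_ind => [c|i|g h sg sh|g h sg sh].
  - by move=> e e0; rewrite mevalC subrr subr0 addr0; split; apply: qmodC => //; apply: ltW.
  - by rewrite mevalXU.
  - by rewrite mevalD rmorphD /= opprD addrACA; apply: smallD.
  - have -> : g * h - (g * h).@[u]%:MP = (g - (g.@[u])%:MP) * h + (h - (h.@[u])%:MP) * (g.@[u])%:MP.
      by rewrite mevalM rmorphM /=; ring.
    by apply: smallD; apply: smallM.
exists u => g /MQ Qg; rewrite leNgt; apply/negP => gu.
have e0 : 0 < - g.@[u] / 2 by rewrite divr_gt0 // oppr_gt0.
have [h1 _] := near g _ e0; have := qmodD qQ Qg h1.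
have -> : g + ((- g.@[u] / 2)%:MP - (g - (g.@[u])%:MP)) = (- g.@[u] / 2 + g.@[u])%:MP.
  by rewrite rmorphD /=; ring.
move/constQ; rewrite leNgt => /negP; apply.
by lra.
Qed.

End QuadraticModules.

(** * Compactness implies the archimedean property *)

Section CompactArchimedean.
Variables (R : realType) (n : nat).
Local Notation A := {mpoly R[n]}.

Lemma meval_norm2 (x : 'I_n -> R) : (norm2 R n).@[x] = \sum_i x i ^+ 2.
Proof. by rewrite /norm2 rmorph_sum; apply: eq_bigr => i _; rewrite rmorphXn /= mevalXU. Qed.

Lemma compact_norm2_bound (p : A) :
  compact [set v : 'rV[R]_n | 0 <= p.@[fun i => v ord0 i]]%classic ->
  exists2 N : R, 0 <= N & forall x : 'I_n -> R, 0 <= p.@[x] -> (norm2 R n).@[x] < N.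
Proof.
move=> cp; have bi (i : 'I_n) : exists B : R, forall x : 'I_n -> R, 0 <= p.@[x] -> `|x i| <= B.
  have cc : compact ((fun v : 'rV[R]_n => v ord0 i) @` [set v : 'rV[R]_n | 0 <= p.@[fun i => v ord0 i]])%classic.
    apply: continuous_compact => //; apply: continuous_subspaceT; exact: coord_continuous.
  have [M [_ hM]] := compact_bounded (cc : compact (_ : set R^o)).
  exists (M + 1) => x px; apply: (hM (M + 1)); first by rewrite ltrDl.
  exists (\row_j x j); last by rewrite mxE.
  by rewrite /= (_ : (fun i => _) = x) //; apply/funext => j; rewrite mxE.
have [B hB] := boolp.choice bi.
exists (\sum_i B i ^+ 2 + 1); first by rewrite addr_ge0 // sumr_ge0 // => i _; rewrite sqr_ge0.
move=> x px; rewrite meval_norm2 ltr_pwDr //; apply: ler_sum => i _.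
by rewrite -[x i ^+ 2]real_normK ?num_real // lerXn2r ?nnegrE // ?(le_trans _ (hB i x px)) // hB.
Qed.

(* Woermann's argument: the Positivstellensatz gives (1 + t) a in T for a = N - |x|^2 and some t
   in T, and adjoining a makes T archimedean; this bounds t, and then |x|^2, in T itself. *)
Lemma compact_qmod_archimedean (p : A) (N : R) : 0 <= N ->
  (forall x, 0 <= p.@[x] -> (norm2 R n).@[x] < N) ->
  qmod_archimedean (adjoin [set s | SOS s]%classic p).
Proof.
move=> N0 hN; set T := adjoin _ p; pose a : A := N%:MP - norm2 R n.
have pS := preordering_SOS R n; have pT : preordering T by apply: preordering_adjoin.
have Tp : T p by apply: adjoin_gen; [apply: preord0|apply: preord1].
have qT := preordering_qmod pT.
(* Otherwise the Positivstellensatz would produce a point with p >= 0 and |x|^2 >= N. *)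
have [t [t' [Tt Tt' e]]] : adjoin T (- a) (- 1).
  apply: contrapT => no.
  have [g|u hu] := positivstellensatz (gs := [:: p; - a]) (preordering_adjoin (- a) pT) no.
    rewrite !inE => /orP[/eqP->|/eqP->]; first exact: adjoin_sub (preord0 pT) _ Tp.
    by apply: adjoin_gen; [apply: preord0|apply: preord1].
  have pu : 0 <= p.@[u] by apply: hu; rewrite mem_head.
  have : 0 <= (- a).@[u] by apply: hu; rewrite !inE eqxx orbT.
  by rewrite mevalN mevalB mevalC opprB subr_ge0 leNgt hN.
have at' : a * t' = 1 + t by rewrite -[1]opprK e; ring.
have Ta : T (a * (1 + t)).
  by rewrite -at' mulrA -expr2; apply: (qmodMX qT).
have [m [[s0 [s1 [Ts0 Ts1 em]]] _]] : qmod_bounded (adjoin T a) t.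
  apply: archimedean_bounded; first exact/preordering_qmod/preordering_adjoin.
  by exists N; apply: adjoin_gen; [apply: preord0|apply: preord1].
have T1t : T (1 + t) by apply: (qmodD qT) => //; apply: preord1.
(* The constant comes from (m - t)(1 + t) + (m/2 - t)^2 = m + (m/2)^2 - t, where m - t is in T + aT
   and the factor 1 + t turns a into the element a (1 + t) of T. *)
pose N2 := m + (m / 2) ^+ 2.
have TN2 : T (N2%:MP - t).
  have -> : N2%:MP - t = (s0 + a * s1) * (1 + t) + ((m / 2)%:MP - t) ^+ 2.
    rewrite -em /N2; have -> : m%:MP = (m / 2)%:MP + (m / 2)%:MP :> A by rewrite -rmorphD /= -splitr.
    by rewrite rmorphD rmorphXn /= {1}(splitr m) rmorphD; ring.
  apply: (qmodD qT); last exact: preordX.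
  have -> : (s0 + a * s1) * (1 + t) = s0 * (1 + t) + a * (1 + t) * s1 by ring.
  by apply: (qmodD qT); apply: (preordM pT).
(* a (1 + t) + t |x|^2 = N - |x|^2 + N t, and N t is bounded by N N2. *)
exists (N + N * N2).
have -> : (N + N * N2)%:MP - norm2 R n = a * (1 + t) + t * norm2 R n + N%:MP * (N2%:MP - t).
  by rewrite /a rmorphD rmorphM /=; ring.
apply: (qmodD qT); last exact: (qmodMC qT).
apply: (qmodD qT) => //; apply: (preordM pT) => //.
apply: (big_ind T) => [|x y|i _]; [exact: preord0|exact: preordD|exact: preordX].
Qed.

End CompactArchimedean.

(** * Univariate certificates *)

Section UnivariateCertificates.

Lemma noroot_quadratic_factor (R : rcfType) (p : {poly R}) : (1 < size p)%N ->
  (forall x, ~~ root p x) ->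
  exists a b : R, b != 0 /\ (('X - a%:P) ^+ 2 + (b ^+ 2)%:P %| p)%R.
Proof.
move=> sp nr; have /closed_rootP[z rz] : size (map_poly (real_complex R) p) != 1.
  by rewrite size_map_poly; case: (size p) sp => [|[]].
case: z rz => a b rz; exists a, b.
have hor (q : {poly R}) : (map_poly (real_complex R) q).[(a +i* b)%C] =
    (map_poly (real_complex R) (q %/ (('X - a%:P) ^+ 2 + (b ^+ 2)%:P))).[(a +i* b)%C]
    * (map_poly (real_complex R) (('X - a%:P) ^+ 2 + (b ^+ 2)%:P)).[(a +i* b)%C]
    + (map_poly (real_complex R) (q %% (('X - a%:P) ^+ 2 + (b ^+ 2)%:P))).[(a +i* b)%C].
  by rewrite {1}(divp_eq q (('X - a%:P) ^+ 2 + (b ^+ 2)%:P)) rmorphD rmorphM /= hornerD hornerM.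
have q0 : (map_poly (real_complex R) (('X - a%:P) ^+ 2 + (b ^+ 2)%:P)).[(a +i* b)%C] = 0.
  rewrite rmorphD rmorphXn rmorphB /= map_polyX !map_polyC /= !hornerE.
  by apply/eqP; rewrite eq_complex /=; apply/andP; split; apply/eqP; ring.
have b0 : b != 0.
  apply: contraNneq (nr a) => b0; move: rz; rewrite b0 -[(a +i* 0)%C]/(real_complex R a).
  by rewrite /root horner_map /= fmorph_eq0.
split=> //; apply/eqP; move: rz; rewrite /root hor q0 mulr0 add0r.
set r := _ %% _ => /eqP er.
have sr : (size r <= 2)%N.
  have sq : size (('X - a%:P) ^+ 2 + (b ^+ 2)%:P) = 3%N.
    rewrite size_polyDl; first by rewrite size_exp_XsubC.
    by rewrite size_exp_XsubC (leq_ltn_trans (size_polyC_leq1 _)).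
  by rewrite -ltnS -sq ltn_modp -size_poly_gt0 sq.
have rE : r = r`_1 *: 'X + (r`_0)%:P.
  apply/polyP => -[|[|i]]; rewrite !coefE ?mulr0 ?add0r ?mulr1 ?addr0 //.
  by rewrite nth_default // (leq_trans sr).
have := er; rewrite {1}rE rmorphD /= map_polyZ /= map_polyX map_polyC /= !hornerE => /eqP.
rewrite eq_complex /= => /andP[/eqP e1 /eqP e2].
have r1 : r`_1 = 0 by apply: (mulIf b0); rewrite mul0r -[RHS]e2; ring.
have r0 : r`_0 = 0 by rewrite -[RHS]e1 r1; ring.
by rewrite rE r1 r0 scale0r add0r.
Qed.

(** The polynomial is a positive constant times factors (X - a)^2 + b^2, and sums of two squares
    multiply. The size bounds serve the uniform degree of the certificates. *)
Lemma pos_poly_two_squares (R : rcfType) (p : {poly R}) : (forall x, 0 < p.[x]) ->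
  exists a b : {poly R}, [/\ p = a ^+ 2 + b ^+ 2, (size a <= size p)%N & (size b <= size p)%N].
Proof.
have [m] := ubnP (size p); elim: m p => // m IH p; rewrite ltnS => sp pos.
have p0 : p != 0 by apply: contraTneq (pos 0) => ->; rewrite horner0 ltxx.
have [s1|s1] := leqP (size p) 1.
  have pE : p = (p`_0)%:P by apply: size1_polyC.
  have c0 : 0 <= p`_0 by have := pos 0; rewrite pE hornerC => /ltW; rewrite coefC.
  exists (Num.sqrt p`_0)%:P, 0; rewrite size_poly0 expr0n /= addr0 -rmorphXn /= sqr_sqrtr //.
  split=> //; apply: leq_trans (size_polyC_leq1 _) _; by rewrite size_poly_gt0.
have [|a [b [b0 /dvdpP[p1 pE]]]] := noroot_quadratic_factor s1.
  by move=> x; rewrite /root gt_eqF.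
set q := _ + _ in pE.
have q0 x : 0 < q.[x].
  rewrite /q !hornerE ltr_wpDl ?sqr_ge0 //.
  by rewrite exprn_even_gt0.
have sq : size q = 3%N.
  rewrite /q size_polyDl; first by rewrite size_exp_XsubC.
  by rewrite size_exp_XsubC (leq_ltn_trans (size_polyC_leq1 _)).
have p10 : p1 != 0 by apply: contraNneq p0 => e; rewrite pE e mul0r.
have q00 : q != 0 by rewrite -size_poly_gt0 sq.
have spE : size p = (size p1).+2 by rewrite pE size_mul // sq !addnS addn0.
have [|x|a1 [b1 [e sa sb]]] := IH p1.
- by rewrite spE in sp; apply: leq_trans sp.
- by have := pos x; rewrite pE hornerM pmulr_lgt0.
have sX (c : {poly R}) : (size c <= size p1)%N -> (size (('X - a%:P) * c)%R <= size p)%N.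
  move=> sc; apply: leq_trans (size_polyMleq _ _) _; rewrite size_XsubC spE.
  by move: (size c) (size p1) sc => u v; lia.
have sC (c : {poly R}) : (size c <= size p1)%N -> (size (b%:P * c)%R <= size p)%N.
  move=> sc; rewrite mul_polyC; apply: leq_trans (size_scale_leq _ _) _.
  by rewrite spE; move: (size c) (size p1) sc => u v; lia.
exists (('X - a%:P) * a1 - b%:P * b1), (('X - a%:P) * b1 + b%:P * a1); split.
- by rewrite pE e /q rmorphXn /=; ring.
- apply: leq_trans (size_polyD _ _) _; rewrite size_polyN geq_max sX ?sC //.
- apply: leq_trans (size_polyD _ _) _; rewrite geq_max sX ?sC //.
Qed.

Lemma split_roots (R : rcfType) (g : R) (q : {poly R}) : q != 0 ->
  exists a b : {poly R}, [/\ q = a * b, forall t, root a t -> t < g &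
    forall t, t < g -> ~~ root b t].
Proof.
have [m] := ubnP (size q); elim: m q => // m IH q; rewrite ltnS => sq q0.
have [[t tg rt]|no] := pselect (exists2 t, t < g & root q t); last first.
  exists 1, q; rewrite mul1r; split=> // t; first by rewrite (negbTE (root1 _)).
  by move=> tg; apply/negP => rt; apply: no; exists t.
have /factor_theorem[q1 qE] := rt.
have q10 : q1 != 0 by apply: contraNneq q0 => e; rewrite qE e mul0r.
have [||a [b [e ha hb]]] := IH q1 => //.
  by move: sq; rewrite qE size_mul ?polyXsubC_eq0 // size_XsubC addnC.
exists (a * ('X - t%:P)), b; split=> //; first by rewrite qE e mulrAC.
by move=> x; rewrite rootM root_XsubC => /orP[/ha//|/eqP->].
Qed.

(** Far to the left q^2, of degree at least 2, dominates the linear term. On the remaining compact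
    interval up to g - e it has a positive minimum, as q has no root there. Beyond g - e the linear
    term is positive by itself. *)
Lemma penalty_constant (R : realType) (g e : R) (q : {poly R}) : 0 < e -> (1 < size q)%N ->
  (forall t, t < g -> ~~ root q t) ->
  exists2 C : R, 0 <= C & forall t, 0 < t - g + e + C * q.[t] ^+ 2.
Proof.
move=> e0 sq nr; have q0 : q != 0 by rewrite -size_poly_gt0 ltnW.
pose Q := q ^+ 2 + ('X - g%:P).
have sq2 : size (q ^+ 2) = (size q + size q).-1 by rewrite size_mul.
have sQ' : (size ('X - g%:P)%R < size (q ^+ 2)%R)%N.
  by rewrite sq2 size_XsubC; move: (size q) sq => u; lia.
have sQ : size Q = (size q + size q).-1 by rewrite /Q size_polyDl.
have lQ : lead_coef Q = lead_coef q ^+ 2 by rewrite /Q lead_coefDl // lead_coef_exp.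
have Q0 : Q != 0 by rewrite -size_poly_gt0 sQ; move: (size q) sq => u; lia.
have [B hB] := sgz_far_left Q0.
have QB t : t <= B -> 0 < Q.[t].
  move=> /hB; rewrite sQ lQ (gtr0_sgz (_ : 0 < lead_coef q ^+ 2)); last first.
    by rewrite exprn_even_gt0 //= lead_coef_eq0.
  have -> : (size q + size q).-1.-1 = ((size q).-1).*2 by move: (size q) sq => u; lia.
  by rewrite -mul2n exprM sqrrN !expr1n mulr1 => h; rewrite -sgz_gt0 h.
have [m m0 hm] : exists2 m : R, 0 < m & forall t, B <= t <= g - e -> m <= q.[t] ^+ 2.
  have [Bg|Bg] := leP B (g - e); last first.
    by exists 1 => // t /andP[h1 h2]; have := le_lt_trans (le_trans h1 h2) Bg; rewrite ltxx.
  have [|c cB hc] := @EVT_min R (horner (q ^+ 2)) B (g - e) Bg.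
    exact/continuous_subspaceT/continuous_horner.
  exists (q ^+ 2).[c]; last by move=> t tB; rewrite -horner_exp; apply: hc; rewrite in_itv.
  rewrite horner_exp exprn_even_gt0 //=; apply: nr.
  move: cB; rewrite in_itv /= => /andP[_ cg]; apply: le_lt_trans cg _.
  by rewrite ltrBlDr ltrDl.
have C0 : 0 <= (`|g| + `|B|) / m by rewrite divr_ge0 ?addr_ge0 // ltW.
(* On [B, g - e] the linear part is at least e - |g| - |B|, which the quotient times q^2
   compensates; the summand 1 serves the region left of B. *)
exists (1 + (`|g| + `|B|) / m) => [|t]; first by rewrite addr_ge0.
have sq0 := sqr_ge0 q.[t].
have Cq : 0 <= (`|g| + `|B|) / m * q.[t] ^+ 2 by rewrite mulr_ge0.
have [tg|tg] := ltP (g - e) t.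
  by apply: ltr_wpDr; [rewrite mulr_ge0 // addr_ge0|lra].
rewrite mulrDl mul1r.
have [tB|tB] := leP t B.
  have := QB t tB; rewrite /Q hornerD horner_exp hornerXsubC; lra.
have hm' := hm t; rewrite (ltW tB) tg in hm'; have {}hm' := hm' isT.
have h1 : `|g| + `|B| <= (`|g| + `|B|) / m * q.[t] ^+ 2.
  by rewrite -mulrA ler_peMr ?addr_ge0 // ler_pdivlMl // mulr1.
have h2 := ler_norm g; have h3 : - B <= `|B| by rewrite -normrN ler_norm.
have h4 : 0 < q.[t] ^+ 2 by apply: lt_le_trans m0 hm'.
lra.
Qed.

End UnivariateCertificates.

(** * Multipliers at minimizers *)

Section PolynomialFunctions.
Variables (R : realType) (n : nat).
Local Notation A := {mpoly R[n]}.
Implicit Types (g : A) (x u : 'I_n -> R).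

Lemma meval_continuous g : continuous (fun v : 'rV[R]_n => g.@[fun i => v ord0 i]).
Proof.
move: g; apply: mpoly_alg_ind => [c|i|g h cg ch|g h cg ch].
- by under eq_fun do rewrite mevalC; apply: cst_continuous.
- by under eq_fun do rewrite mevalXU; apply: coord_continuous.
- under eq_fun do rewrite mevalD; move=> v; exact: continuousD (cg v) (ch v).
- under eq_fun do rewrite mevalM; move=> v; exact: continuousM (cg v) (ch v).
Qed.

Lemma meval_near g u (d : R) : 0 < d ->
  exists2 e : R, 0 < e & forall x, (forall i, `|x i - u i| <= e) -> `|g.@[x] - g.@[u]| < d.
Proof.
move: g d; apply: mpoly_alg_ind => [c|i|g h cg ch|g h cg ch] d d0.
- by exists 1 => // x _; rewrite !mevalC subrr normr0.
- exists (d / 2) => [|x hx]; first by rewrite divr_gt0.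
  by rewrite !mevalXU; apply: le_lt_trans (hx i) _; lra.
- have d20 : 0 < d / 2 by rewrite divr_gt0.
  have [e1 e10 h1] := cg _ d20; have [e2 e20 h2] := ch _ d20.
  exists (Num.min e1 e2) => [|x hx]; first by rewrite lt_min e10.
  have k1 := h1 x; have k2 := h2 x; rewrite !mevalD.
  have -> : g.@[x] + h.@[x] - (g.@[u] + h.@[u]) = (g.@[x] - g.@[u]) + (h.@[x] - h.@[u]) by ring.
  apply: le_lt_trans (ler_normD _ _) _; rewrite [d]splitr; apply: ltrD.
    by apply: k1 => i; apply: le_trans (hx i) _; rewrite ge_min lexx.
  by apply: k2 => i; apply: le_trans (hx i) _; rewrite ge_min lexx orbT.
- pose K := `|g.@[u]| + `|h.@[u]| + 1.
  have K0 : 0 < K by rewrite ltr_wpDl // addr_ge0.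
  pose d' := Num.min 1 (d / (2 * K)).
  have d'0 : 0 < d' by rewrite lt_min ltr01 divr_gt0 // mulr_gt0.
  have [e1 e10 h1] := cg _ d'0; have [e2 e20 h2] := ch _ d'0.
  exists (Num.min e1 e2) => [|x hx]; first by rewrite lt_min e10.
  have {h1} k1 : `|g.@[x] - g.@[u]| < d'.
    by apply: h1 => i; apply: le_trans (hx i) _; rewrite ge_min lexx.
  have {h2} k2 : `|h.@[x] - h.@[u]| < d'.
    by apply: h2 => i; apply: le_trans (hx i) _; rewrite ge_min lexx orbT.
  have d'1 : d' <= 1 by rewrite ge_min lexx.
  have d'K : d' * (2 * K) <= d by rewrite -ler_pdivlMr ?mulr_gt0 // ge_min lexx orbT.
  rewrite !mevalM.
  have -> : g.@[x] * h.@[x] - g.@[u] * h.@[u] = (g.@[x] - g.@[u]) * (h.@[x] - h.@[u])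
     + ((g.@[x] - g.@[u]) * h.@[u] + g.@[u] * (h.@[x] - h.@[u])) by ring.
  apply: le_lt_trans (ler_normD _ _) _; apply: le_lt_trans (lerD (lexx _) (ler_normD _ _)) _.
  rewrite !normrM; move: k1 k2 d'K; rewrite /K.
  have := normr_ge0 (g.@[x] - g.@[u]); have := normr_ge0 (h.@[x] - h.@[u]).
  have := normr_ge0 g.@[u]; have := normr_ge0 h.@[u].
  move: `|g.@[x] - _| `|h.@[x] - _| `|g.@[u]| `|h.@[u]| => a b G H; nra.
Qed.

Lemma meval_pos_near (gs : seq A) u : (forall g, g \in gs -> 0 < g.@[u]) ->
  exists2 e : R, 0 < e & forall x, (forall i, `|x i - u i| <= e) ->
    forall g, g \in gs -> 0 < g.@[x].
Proof.
elim: gs => [_|g gs IH hg]; first by exists 1.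
have [|e1 e10 h1] := IH; first by move=> h hh; apply: hg; rewrite in_cons hh orbT.
have g0 : 0 < g.@[u] by apply: hg; rewrite mem_head.
have [e2 e20 h2] := meval_near g u g0.
exists (Num.min e1 e2) => [|x hx h]; first by rewrite lt_min e10.
rewrite in_cons => /orP[/eqP->|hh].
  have := h2 x; rewrite ltr_distl subrr => /(_ _)/andP[] // i.
  by apply: le_trans (hx i) _; rewrite ge_min lexx orbT.
by apply: h1 hh => i; apply: le_trans (hx i) _; rewrite ge_min lexx.
Qed.

Lemma local_min_deriv_poly (h : {poly R}) (e : R) : 0 < e ->
  (forall t, `|t| <= e -> h.[0] <= h.[t]) -> h^`().[0] = 0.
Proof.
move=> e0 hm; have /factor_theorem[h1 hE] : root (h - h.[0]%:P) 0.
  by rewrite /root !hornerE subrr.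
have hE' : h = h1 * 'X + h.[0]%:P by rewrite -[LHS](subrK h.[0]%:P) hE subr0.
have -> : h^`().[0] = h1.[0] by rewrite hE' derivD derivM derivX derivC !hornerE; ring.
have ht t : `|t| <= e -> 0 <= h1.[t] * t.
  by move=> /hm; rewrite {2}hE' !hornerE lerDr.
apply/eqP/negPn/negP => h10.
have n0 : 0 < `|h1.[0]| by rewrite normr_gt0.
have [d d0 hd] := poly_cont 0 h1 n0.
pose t := Num.min (d / 2) e; have t0 : 0 < t by rewrite lt_min divr_gt0.
have td : t < d by rewrite gt_min; apply/orP; left; lra.
have te : t <= e by rewrite ge_min lexx orbT.
have close y : `|y| = t -> `|h1.[y] - h1.[0]| < `|h1.[0]|.
  by move=> hy; apply: hd; rewrite subr0 hy.
case: (ltgtP h1.[0] 0) h10 => // hs _.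
  have := close t; rewrite gtr0_norm // => /(_ erefl); rewrite (ltr0_norm hs) ltr_distl subrr.
  move=> /andP[_ h1t]; have := ht t; rewrite gtr0_norm // => /(_ te).
  by rewrite pmulr_lge0 // leNgt h1t.
have := close (- t); rewrite normrN gtr0_norm // => /(_ erefl); rewrite (gtr0_norm hs) ltr_distl subrr.
move=> /andP[h1t _]; have := ht (- t); rewrite normrN gtr0_norm // => /(_ te).
by rewrite mulrN oppr_ge0 leNgt mulr_gt0.
Qed.

Lemma local_min_mderiv g x (e : R) : 0 < e ->
  (forall y, (forall i, `|y i - x i| <= e) -> g.@[x] <= g.@[y]) ->
  forall l, g^`M(l).@[x] = 0.
Proof.
move=> e0 hm l.
pose line : {rmorphism A -> {poly R}} := mmap polyC (fun i => (x i)%:P + (i == l)%:R *: 'X).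
have lineC c : line c%:MP = c%:P by rewrite /= mmapC.
have lineX i : line 'X_i = (x i)%:P + (i == l)%:R *: 'X by rewrite /= mmapX mmap1U.
have lineE t p : (line p).[t] = p.@[fun i => x i + (i == l)%:R * t].
  apply: (mpoly_rmorph_ext (F := horner_eval t \o line) (G := meval _)) => [c|i] /=.
    by rewrite /horner_eval -[mmap _ _ _]/(line _) lineC hornerC mevalC.
  by rewrite /horner_eval -[mmap _ _ _]/(line _) lineX mevalXU !hornerE.
have x0 p : (line p).[0] = p.@[x].
  by rewrite lineE; congr (meval _ p); apply/funext => i; rewrite mulr0 addr0.
have lineD : forall p, (line p)^`().[0] = p^`M(l).@[x].
  apply: mpoly_alg_ind => [c|i|p q hp hq|p q hp hq].
  - by rewrite lineC derivC horner0 mderivC meval0.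
  - rewrite lineX derivD derivC derivZ derivX !hornerE mderivX mnm1E mevalZ.
    case: eqVneq => [->|]; last by rewrite !mul0r.
    by rewrite !mul1r mevalX big1 // => j _; rewrite mnmBE subnn expr0.
  - by rewrite rmorphD derivD hornerD hp hq mderivD mevalD.
  - by rewrite rmorphM derivM hornerD !hornerM hp hq !x0 mderivM mevalD !mevalM.
rewrite -lineD; apply: (local_min_deriv_poly e0) => t te.
rewrite x0 lineE; apply: hm => i; rewrite addrC addKr.
by case: eqP; rewrite ?mul1r ?mul0r ?normr0 // ltW.
Qed.

End PolynomialFunctions.

(** * Stationary points of penalised problems *)

Section PenaltyMethod.
Local Open Scope classical_set_scope.
Variables (R : realType) (n mE mI : nat) (f : {mpoly R[n]}).
Variables (cE : 'I_mE -> {mpoly R[n]}) (cI : 'I_mI -> {mpoly R[n]}).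
Local Notation A := {mpoly R[n]}.
Local Notation ev v := (fun i => (v : 'rV[R]_n) ord0 i).

(** This is min(r, 0), in a form whose continuity is immediate. *)
Let neg (r : R) := (r - `|r|) / 2.

Let neg_le0 r : neg r <= 0.
Proof. by rewrite pmulr_lle0 ?invr_gt0 // subr_le0 ler_norm. Qed.

Let neg_ge0E r : 0 <= r -> neg r = 0.
Proof. by move=> r0; rewrite /neg ger0_norm // subrr mul0r. Qed.

Let neg_le r : neg r <= r.
Proof. by rewrite /neg; have := ler_norm (- r); rewrite normrN; lra. Qed.

Let neg_eq0 r : neg r = 0 -> 0 <= r.
Proof. by move=> e; rewrite -e; apply: neg_le. Qed.

Let neg_sqr_le r k : 0 <= k -> neg r ^+ 2 <= (r - k) ^+ 2.
Proof.
move=> k0; have [r0|r0] := leP 0 r; first by rewrite neg_ge0E // expr0n sqr_ge0.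
have -> : neg r = r by rewrite /neg ltr0_norm // opprK; field.
nra.
Qed.

Let viol (x : 'I_n -> R) := \sum_i (cE i).@[x] ^+ 2 + \sum_j neg (cI j).@[x] ^+ 2.

Let viol_ge0 x : 0 <= viol x.
Proof. by rewrite addr_ge0 // sumr_ge0 // => i _; rewrite sqr_ge0. Qed.

Let viol_eq0 x : viol x = 0 -> feasible cE cI x.
Proof.
move/eqP; rewrite paddr_eq0 ?sumr_ge0 // => [|i _|i _]; rewrite ?sqr_ge0 //.
rewrite !psumr_eq0 => [/andP[/allP h1 /allP h2]|i _|i _]; rewrite ?sqr_ge0 //.
split=> i; first by have := h1 i; rewrite mem_index_enum sqrf_eq0 => /(_ isT)/eqP.
by have := h2 i; rewrite mem_index_enum sqrf_eq0 => /(_ isT)/eqP/neg_eq0.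
Qed.

Let viol_continuous : continuous (fun v : 'rV[R]_n => viol (ev v)).
Proof.
have cX (F : 'rV[R]_n -> R) : continuous F -> continuous (fun v => F v ^+ 2).
  by move=> cF v; apply: continuousM (cF v) (cF v).
have cS (m : nat) (F : 'I_m -> 'rV[R]_n -> R) :
    (forall i, continuous (F i)) -> continuous (fun v => \sum_i F i v).
  move=> cF; rewrite /index_enum; elim: (Finite.enum _) => [|i r IH] v.
    by under eq_fun do rewrite big_nil; apply: cst_continuous.
  by under eq_fun do rewrite big_cons; apply: continuousD; [apply: cF|apply: IH].
move=> v; apply: continuousD; apply: cS => i; apply: cX; first exact: meval_continuous.
have cN : continuous (fun v : 'rV[R]_n => (cI i).@[ev v] - `|(cI i).@[ev v]|).
  move=> w; have cw := @meval_continuous R n (cI i) w.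
  exact: (continuousB cw (cvg_norm cw)).
by move=> w; exact: (continuousM (cN w) (@cst_continuous _ _ (2^-1 : R) w)).
Qed.

(** a + |a| + b is positive on D and equals b where a <= 0, so b is bounded away from 0 there; a is
    bounded below on D. *)
Lemma penalty_parameter (D : set 'rV[R]_n) (a b : 'rV[R]_n -> R) : compact D ->
  continuous a -> continuous b -> (forall v, 0 <= b v) ->
  (forall v, D v -> b v = 0 -> 0 < a v) ->
  exists2 N : R, 0 <= N & forall v, D v -> 0 < a v + N * b v.
Proof.
move=> cD ca cb b0 ab; have [->|/set0P D0] := eqVneq D set0; first by exists 0.
have [|v1 v1D h1] := @EVT_min_rV R n (fun v => a v + `|a v| + b v) D D0 cD.
  apply: continuous_subspaceT => v.
  exact: (continuousD (continuousD (ca v) (cvg_norm (ca v))) (cb v)).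
have [|v2 _ h2] := @EVT_min_rV R n a D D0 cD; first exact: continuous_subspaceT.
pose m := a v1 + `|a v1| + b v1.
have m0 : 0 < m.
  have Dv1 : D v1 by move: v1D; rewrite in_setE.
  have [av|av] := ltP 0 (a v1).
    by rewrite /m ltr_wpDr // ltr_wpDr.
  rewrite /m (ler0_norm av) addrN add0r.
  rewrite lt_neqAle b0 andbT eq_sym; apply/negP => /eqP e.
  by have := ab _ Dv1 e; rewrite ltNge av.
have N0 : 0 <= 2 * (`|a v2| + 1) / m by apply: divr_ge0; [rewrite mulr_ge0 // addr_ge0|exact: ltW].
exists (2 * (`|a v2| + 1) / m) => // v Dv.
have {}h1 := h1 v; have {}h2 := h2 v; rewrite in_setE in h1 h2.
have {}h1 := h1 Dv; have {}h2 := h2 Dv.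
have [av|av] := ltP 0 (a v); first by rewrite ltr_wpDr // mulr_ge0.
have bm : m <= b v by move: h1; rewrite -/m (ler0_norm av) subrr add0r.
have h3 : 2 * (`|a v2| + 1) <= 2 * (`|a v2| + 1) / m * b v.
  by rewrite -mulrA ler_peMr ?mulr_ge0 ?addr_ge0 // ler_pdivlMl // mulr1.
have h4 : - `|a v2| <= a v by apply: le_trans h2; rewrite lerNl -normrN ler_norm.
by have := normr_ge0 (a v2); lra.
Qed.

(** f + |x - u|^2 plus N times the squared violation is minimised over a box around u. N is so large
    that the value exceeds f(u) wherever |x - u| >= e; hence the minimizer is interior and
    stationary. The term |x - u|^2 singles out u among possible other minimizers. *)
Lemma penalty_stationary_point u (e : R) : 0 < e -> feasible cE cI u ->
  (forall x, feasible cE cI x -> f.@[u] <= f.@[x]) ->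
  exists (x : 'I_n -> R) (muE : 'I_mE -> R) (muI : 'I_mI -> R),
  [/\ forall i, `|x i - u i| <= e, forall j, 0 <= muI j,
      forall j, 0 < (cI j).@[x] -> muI j = 0 &
      forall l, f^`M(l).@[x] + 2 * (x l - u l) =
        \sum_i muE i * (cE i)^`M(l).@[x] + \sum_j muI j * (cI j)^`M(l).@[x]].
Proof.
move=> e0 fu um.
pose dist : A := \sum_(i < n) ('X_i - (u i)%:MP) ^+ 2.
have distE x : dist.@[x] = \sum_i (x i - u i) ^+ 2.
  by rewrite /dist rmorph_sum; apply: eq_bigr => i _; rewrite rmorphXn rmorphB /= mevalXU mevalC.
have dist_coord x i : (x i - u i) ^+ 2 <= dist.@[x].
  by rewrite distE (bigD1 i) //= lerDl sumr_ge0 // => j _; rewrite sqr_ge0.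
have distu : dist.@[u] = 0 by rewrite distE big1 // => i _; rewrite subrr expr0n.
have violu : viol u = 0.
  case: fu => h1 h2; rewrite /viol !big1 ?addr0 // => i _; last by rewrite h1 expr0n.
  by rewrite neg_ge0E // expr0n.
pose B := [set v : 'rV[R]_n | forall i, `[u i - e, u i + e] (v ord0 i)].
have cB : compact B.
  exact: (@rV_compact _ n (fun i => `[u i - e, u i + e]) (fun i => @segment_compact _ _ _)).
have inB x : (forall i, `|x i - u i| <= e) -> B (\row_i x i).
  by move=> hx i; rewrite /= mxE in_itv /= -ler_distl.
have evrow (x : 'I_n -> R) : ev (\row_i x i) = x by apply/funext => i; rewrite mxE.
pose D := B `&` [set v | e ^+ 2 <= dist.@[ev v]].
have cD : compact D.
  apply: (subclosed_compact _ cB); last exact: subIsetl.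
  apply: closedI; first by apply: compact_closed cB; apply: norm_hausdorff.
  have -> : [set v : 'rV[R]_n | e ^+ 2 <= dist.@[ev v]] =
      (fun v : 'rV[R]_n => dist.@[ev v]) @^-1` [set r | e ^+ 2 <= r] by [].
  apply: preimage_closed; last exact: closed_ge.
  by move=> v _; apply: meval_continuous.
have [||||N N0 hN] := @penalty_parameter D (fun v => (f + dist - (f.@[u])%:MP).@[ev v])
    (fun v => viol (ev v)) cD.
- exact: meval_continuous.
- exact: viol_continuous.
- by [].
- move=> v [Bv dv] /viol_eq0 fv; rewrite /= mevalB mevalD mevalC.
  have := um _ fv; have := exprn_gt0 2 e0; move: dv => /=; lra.
pose Phi v := (f + dist).@[ev v] + N * viol (ev v).
have [||v vB vmin] := @EVT_min_rV R n Phi B _ cB.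
- by exists (\row_i u i); apply: inB => i; rewrite subrr normr0 ltW.
- apply: continuous_subspaceT => v; have cm := @meval_continuous R n (f + dist) v.
  exact: (continuousD cm (continuousM (@cst_continuous _ _ N v) (@viol_continuous v))).
rewrite in_setE in vB; pose x := ev v.
have Phix : Phi v <= f.@[u].
  have -> : f.@[u] = Phi (\row_i u i) by rewrite /Phi evrow mevalD distu violu mulr0 !addr0.
  by apply: vmin; rewrite in_setE; apply: inB => i; rewrite subrr normr0 ltW.
have dx : dist.@[x] < e ^+ 2.
  rewrite ltNge; apply/negP => h; have := hN v (conj vB h).
  rewrite mevalB mevalC => h1; move: Phix; rewrite /Phi -/x; rewrite -/x in h1; lra.
pose r := Num.sqrt dist.@[x].
have re : r < e by rewrite -(gtr0_norm e0) -sqrtr_sqr ltr_sqrt ?exprn_gt0.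
have xr i : `|x i - u i| <= r by rewrite -sqrtr_sqr ler_wsqrtr.
pose kap j := (cI j).@[x] - neg (cI j).@[x].
have kap0 j : 0 <= kap j by rewrite subr_ge0 neg_le.
(* The violation is not polynomial. With [kap], the positive part of c_j at x, held fixed, (c_j -
   kap)^2 bounds the violation term from above and agrees with it at x, so the polynomial [Psi] has
   a local minimum at x too. *)
pose Psi : A := f + dist + N%:MP * (\sum_i (cE i) ^+ 2 + \sum_j (cI j - (kap j)%:MP) ^+ 2).
have PsiE y : Psi.@[y] = (f + dist).@[y] +
    N * (\sum_i (cE i).@[y] ^+ 2 + \sum_j ((cI j).@[y] - kap j) ^+ 2).
  rewrite /Psi mevalD; congr (_ + _); rewrite mevalM mevalC mevalD !rmorph_sum /=; congr (N * (_ + _)).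
    by apply: eq_bigr => i _; rewrite rmorphXn.
  by apply: eq_bigr => i _; rewrite rmorphXn rmorphB /= mevalC.
have dPsi : forall l, Psi^`M(l).@[x] = 0.
  apply: (@local_min_mderiv R n Psi x (e - r)); first by rewrite subr_gt0.
  move=> y hy; have -> : Psi.@[x] = Phi v.
    rewrite PsiE /Phi; congr (_ + N * (_ + _)); apply: eq_bigr => j _.
    by rewrite /kap opprB addrC subrK.
  have hyB : forall i, `|y i - u i| <= e.
    move=> i; have -> : y i - u i = (y i - x i) + (x i - u i) by rewrite subrKA.
    by apply: le_trans (ler_normD _ _) _; rewrite -[e](subrK r) lerD.
  apply: (@le_trans _ _ (Phi (\row_i y i))); first by apply: vmin; rewrite in_setE; apply: inB.
  rewrite /Phi evrow PsiE lerD2l ler_wpM2l // lerD2l; apply: ler_sum => j _.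
  exact: neg_sqr_le.
exists x, (fun i => - (2 * N * (cE i).@[x])), (fun j => - (2 * N * neg (cI j).@[x])); split.
- by move=> i; apply: le_trans (xr i) (ltW re).
- by move=> j; rewrite oppr_ge0 mulr_ge0_le0 // mulr_ge0.
- by move=> j cj; rewrite neg_ge0E ?ltW // mulr0 oppr0.
- move=> l; have := dPsi l.
  have dX (g : A) : (g ^+ 2)^`M(l) = 2%:MP * (g * g^`M(l)).
    by rewrite expr2 mderivM (_ : 2%:MP = 1 + 1 :> A) ?rmorph_nat //; ring.
  have dsum (m : nat) (F : 'I_m -> A) : (\sum_i F i)^`M(l) = \sum_i (F i)^`M(l).
    by rewrite (raddf_sum (mderiv l)).
  have dd : dist^`M(l).@[x] = 2 * (x l - u l).
    rewrite /dist dsum rmorph_sum (bigD1 l) //= big1 => [|i il].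
      rewrite dX !mevalM mevalC mevalB mevalXU mevalC mderivB mderivC subr0 mderivX mnm1E eqxx.
      by rewrite scale1r mevalX big1 => [|j _]; rewrite ?mulr1 ?addr0 // mnmBE subnn expr0.
    rewrite dX !mevalM mderivB mderivC subr0 mderivX mnm1E (negbTE il).
    by rewrite scale0r meval0 !mulr0.
  rewrite /Psi !mderivD mderiv_mulC !mevalD dd mevalM mevalC mderivD mevalD !dsum !rmorph_sum => e1.
  transitivity (- (N * (\sum_(i < mE) ((cE i ^+ 2)^`M(l)).@[x] +
      \sum_(j < mI) (((cI j - (kap j)%:MP) ^+ 2)^`M(l)).@[x]))).
    by apply/eqP; rewrite -subr_eq0 opprK; apply/eqP.
  rewrite mulrDr opprD !mulr_sumr -!sumrN; congr (_ + _); apply: eq_bigr => i _.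
    by rewrite dX !mevalM mevalC; ring.
  rewrite dX !mevalM mevalC mevalB mevalC mderivB mderivC subr0 /kap opprB addrC subrK; ring.
Qed.

End PenaltyMethod.

(** * Nonnegativity of the multipliers by Cramer's rule *)

Section MultiplierSign.
Variables (R : realType) (n mE mI : nat) (f : {mpoly R[n]}).
Variables (cE : 'I_mE -> {mpoly R[n]}) (cI : 'I_mI -> {mpoly R[n]}).
Variables (pE : 'I_mE -> {mpoly R[n]}) (pI : 'I_mI -> {mpoly R[n]}).
Local Notation A := {mpoly R[n]}.

Let m := (mE + mI)%N.

Definition constraint (i : 'I_m) : A :=
  match fintype.split i with inl i' => cE i' | inr j => cI j end.

Definition multiplier (lE : 'I_mE -> R) (lI : 'I_mI -> R) : 'rV[R]_m :=
  row_mx (\row_i lE i) (\row_j lI j).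

Let inactive (u : 'I_n -> R) : 'rV[R]_m := row_mx 0 (\row_j ((cI j).@[u] != 0)%:R).

(* A row of zeros and ones is appended so that inactive constraints, whose gradients may be
   dependent, contribute independent rows. *)
Let grad (u : 'I_n -> R) : 'M[A]_(m, n + m) :=
  row_mx (\matrix_(i, l) (constraint i)^`M(l)) (map_mx (@mpolyC n R) (diag_mx (inactive u))).

Lemma constraint_lshift i : constraint (lshift mI i) = cE i.
Proof. by rewrite /constraint (unsplitK (inl i)). Qed.

Lemma constraint_rshift j : constraint (rshift mE j) = cI j.
Proof. by rewrite /constraint (unsplitK (inr j)). Qed.

Lemma multiplier_lshift lE lI i : multiplier lE lI ord0 (lshift mI i) = lE i.
Proof. by rewrite /multiplier row_mxEl mxE. Qed.

Lemma multiplier_rshift lE lI j : multiplier lE lI ord0 (rshift mE j) = lI j.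
Proof. by rewrite /multiplier row_mxEr mxE. Qed.

Let inactive_lshift u i : inactive u ord0 (lshift mI i) = 0.
Proof. by rewrite /inactive row_mxEl mxE. Qed.

Let inactive_rshift u j : inactive u ord0 (rshift mE j) = ((cI j).@[u] != 0)%:R.
Proof. by rewrite /inactive row_mxEr mxE. Qed.

Lemma multiplier_grad u x lE lI : (forall j, (cI j).@[u] != 0 -> lI j = 0) ->
  multiplier lE lI *m map_mx (meval x) (grad u) =
  row_mx (\row_l (\sum_i lE i * (cE i)^`M(l).@[x] + \sum_j lI j * (cI j)^`M(l).@[x])) 0.
Proof.
move=> hI; rewrite map_row_mx mul_mx_row; congr row_mx; apply/rowP => l.
  rewrite mxE [RHS]mxE big_split_ord /=; congr (_ + _); apply: eq_bigr => i _.
    by rewrite multiplier_lshift !mxE constraint_lshift.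
  by rewrite multiplier_rshift !mxE constraint_rshift.
have -> : map_mx (meval x) (map_mx (@mpolyC n R) (diag_mx (inactive u))) = diag_mx (inactive u).
  by apply/matrixP => i j; rewrite !mxE; apply: mevalC.
rewrite mul_mx_diag mxE [RHS]mxE -[l]splitK; case: (fintype.split l) => i /=.
  by rewrite inactive_lshift mulr0.
rewrite multiplier_rshift inactive_rshift; have := hI i.
by case: eqP => [_|_ /(_ isT) ->]; rewrite ?mulr0 ?mul0r.
Qed.

(** A left kernel vector vanishes on the inactive constraints because of the appended columns, so
    adding it to the multipliers at u gives another critical pair. Assumption A prescribes both,
    hence the vector is 0. *)
Lemma grad_row_free u lE lI : assumptionA f cE cI pE pI -> crit_pair f cE cI u lE lI ->
  row_free (map_mx (meval u) (grad u)).
Proof.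
move=> aA cp; apply: inj_row_free => nu e; have [h1 [h2 h3]] := cp.
pose nE i := nu ord0 (lshift mI i); pose nI j := nu ord0 (rshift mE j).
have nuE : nu = multiplier nE nI.
  apply/rowP => i; rewrite -[ i ]splitK; case: (fintype.split i) => k /=.
    by rewrite multiplier_lshift.
  by rewrite multiplier_rshift.
have nI0 j : (cI j).@[u] != 0 -> nI j = 0.
  move=> cj; have := congr1 (fun M : 'rV_(n + m) => M ord0 (rshift n (rshift mE j))) e.
  rewrite map_row_mx mul_mx_row row_mxEr.
  have -> : map_mx (meval u) (map_mx (@mpolyC n R) (diag_mx (inactive u))) = diag_mx (inactive u).
    by apply/matrixP => i k; rewrite !mxE; apply: mevalC.
  by rewrite mul_mx_diag mxE [RHS]mxE inactive_rshift cj mulr1.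
move: e; rewrite nuE multiplier_grad //; rewrite -[RHS]row_mx0 => /eq_row_mx[e _].
have [gE gI] := aA _ _ _ cp.
have cp' : crit_pair f cE cI u (fun i => lE i + nE i) (fun j => lI j + nI j).
  split=> //; split=> [j|l].
    rewrite mulrDl h2 add0r; have [->|/nI0->] := eqVneq (cI j).@[u] 0; by rewrite ?mulr0 ?mul0r.
  rewrite h3; under [X in _ = X + _]eq_bigr do rewrite mulrDl.
  under [X in _ = _ + X]eq_bigr do rewrite mulrDl.
  rewrite !big_split /= addrACA -[LHS]addr0; congr (_ + _).
  by have := congr1 (fun M : 'rV_n => M ord0 l) e; rewrite !mxE => ->.
have [gE' gI'] := aA _ _ _ cp'.
apply/rowP => i; rewrite -[ i ]splitK [RHS]mxE; case: (fintype.split i) => k /=.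
  by rewrite multiplier_lshift; apply: (addrI (lE k)); rewrite gE' gE addr0.
by rewrite multiplier_rshift; apply: (addrI (lI k)); rewrite gI' gI addr0.
Qed.

(* Multipliers mu at the nearby stationary points x of the penalised problems solve the linear
   system mu G(x) = b(x), so by Cramer's rule mu_j det = v_j(x) with det and v_j polynomial. *)
Lemma minimizer_multiplier_ge0 u : assumptionA f cE cI pE pI -> crit_point f cE cI u ->
  feasible cE cI u -> (forall x, feasible cE cI x -> f.@[u] <= f.@[x]) ->
  forall j, 0 <= (pI j).@[u].
Proof.
move=> aA [lE [lI cp]] fu um j; have [gE gI] := aA _ _ _ cp; have [h1 [h2 h3]] := cp.
(* [D] is a constant right inverse of the gradient matrix at u, so the square matrix [M] below is
   the identity at u and its determinant stays positive nearby. *)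
have /row_freeP[D GD] := grad_row_free aA cp.
pose Dp := map_mx (@mpolyC n R) D.
have Dpx x : map_mx (meval x) Dp = D by apply/matrixP => i k; rewrite !mxE mevalC.
pose M := grad u *m Dp.
pose b : 'rV[A]_(n + m) := row_mx (\row_l (f^`M(l) + 2%:MP * ('X_l - (u l)%:MP))) 0.
have bx x : map_mx (meval x) b = row_mx (\row_l (f^`M(l).@[x] + 2 * (x l - u l))) 0.
  rewrite map_row_mx map_mx0; congr row_mx; apply/rowP => l.
  by rewrite !mxE mevalD mevalM mevalB !mevalC mevalXU.
pose v := b *m Dp *m \adj M.
have vx x mu : mu *m map_mx (meval x) (grad u) = map_mx (meval x) b ->
    (\det M).@[x] *: mu = map_mx (meval x) v.
  move=> e; rewrite /v !map_mxM Dpx -e -[mu *m _ *m D]mulmxA.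
  have -> : map_mx (meval x) (grad u) *m D = map_mx (meval x) M by rewrite /M map_mxM Dpx.
  by rewrite -mulmxA -map_mxM mul_mx_adj map_scalar_mx mul_mx_scalar.
have detu : (\det M).@[u] = 1.
  by rewrite -(det_map_mx (meval u)) /M map_mxM Dpx GD det1.
have vu : (v ord0 (rshift mE j)).@[u] = (pI j).@[u].
  have e : multiplier lE lI *m map_mx (meval u) (grad u) = map_mx (meval u) b.
    rewrite multiplier_grad => [|k ck]; last first.
      by have /eqP := h2 k; rewrite mulf_eq0 (negbTE ck) orbF => /eqP.
    by rewrite bx; congr row_mx; apply/rowP => l; rewrite !mxE h3 subrr mulr0 addr0.
  have := congr1 (fun N : 'rV_m => N ord0 (rshift mE j)) (vx _ _ e).
  by rewrite detu scale1r multiplier_rshift [RHS]mxE gI.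
rewrite leNgt; apply/negP => pneg.
(* If p_j(u) < 0, all of these are positive at u and therefore nearby. At x this makes det > 0 and
   v_j < 0, against mu_j >= 0; and constraints inactive at u remain inactive at x, so their
   multipliers vanish. *)
pose gs := [:: \det M; - v ord0 (rshift mE j)] ++ [seq cI k | k <- enum 'I_mI & (cI k).@[u] != 0].
have [|eps e0 he] := @meval_pos_near R n gs u.
  move=> g; rewrite mem_cat !inE -orbA => /or3P[/eqP->|/eqP->|].
  - by rewrite detu.
  - by rewrite mevalN vu oppr_gt0.
  - case/mapP=> k; rewrite mem_filter => /andP[ck _] ->.
    by rewrite lt_neqAle eq_sym ck; case: fu => _ ->.
have [x [muE [muI [hx mu0 muact est]]]] := penalty_stationary_point e0 fu um.
have pos := he x hx.
have det0 : 0 < (\det M).@[x] by apply: pos; rewrite mem_cat mem_head.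
have vneg : (v ord0 (rshift mE j)).@[x] < 0.
  by rewrite -oppr_gt0 -mevalN; apply: pos; rewrite mem_cat !inE eqxx orbT.
have e : multiplier muE muI *m map_mx (meval x) (grad u) = map_mx (meval x) b.
  rewrite multiplier_grad => [|k ck].
    by rewrite bx; congr row_mx; apply/rowP => l; rewrite !mxE est.
  apply: muact; apply: pos; rewrite mem_cat; apply/orP; right; apply/mapP.
  by exists k; rewrite // mem_filter ck mem_enum.
have := congr1 (fun N : 'rV_m => N ord0 (rshift mE j)) (vx _ _ e).
rewrite mxE [RHS]mxE multiplier_rshift => ev.
by move: vneg; rewrite -ev ltNge mulr_ge0 // ltW.
Qed.

End MultiplierSign.

(** * Certificates of bounded degree *)

Section Degrees.
Variables (R : realType) (n : nat).
Local Notation A := {mpoly R[n]}.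
Implicit Types (p q h g a s : A) (d k D : nat).

Lemma deg_leW d d' p : (d <= d')%N -> deg_le d p -> deg_le d' p.
Proof. by move=> dd hp; apply: leq_trans hp _. Qed.

Lemma deg_le0 d : deg_le d (0 : A).
Proof. by rewrite /deg_le msize0. Qed.

Lemma deg_leD d p q : deg_le d p -> deg_le d q -> deg_le d (p + q).
Proof. by move=> hp hq; apply: leq_trans (mmeasureD_le _ _ _) _; rewrite geq_max hp. Qed.

Lemma deg_leM d e p q : deg_le d p -> deg_le e q -> deg_le (d + e) (p * q).
Proof.
rewrite /deg_le => hp hq; have [->|p0] := eqVneq p 0; first by rewrite mul0r msize0.
have [->|q0] := eqVneq q 0; first by rewrite mulr0 msize0.
by rewrite msizeM //; move: (msize p) (msize q) hp hq => u v; lia.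
Qed.

Lemma deg_le_pdeg p : deg_le (pdeg p) p.
Proof. by rewrite /deg_le /pdeg; case: (msize p). Qed.

Lemma deg_leC d (c : R) : deg_le d (c%:MP : A).
Proof. by apply: leq_trans (_ : 1 <= _)%N => //; rewrite msizeC; case: (c == 0). Qed.

Lemma deg_le_subP D h a d : deg_le d a -> (pdeg h + d <= D)%N -> deg_le_sub D h a.
Proof.
move=> ha hD; rewrite /deg_le_sub (leq_trans (leq_addr d _) hD).
by apply: deg_leW ha; rewrite leq_subRL // (leq_trans _ hD) // leq_addr.
Qed.

Lemma deg_le_sub0 D h : deg_le_sub D h 0.
Proof. by rewrite /deg_le_sub; case: ifP => // _; apply: deg_le0. Qed.

Lemma deg_le_subD D h p q : deg_le_sub D h p -> deg_le_sub D h q -> deg_le_sub D h (p + q).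
Proof.
rewrite /deg_le_sub; case: ifP => _; first exact: deg_leD.
by move=> -> ->; rewrite addr0.
Qed.

Lemma pick_sum (t : nat) (i : 'I_t) (g : 'I_t -> A) a :
  \sum_(j < t) g j * (if j == i then a else 0) = g i * a.
Proof.
by rewrite (bigD1 i) //= eqxx big1 ?addr0 // => j /negbTE ->; rewrite mulr0.
Qed.

Section Truncation.
Variables (k s t : nat) (h : 'I_s -> A) (g : 'I_t -> A).

Lemma IQ_trunc0 : IQ_trunc k h g 0.
Proof.
exists (fun=> 0), 0, (fun=> 0); split=> [i|]; first exact: deg_le_sub0.
split; [split; [exact: SOS_0|exact: deg_le0]|split=> [j|]].
  by split; [exact: SOS_0|exact: deg_le_sub0].
by rewrite !big1 ?addr0 // => i _; rewrite mulr0.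
Qed.

Lemma IQ_truncD p q : IQ_trunc k h g p -> IQ_trunc k h g q -> IQ_trunc k h g (p + q).
Proof.
move=> [a [s0 [sg [ha [[S0 hs0] [hsg ->]]]]]] [a' [s0' [sg' [ha' [[S0' hs0'] [hsg' ->]]]]]].
exists (fun i => a i + a' i), (s0 + s0'), (fun j => sg j + sg' j).
split=> [i|]; first exact: deg_le_subD.
split; first by split; [apply: SOS_D|apply: deg_leD].
split=> [j|].
  by have [h1 h2] := hsg j; have [h3 h4] := hsg' j; split; [apply: SOS_D|apply: deg_le_subD].
under [\sum_(i < s) h i * (a i + a' i)]eq_bigr do rewrite mulrDr.
under [\sum_(i < t) g i * (sg i + sg' i)]eq_bigr do rewrite mulrDr.
by rewrite !big_split /=; ring.
Qed.

Lemma IQ_trunc_eq i a : deg_le_sub k.*2 (h i) a -> IQ_trunc k h g (h i * a).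
Proof.
move=> ha; exists (fun j => if j == i then a else 0), 0, (fun=> 0).
split=> [j|]; first by case: eqP => [->//|_]; apply: deg_le_sub0.
split; [split; [exact: SOS_0|exact: deg_le0]|split=> [j|]].
  by split; [exact: SOS_0|exact: deg_le_sub0].
rewrite pick_sum addr0 [X in _ + X]big1 ?addr0 // => j _; by rewrite mulr0.
Qed.

Lemma IQ_trunc_SOS p : SOS p -> deg_le k.*2 p -> IQ_trunc k h g p.
Proof.
move=> Sp hp; exists (fun=> 0), p, (fun=> 0); split=> [i|]; first exact: deg_le_sub0.
split=> //; split=> [j|]; first by split; [exact: SOS_0|exact: deg_le_sub0].
by rewrite !big1 ?addr0 ?add0r // => i _; rewrite mulr0.
Qed.

Lemma IQ_trunc_ineq j p : SOS_sub k.*2 (g j) p -> IQ_trunc k h g (g j * p).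
Proof.
move=> hp; exists (fun=> 0), 0, (fun i => if i == j then p else 0).
split=> [i|]; first exact: deg_le_sub0.
split; [split; [exact: SOS_0|exact: deg_le0]|split=> [i|]].
  by case: eqP => [->//|_]; split; [exact: SOS_0|exact: deg_le_sub0].
by rewrite pick_sum big1 ?add0r // => i _; rewrite mulr0.
Qed.

Lemma IQ_trunc_ge0 p x : IQ_trunc k h g p -> (forall i, (h i).@[x] = 0) ->
  (forall j, 0 <= (g j).@[x]) -> 0 <= p.@[x].
Proof.
have sos q : SOS q -> 0 <= q.@[x].
  case=> l ->; rewrite rmorph_sum; apply: sumr_ge0 => q' _.
  by rewrite rmorphXn sqr_ge0.
move=> [a [s0 [sg [_ [[S0 _] [hsg ->]]]]]] hx gx; rewrite !mevalD !rmorph_sum /=.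
rewrite [X in 0 <= X + _ + _]big1 => [|i _]; last by rewrite mevalM hx mul0r.
rewrite add0r addr_ge0 ?sos // sumr_ge0 // => j _.
by rewrite mevalM mulr_ge0 // sos //; have [] := hsg j.
Qed.

End Truncation.

Section Riesz.
Variable y : 'X_{1..n} -> R.

Lemma riesz_uniq (r : seq 'X_{1..n}) p : uniq r -> {subset msupp p <= r} ->
  riesz y p = \sum_(m <- r) p@_m * y m.
Proof.
move=> ur sub; rewrite (bigID (mem (msupp p))) /= [X in _ + X]big1 ?addr0; last first.
  by move=> m /memN_msupp_eq0->; rewrite mul0r.
rewrite -big_filter /riesz; apply: perm_big; apply: uniq_perm => //.
- by rewrite filter_uniq.
- by move=> m; rewrite mem_filter; case: (boolP (m \in msupp p)) => // /sub ->.
Qed.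

Lemma rieszD p q : riesz y (p + q) = riesz y p + riesz y q.
Proof.
pose r := undup (msupp p ++ msupp q ++ msupp (p + q)).
have ur : uniq r by apply: undup_uniq.
rewrite !(@riesz_uniq r) //; first last.
- by move=> m mp; rewrite mem_undup !mem_cat mp ?orbT.
- by move=> m mp; rewrite mem_undup !mem_cat mp ?orbT.
- by move=> m mp; rewrite mem_undup !mem_cat mp ?orbT.
by rewrite -big_split; apply: eq_bigr => m _; rewrite mcoeffD mulrDl.
Qed.

Lemma rieszC (c : R) : riesz y c%:MP = c * riesz y 1.
Proof.
rewrite !(@riesz_uniq [:: 0%MM]) //; first by rewrite !big_seq1 mcoeffC mcoeff1 eqxx mulr1 mul1r.
- by move=> m; rewrite msupp1 inE.
- by move=> m; rewrite msuppC; case: ifP => // _; rewrite inE.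
Qed.

Lemma riesz0 : riesz y 0 = 0.
Proof. by rewrite /riesz msupp0 big_nil. Qed.

End Riesz.

(** Moments of the Dirac measure at x, cut above degree 2k as the encoding of moment vectors
    demands. *)
Definition point_moments k (x : 'I_n -> R) (m : 'X_{1..n}) : R :=
  if (mdeg m <= k.*2)%N then \prod_i x i ^+ m i else 0.

Lemma riesz_point_moments k x p : deg_le k.*2 p -> riesz (point_moments k x) p = p.@[x].
Proof.
move=> hp; rewrite /riesz mevalE big_seq [RHS]big_seq; apply: eq_bigr => m mp.
by rewrite /point_moments -ltnS (leq_trans (msize_mdeg_lt mp) hp).
Qed.

Lemma loc_dom_deg k q a b : loc_dom k q a -> loc_dom k q b -> deg_le k.*2 (q * a * b).
Proof.
move=> [h1 ha] [_ hb]; apply: deg_leW (deg_leM (deg_leM (deg_le_pdeg q) ha) hb).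
by move: (pdeg q) h1 => d; lia.
Qed.

End Degrees.

(** * From certificates to the two relaxations *)

Section Certificates.
Local Open Scope classical_set_scope.
Variables (R : realType) (n mE mI : nat) (f : {mpoly R[n]}).
Variables (cE : 'I_mE -> {mpoly R[n]}) (cI : 'I_mI -> {mpoly R[n]}).
Variables (pE : 'I_mE -> {mpoly R[n]}) (pI : 'I_mI -> {mpoly R[n]}).
Local Notation A := {mpoly R[n]}.
Local Notation phi := (phi f cE cI pE pI).
Local Notation psi := (psi pI).
Local Notation feasible_c := (feasible_c f cE cI pE pI).
Local Notation fc := (fc f cE cI pE pI).
Local Notation fk := (fk f cE cI pE pI).
Local Notation fk' := (fk' f cE cI pE pI).
Local Notation mom_feasible := (mom_feasible f cE cI pE pI).
Implicit Types (g h p q : A) (x u : 'I_n -> R) (d k : nat).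

Definition eq_generator h := (exists i, h = cE i) \/ (exists i, h = phi i).

Definition ineq_generator g := [\/ g = 1, exists j, g = cI j | exists j, g = psi j].

(** Here and below, lists of generator and multiplier pairs may repeat a generator: addition is
    concatenation, and a sum-of-squares multiplier becomes several entries. *)
Definition eq_ideal : set A := [set p | exists2 l : seq (A * A),
  forall t, t \in l -> eq_generator t.1 & p = \sum_(t <- l) t.1 * t.2].

Definition relaxation_qmod : set A := [set p | exists2 j, eq_ideal j &
  exists2 l : seq (A * A), forall t, t \in l -> ineq_generator t.1 &
    p = j + \sum_(t <- l) t.1 * t.2 ^+ 2].

(* Elements of the quadratic module whose multipliers have bounded degree: the bound is what
   makes a family of certificates live in one fixed relaxation order. *)
Definition certificate d p := exists l1 l2 : seq (A * A),
  [/\ forall t, t \in l1 -> eq_generator t.1 /\ deg_le d t.2,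
      forall t, t \in l2 -> ineq_generator t.1 /\ deg_le d t.2 &
      p = \sum_(t <- l1) t.1 * t.2 + \sum_(t <- l2) t.1 * t.2 ^+ 2].

Lemma eq_ideal_gen h : eq_generator h -> eq_ideal h.
Proof.
move=> eh; exists [:: (h, 1)]; last by rewrite big_seq1 mulr1.
by move=> t; rewrite inE => /eqP->.
Qed.

Lemma eq_idealP : ideal_set eq_ideal.
Proof.
split.
- by exists [::]; rewrite ?big_nil.
- move=> _ _ [l hl ->] [l' hl' ->]; exists (l ++ l'); last by rewrite big_cat.
  by move=> t; rewrite mem_cat => /orP[/hl|/hl'].
- move=> a _ [l hl ->]; exists [seq (t.1, a * t.2) | t <- l].
    by move=> _ /mapP[t /hl tl ->].
  by rewrite big_map mulr_sumr; apply: eq_bigr => t _ /=; rewrite mulrCA.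
Qed.

Lemma eq_ideal_qmod p : eq_ideal p -> relaxation_qmod p.
Proof. by move=> Jp; exists p => //; exists [::]; rewrite ?big_nil ?addr0. Qed.

Lemma ineq_generator_qmod g : ineq_generator g -> relaxation_qmod g.
Proof.
move=> ig; exists 0; first exact: ideal0 eq_idealP.
exists [:: (g, 1)]; last by rewrite big_seq1 expr1n mulr1 add0r.
by move=> t; rewrite inE => /eqP->.
Qed.

Lemma relaxation_qmodP : quadratic_module relaxation_qmod.
Proof.
split.
- by apply: ineq_generator_qmod; constructor 1.
- move=> _ _ [j Jj [l hl ->]] [j' Jj' [l' hl' ->]].
  exists (j + j'); first exact: (idealD eq_idealP).
  exists (l ++ l'); last by rewrite big_cat /=; ring.
  by move=> t; rewrite mem_cat => /orP[/hl|/hl'].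
- move=> q _ [j Jj [l hl ->]]; exists (q ^+ 2 * j); first exact: (idealM eq_idealP).
  exists [seq (t.1, q * t.2) | t <- l]; first by move=> _ /mapP[t /hl tl ->].
  rewrite mulrDr big_map mulr_sumr; congr (_ + _); apply: eq_bigr => t _ /=.
  by rewrite exprMn mulrCA.
Qed.

Lemma certificateW d d' p : (d <= d')%N -> certificate d p -> certificate d' p.
Proof.
move=> dd [l1 [l2 [h1 h2 ->]]]; exists l1, l2; split=> // t; [move=> /h1|move=> /h2];
by case=> ht dt; split=> //; apply: deg_leW dt.
Qed.

Lemma certificateD d p q : certificate d p -> certificate d q -> certificate d (p + q).
Proof.
move=> [l1 [l2 [h1 h2 ->]]] [l1' [l2' [h1' h2' ->]]]; exists (l1 ++ l1'), (l2 ++ l2'); split.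
- by move=> t; rewrite mem_cat => /orP[/h1|/h1'].
- by move=> t; rewrite mem_cat => /orP[/h2|/h2'].
- by rewrite !big_cat /=; ring.
Qed.

Lemma certificateZ d (c : R) p : 0 <= c -> certificate d p -> certificate d (c%:MP * p).
Proof.
move=> c0 [l1 [l2 [h1 h2 ->]]].
exists [seq (t.1, c%:MP * t.2) | t <- l1], [seq (t.1, (Num.sqrt c)%:MP * t.2) | t <- l2].
split=> [_ /mapP[t /h1[h3 h4] ->]|_ /mapP[t /h2[h3 h4] ->]|].
- by split=> //; rewrite -[d]add0n; apply: deg_leM => //; apply: deg_leC.
- by split=> //; rewrite -[d]add0n; apply: deg_leM => //; apply: deg_leC.
rewrite !big_map mulrDr !mulr_sumr; congr (_ + _); apply: eq_bigr => t _ /=.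
  by rewrite mulrCA.
have -> : c%:MP = (Num.sqrt c)%:MP ^+ 2 :> A by rewrite -{1}(sqr_sqrtr c0) rmorphXn.
by rewrite exprMn mulrCA.
Qed.

Lemma certificate_sqr d q : deg_le d q -> certificate d (q ^+ 2).
Proof.
move=> hq; exists [::], [:: (1, q)]; split=> //; last by rewrite big_nil big_seq1 add0r mul1r.
by move=> t; rewrite inE => /eqP->; split=> //; constructor 1.
Qed.

Lemma certificate_mulX d e p q : deg_le e q -> certificate d p ->
  certificate (d + e + e) (q ^+ 2 * p).
Proof.
move=> hq [l1 [l2 [h1 h2 ->]]].
exists [seq (t.1, t.2 * q * q) | t <- l1], [seq (t.1, t.2 * q) | t <- l2].
split=> [_ /mapP[t /h1[h3 h4] ->]|_ /mapP[t /h2[h3 h4] ->]|].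
- by split=> //; apply: deg_leM => //; apply: deg_leM.
- by split=> //; apply: deg_leW (leq_addr e _) _; apply: deg_leM.
by rewrite !big_map mulrDr !mulr_sumr; congr (_ + _); apply: eq_bigr => t _ /=; ring.
Qed.

Lemma qmod_certificate p : relaxation_qmod p -> exists d, certificate d p.
Proof.
move=> [_ [l1 h1 ->] [l2 h2 ->]].
pose b (l : seq (A * A)) := (\max_(t <- l) msize t.2)%N.
have bP (l : seq (A * A)) t : t \in l -> (msize t.2 <= b l)%N.
  by move=> tl; rewrite /b (big_rem t tl) leq_maxl.
exists (maxn (b l1) (b l2)), l1, l2; split=> // t tl; split; [exact: h1| |exact: h2|];
by apply: leqW; apply: leq_trans (bP _ _ tl) _; rewrite ?leq_maxl ?leq_maxr.
Qed.

Definition generator_degree :=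
  (\max_i pdeg (cE i) + \max_i pdeg (phi i) + \max_j pdeg (cI j) + \max_j pdeg (psi j))%N.

Lemma eq_generator_degree h : eq_generator h -> (pdeg h <= generator_degree)%N.
Proof.
rewrite /generator_degree; case=> [[i ->]|[i ->]].
  have := leq_bigmax (F := fun i => pdeg (cE i)) i.
  by move: (pdeg _) (\max_i _)%N (\max_i _)%N (\max_j _)%N (\max_j _)%N; lia.
have := leq_bigmax (F := fun i => pdeg (phi i)) i.
by move: (pdeg _) (\max_i _)%N (\max_i _)%N (\max_j _)%N (\max_j _)%N; lia.
Qed.

Lemma ineq_generator_degree g : ineq_generator g -> (pdeg g <= generator_degree)%N.
Proof.
rewrite /generator_degree; case=> [->|[j ->]|[j ->]].
- by rewrite /pdeg msize1.
- have := leq_bigmax (F := fun j => pdeg (cI j)) j.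
  by move: (pdeg _) (\max_i _)%N (\max_i _)%N (\max_j _)%N (\max_j _)%N; lia.
- have := leq_bigmax (F := fun j => pdeg (psi j)) j.
  by move: (pdeg _) (\max_i _)%N (\max_i _)%N (\max_j _)%N (\max_j _)%N; lia.
Qed.

Definition relaxation_trunc k p :=
  exists p1 p2, p = p1 + p2 /\ IQ_trunc k cE cI p1 /\ IQ_trunc k phi psi p2.

Lemma relaxation_truncD k p q :
  relaxation_trunc k p -> relaxation_trunc k q -> relaxation_trunc k (p + q).
Proof.
move=> [p1 [p2 [-> [h1 h2]]]] [q1 [q2 [-> [h3 h4]]]]; exists (p1 + q1), (p2 + q2).
by rewrite addrACA; split=> //; split; apply: IQ_truncD.
Qed.

Lemma relaxation_trunc1 k p : IQ_trunc k cE cI p -> relaxation_trunc k p.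
Proof. by move=> hp; exists p, 0; rewrite addr0; split=> //; split=> //; apply: IQ_trunc0. Qed.

Lemma relaxation_trunc2 k p : IQ_trunc k phi psi p -> relaxation_trunc k p.
Proof. by move=> hp; exists 0, p; rewrite add0r; split=> //; split=> //; apply: IQ_trunc0. Qed.

Lemma certificate_trunc k d p : (generator_degree + d <= k)%N ->
  certificate d p -> relaxation_trunc k p.
Proof.
move=> hk [l1 [l2 [h1 h2 ->]]]; have z : relaxation_trunc k 0.
  by apply: relaxation_trunc1; apply: IQ_trunc0.
apply: relaxation_truncD; rewrite big_seq.
  apply: big_ind => // [a b|t /h1[et dt]]; first exact: relaxation_truncD.
  have dg : deg_le_sub k.*2 t.1 t.2.
    by apply: deg_le_subP dt _; have := eq_generator_degree et; lia.
  case: et dg => [[i ->]|[i ->]] dg.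
    by apply: relaxation_trunc1; apply: IQ_trunc_eq.
  by apply: relaxation_trunc2; apply: IQ_trunc_eq.
apply: big_ind => // [a b|t /h2[it dt]]; first exact: relaxation_truncD.
have dt2 : deg_le (d + d) (t.2 ^+ 2) by rewrite expr2; apply: deg_leM.
have dg : SOS_sub k.*2 t.1 (t.2 ^+ 2).
  by split; [apply: SOS_X|apply: deg_le_subP dt2 _; have := ineq_generator_degree it; lia].
case: it dg => [->|[j ->]|[j ->]] dg.
- rewrite mul1r; apply: relaxation_trunc1; apply: IQ_trunc_SOS; first exact: SOS_X.
  by apply: deg_leW dt2; lia.
- by apply: relaxation_trunc1; apply: IQ_trunc_ineq.
- by apply: relaxation_trunc2; apply: IQ_trunc_ineq.
Qed.

(** The certificate is paired with the moment vector term by term, so the bound on [fk'] does not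
    pass through [fk]. *)
Lemma certificate_riesz k d p y : (generator_degree + d <= k)%N -> mom_feasible k y ->
  certificate d p -> 0 <= riesz y p.
Proof.
move=> hk [_ [_ [y1 [yE [yI [yphi ypsi]]]]]] [l1 [l2 [h1 h2 ->]]]; rewrite rieszD addr_ge0 //.
  rewrite big_seq; apply: (big_ind (fun p => 0 <= riesz y p)).
  - by rewrite riesz0.
  - by move=> a b ha hb; rewrite rieszD addr_ge0.
  move=> t /h1[et dt]; have := eq_generator_degree et => dg.
  have ld : loc_dom k t.1 t.2.
    split; first by move: (pdeg t.1) dg => a; lia.
    by apply: deg_leW dt; move: (pdeg t.1) dg => a; lia.
  (* The localizing equations involve two test polynomials; for the ideal part the second one is
     1. *)
  have l1' : loc_dom k t.1 1.
    split; first by case: ld.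
    by rewrite -[1]/(1%:MP); apply: deg_leC.
  have : loc_zero k t.1 y by case: et => -[i ->].
  by move=> /(_ _ _ ld l1'); rewrite mulr1 => ->.
rewrite big_seq; apply: (big_ind (fun p => 0 <= riesz y p)).
- by rewrite riesz0.
- by move=> a b ha hb; rewrite rieszD addr_ge0.
move=> t /h2[it dt]; have := ineq_generator_degree it => dg.
have ld : loc_dom k t.1 t.2.
  split; first by move: (pdeg t.1) dg => a; lia.
  by apply: deg_leW dt; move: (pdeg t.1) dg => a; lia.
have : loc_psd k t.1 y by case: it => [->|[j ->]|[j ->]].
by move=> /(_ _ ld); rewrite expr2 mulrA.
Qed.

Lemma point_moments_feasible k x : feasible_c x -> mom_feasible k (point_moments k x).
Proof.
move=> [[xE xI] [xphi xpsi]].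
have psd q : 0 <= q.@[x] -> loc_psd k q (point_moments k x).
  move=> q0 a ha; rewrite riesz_point_moments; last exact: loc_dom_deg.
  by rewrite !mevalM -mulrA mulr_ge0 // -expr2 sqr_ge0.
have zero q : q.@[x] = 0 -> loc_zero k q (point_moments k x).
  move=> q0 a b ha hb; rewrite riesz_point_moments; last exact: loc_dom_deg.
  by rewrite !mevalM q0 !mul0r.
split; first by move=> m; rewrite /point_moments ltnNge => /negbTE ->.
split; first by rewrite riesz_point_moments ?meval1 // -[1]/(1%:MP); apply: deg_leC.
split; first by apply: psd; rewrite meval1.
by split=> [i|]; [apply: zero|split=> [j|]; [apply: psd|split=> i; [apply: zero|apply: psd]]].
Qed.

Lemma ereal_le_reals (a b : \bar R) : (forall r : R, (r%:E < a)%E -> (r%:E <= b)%E) -> (a <= b)%E.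
Proof.
case: a => [a|h|h]; last by rewrite leNye.
  move=> h; apply/lee_addgt0Pr => e e0; rewrite -leeBlDr // -EFinB; apply: h.
  by rewrite lte_fin ltrBlDr ltrDl.
by rewrite leye_eq; apply/eqP/eqyP => c _; apply: h; rewrite ltry.
Qed.

(** Each value is squeezed separately: certificates bound both from below, while points feasible for
    [fc] bound [fk] by evaluation and [fk'] through their Dirac moments. *)
Lemma relaxations_tight d : (forall r : R, (r%:E < fc)%E -> certificate d (f - r%:MP)) ->
  exists k0 : nat, forall k : nat, (k0 <= k)%N -> fk k = fc /\ fk' k = fc.
Proof.
move=> cert; exists (generator_degree + d + pdeg f)%N => k hk.
have hk' : (generator_degree + d <= k)%N by apply: leq_trans hk; rewrite leq_addr.
have df : deg_le k.*2 f by apply: deg_leW (deg_le_pdeg f); move: (pdeg f) hk => a; lia.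
split; apply/eqP; rewrite eq_le; apply/andP; split.
- apply: ge_ereal_sup => _ [r [p1 [p2 [e [h1 h2]]]] <-].
  apply: le_ereal_inf_tmp => _ [x [[xE xI] [xphi xpsi]] <-]; rewrite lee_fin -subr_ge0.
  have -> : f.@[x] - r = (f - r%:MP).@[x] by rewrite mevalB mevalC.
  by rewrite e mevalD addr_ge0 // (IQ_trunc_ge0 h1, IQ_trunc_ge0 h2).
- apply: ereal_le_reals => r /cert cr; apply: ereal_sup_ubound; exists r => //=.
  exact: certificate_trunc cr.
- apply: le_ereal_inf_tmp => _ [x fx <-]; apply: ereal_inf_lbound.
  exists (point_moments k x); first exact: point_moments_feasible.
  by rewrite riesz_point_moments.
- apply: le_ereal_inf_tmp => _ [y fy <-]; apply: ereal_le_reals => r /cert cr.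
  rewrite lee_fin -subr_ge0; have := certificate_riesz hk' fy cr.
  have [_ [y1 _]] := fy.
  by rewrite -mpolyCN rieszD rieszC y1 mulr1.
Qed.

End Certificates.

(** * Uniform certificates for the objective *)

Section FiniteConvergence.
Local Open Scope classical_set_scope.
Variables (R : realType) (n mE mI : nat) (f : {mpoly R[n]}).
Variables (cE : 'I_mE -> {mpoly R[n]}) (cI : 'I_mI -> {mpoly R[n]}).
Variables (pE : 'I_mE -> {mpoly R[n]}) (pI : 'I_mI -> {mpoly R[n]}).
Local Notation A := {mpoly R[n]}.
Local Notation phi := (phi f cE cI pE pI).
Local Notation psi := (psi pI).
Local Notation feasible_c := (feasible_c f cE cI pE pI).
Local Notation fc := (fc f cE cI pE pI).
Local Notation J := (eq_ideal f cE cI pE pI).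
Local Notation M := (relaxation_qmod f cE cI pE pI).
Implicit Types (g h p : A) (x u : 'I_n -> R).

Let hJ := eq_idealP f cE cI pE pI.
Let qM := relaxation_qmodP f cE cI pE pI.

Definition eq_zero u := (forall i, (cE i).@[u] = 0) /\ (forall i, (phi i).@[u] = 0).

Lemma eq_ideal_zero p u : J p -> eq_zero u -> p.@[u] = 0.
Proof.
move=> [l hl ->] [uE uphi]; rewrite rmorph_sum /= big_seq big1 // => t /hl et.
by rewrite mevalM; case: et => -[i ->]; rewrite ?uE ?uphi mul0r.
Qed.

Lemma phi_lshift l : phi (lshift mI l) =
  f^`M(l) - \sum_(i < mE) pE i * (cE i)^`M(l) - \sum_(j < mI) pI j * (cI j)^`M(l).
Proof. by rewrite /Defs.phi (unsplitK (inl l)). Qed.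

Lemma phi_rshift j : phi (rshift n j) = pI j * cI j.
Proof. by rewrite /Defs.phi (unsplitK (inr j)). Qed.

Lemma eq_zero_crit_pair u : eq_zero u ->
  crit_pair f cE cI u (fun i => (pE i).@[u]) (fun j => (pI j).@[u]).
Proof.
move=> [uE uphi]; split=> //; split=> [j|l].
  by have := uphi (rshift n j); rewrite phi_rshift mevalM.
have /eqP := uphi (lshift mI l); rewrite phi_lshift !mevalB !rmorph_sum /=.
rewrite -addrA -opprD subr_eq0 => /eqP ->.
by congr (_ + _); apply: eq_bigr => i _; rewrite mevalM.
Qed.

Lemma crit_point_phi u : assumptionA f cE cI pE pI -> crit_point f cE cI u ->
  forall i, (phi i).@[u] = 0.
Proof.
move=> aA [lE [lI cp]] i; have [gE gI] := aA _ _ _ cp; have [h1 [h2 h3]] := cp.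
rewrite -[ i ]splitK; case: (fintype.split i) => k /=.
  rewrite phi_lshift !mevalB h3 !rmorph_sum /= -addrA -opprD; apply/eqP; rewrite subr_eq0.
  by apply/eqP; congr (_ + _); apply: eq_bigr => j _; rewrite mevalM ?gE ?gI.
by rewrite phi_rshift mevalM -gI h2.
Qed.

Lemma algebraic_objective : exists2 q : {poly R}, q != 0 & J (map_poly (@mpolyC n R) q).[f].
Proof.
apply: contrapT => no.
pose W : set A := fun w => exists2 q : {poly R}, q != 0 & w = (map_poly (@mpolyC n R) q).[f].
have [|||I [JI pI' IW]] := @prime_ideal_avoiding A J W hJ.
- by exists 1; rewrite ?oner_neq0 // rmorph1 hornerC.
- move=> _ _ [q q0 ->] [r r0 ->]; exists (q * r); first by rewrite mulf_neq0.
  by rewrite rmorphM hornerM.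
- by move=> a Ja [q q0 e]; apply: no; exists q; rewrite -?e.
have hI := prime_ideal_ideal pI'.
have [q Iq|xi [hxi]] := transcendental_derivation pI' (f := f).
  by apply/eqP/negPn/negP => q0; apply: IW Iq _; exists q.
apply.
pose D g := \sum_l g^`M(l) * xi l.
have -> : \sum_l f^`M(l) * xi l = \sum_l phi (lshift mI l) * xi l +
    (\sum_i pE i * D (cE i) + \sum_j pI j * D (cI j)).
  have e (m : nat) (p c : 'I_m -> A) :
      \sum_i p i * D (c i) = \sum_l (\sum_i p i * (c i)^`M(l)) * xi l.
    under [RHS]eq_bigr do rewrite mulr_suml.
    rewrite exchange_big; apply: eq_bigr => i _; rewrite /D mulr_sumr.
    by apply: eq_bigr => l _; rewrite mulrA.
  rewrite !e -!big_split; apply: eq_bigr => l _ /=; rewrite phi_lshift; ring.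
apply: (idealD hI); last apply: (idealD hI).
- apply: ideal_sum => // l _; apply: idealMl => //; apply: JI; apply: eq_ideal_gen.
  by right; exists (lshift mI l).
- apply: ideal_sum => // i _; apply: (idealM hI); apply: hxi; apply: JI.
  by apply: eq_ideal_gen; left; exists i.
- apply: ideal_sum => // j _.
  have /(pideal_prime pI')[h|h] : I (pI j * cI j).
    by apply: JI; apply: eq_ideal_gen; right; exists (rshift n j); rewrite phi_rshift.
  + exact: idealMl.
  + by apply: (idealM hI); apply: hxi.
Qed.

Lemma qmod_point_feasible (N : set A) u : M `<=` N -> (forall g, N g -> 0 <= g.@[u]) -> feasible_c u.
Proof.
move=> MN pos.
have zero h : eq_generator f cE cI pE pI h -> h.@[u] = 0.
  move=> eh; have Jh := eq_ideal_gen eh; apply/eqP; rewrite eq_le; apply/andP; split.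
    by rewrite -oppr_ge0 -mevalN; apply: pos; apply: MN; apply: eq_ideal_qmod; apply: idealN.
  by apply: pos; apply: MN; apply: eq_ideal_qmod.
have nng g : ineq_generator cI pI g -> 0 <= g.@[u].
  by move=> ig; apply: pos; apply: MN; apply: ineq_generator_qmod.
split; first split.
- by move=> i; apply: zero; left; exists i.
- by move=> j; apply: nng; constructor 2; exists j.
split=> i; first by apply: zero; right; exists i.
by apply: nng; constructor 3; exists i.
Qed.

Lemma feasible_c_ge u : feasible_c u -> (fc <= (f.@[u])%:E)%E.
Proof. by move=> fu; apply: ereal_inf_lbound; exists u. Qed.

Lemma IQ_relaxation_qmod (s t : nat) (h : 'I_s -> A) (g : 'I_t -> A) p :
  (forall i, eq_generator f cE cI pE pI (h i)) -> (forall j, ineq_generator cI pI (g j)) ->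
  IQ h g p -> M p.
Proof.
move=> hh hg [a [s0 [sg [S0 [Sg ->]]]]].
have sum0 (m : nat) (F : 'I_m -> A) : (forall i, M (F i)) -> M (\sum_i F i).
  by move=> MF; apply: (big_ind M) => [|x y|i _]; [exact: qmod0|exact: qmodD|].
apply: (qmodD qM); first apply: (qmodD qM).
- apply: sum0 => i; apply: eq_ideal_qmod; apply: idealMl => //; exact: eq_ideal_gen.
- exact: SOS_qmod.
- apply: sum0 => j; rewrite mulrC; apply: SOS_mul_qmod => //; exact: ineq_generator_qmod.
Qed.

Definition relaxation_archimedean := exists2 p, M p &
  compact [set v : 'rV[R]_n | 0 <= p.@[fun i => v ord0 i]].

(** In the archimedean case M + (b), if proper, has a point; it is feasible for [fc] and a zero of
    b, which is contradictory. Under Assumption B a preordering is needed, although M is not closed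
    under products: J + (b) + SOS is one, and adjoining the single element rho stays inside M + (b).
    A point of it would be critical with f(u) < [fc] and rho(u) >= 0. *)
Lemma infeasible_certificate (b : A) :
  relaxation_archimedean \/ assumptionB f cE cI pE pI ->
  (forall u, eq_zero u -> b.@[u] = 0 -> ((f.@[u])%:E < fc)%E) ->
  exists mu h, M mu /\ - 1 = mu + b * h.
Proof.
move=> hyp hb; apply: contrapT => no; case: hyp => [[p Mp cp]|[rho [Qrho hrho]]].
  pose N : set A := [set z | exists mu h, M mu /\ z = mu + b * h].
  have MN : M `<=` N by move=> z Mz; exists z, 0; rewrite mulr0 addr0.
  have qN : quadratic_module N.
    split; first by apply: MN; apply: qmod1 qM.
      move=> _ _ [mu [h [Mmu ->]]] [mu' [h' [Mmu' ->]]]; exists (mu + mu'), (h + h').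
      by split; [apply: (qmodD qM)|ring].
    move=> q _ [mu [h [Mmu ->]]]; exists (q ^+ 2 * mu), (q ^+ 2 * h).
    by split; [apply: (qmodMX qM)|ring].
  have aN : qmod_archimedean N.
    have [r r0 hr] := compact_norm2_bound cp; have [r' [s [t [Ss St e]]]] := compact_qmod_archimedean r0 hr.
    exists r'; rewrite e; apply: MN; apply: (qmodD qM); first exact: SOS_qmod.
    by rewrite mulrC; apply: SOS_mul_qmod.
  have [u hu] := archimedean_qmod_point qN aN no.
  have fu := qmod_point_feasible MN hu; have [[uE _] [uphi _]] := fu.
  have : ((f.@[u])%:E < fc)%E.
    apply: hb => //; apply/eqP; rewrite eq_le; apply/andP; split.
      rewrite -oppr_ge0 -mevalN; apply: hu; exists 0, (- 1).
      by split; [apply: (qmod0 qM)|rewrite mulrN1 add0r].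
    by apply: hu; exists 0, 1; split; [apply: (qmod0 qM)|rewrite mulr1 add0r].
  by rewrite ltNge feasible_c_ge.
have Mrho : M rho.
  have [s0 [sg [S0 [Sg ->]]]] := Qrho; apply: (qmodD qM); first exact: SOS_qmod.
  apply: (big_ind M) => [|x y|j _]; [exact: (qmod0 qM)|exact: (qmodD qM)|].
  rewrite mulrC; apply: SOS_mul_qmod => //; apply: ineq_generator_qmod.
  by case: fintype.split => k; [constructor 2|constructor 3]; exists k.
pose T : set A := [set z | exists j h s, [/\ J j, SOS s & z = j + b * h + s]].
have pT : preordering T.
  split.
  - move=> q; exists 0, 0, (q ^+ 2); rewrite mulr0 !add0r.
    by split=> //; [apply: (ideal0 hJ)|apply: SOS_X].
  - move=> _ _ [j [h [s [Jj Ss ->]]]] [j' [h' [s' [Jj' Ss' ->]]]].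
    exists (j + j'), (h + h'), (s + s').
    by split; [apply: (idealD hJ)|apply: SOS_D|ring].
  - move=> _ _ [j [h [s [Jj Ss ->]]]] [j' [h' [s' [Jj' Ss' ->]]]].
    exists ((j' + b * h' + s') * j + (b * h + s) * j'), (h * (b * h' + s') + s * h'), (s * s').
    split; [|exact: SOS_M|ring].
    by apply: (idealD hJ); apply: (idealM hJ).
have [T0 T1] := (preord0 pT, preord1 pT).
have [[z [z' [[j [h [s [Jj Ss ->]]]] [j' [h' [s' [Jj' Ss' ->]]]] e]]]|no'] := pselect (adjoin T rho (- 1)).
  apply: no; exists (j + s + (rho * j' + s' * rho)), (h + rho * h').
  split; last by rewrite e; ring.
  apply: (qmodD qM); apply: (qmodD qM).
  - exact: eq_ideal_qmod.
  - exact: SOS_qmod.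
  - by apply: eq_ideal_qmod; apply: (idealM hJ).
  - exact: SOS_mul_qmod.
pose es := b :: [seq cE i | i <- enum 'I_mE] ++ [seq phi i | i <- enum 'I_(n + mI)].
have Tes h : h \in es -> T h /\ T (- h).
  rewrite /es in_cons mem_cat => /orP[/eqP->|eh].
    split; [exists 0, 1, 0|exists 0, (- 1), 0]; rewrite ?mulrN1 ?mulr1 addr0 add0r;
    by split=> //; [apply: (ideal0 hJ)|apply: SOS_0].
  have Jh : J h.
    by apply: eq_ideal_gen; case/orP: eh => /mapP[i _ ->]; [left|right]; exists i.
  split; [exists h|exists (- h)]; exists 0, 0; rewrite mulr0 !addr0; split=> //;
  by [apply: SOS_0|apply: idealN].
have [g|u hu] := positivstellensatz (gs := rho :: es ++ map -%R es) (preordering_adjoin rho pT) no'.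
  rewrite in_cons => /orP[/eqP->|]; first exact: adjoin_gen.
  rewrite mem_cat => /orP[/Tes[h _]|/mapP[h /Tes[_ h'] ->]]; exact: adjoin_sub.
have zero h : h \in es -> h.@[u] = 0.
  move=> he; apply/eqP; rewrite eq_le; apply/andP; split.
    by rewrite -oppr_ge0 -mevalN; apply: hu; rewrite in_cons mem_cat map_f ?orbT.
  by apply: hu; rewrite in_cons mem_cat he orbT.
have uz : eq_zero u.
  split=> i; apply: zero; rewrite in_cons mem_cat.
    by rewrite (map_f cE) ?orbT ?mem_enum.
  by rewrite (map_f phi) ?orbT ?mem_enum.
have : rho.@[u] < 0.
  apply: hrho; last by apply: hb => //; apply: zero; rewrite mem_head.
  by exists (fun i => (pE i).@[u]), (fun j => (pI j).@[u]); apply: eq_zero_crit_pair.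
by rewrite ltNge hu // mem_head.
Qed.

Local Notation at_f q := (map_poly (@mpolyC n R) q).[f].

Lemma meval_at_objective (q : {poly R}) u : (at_f q).@[u] = q.[f.@[u]].
Proof.
elim/poly_ind: q => [|q c IHq]; first by rewrite rmorph0 !horner0 meval0.
by rewrite rmorphD rmorphM /= map_polyX map_polyC !hornerE mevalD mevalM IHq mevalC.
Qed.

Lemma at_objective_degree (m : nat) : exists d, forall q : {poly R}, (size q <= m)%N ->
  deg_le d (at_f q).
Proof.
exists (m * pdeg f)%N => q sq; rewrite (horner_coef_wide _ (size_poly _ _)).
apply: (big_ind (deg_le _)) => [|a b|i _]; [exact: deg_le0|exact: deg_leD|].
have deg_fX (j : nat) : deg_le (j * pdeg f) (f ^+ j).
  elim: j => [|j IHj]; first by rewrite -[_ ^+ 0]/(1%:MP); apply: deg_leC.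
  by rewrite exprS mulSn; apply: deg_leM => //; apply: deg_le_pdeg.
rewrite coef_map /= -[(m * _)%N]add0n; apply: deg_leM; first exact: deg_leC.
apply: deg_leW (deg_fX i); rewrite leq_mul2r; apply/orP; right.
by apply: leq_trans (ltnW (ltn_ord i)) _.
Qed.

Lemma objective_certificate : relaxation_archimedean \/ assumptionB f cE cI pE pI ->
  exists d, forall r : R, (r%:E < fc)%E -> certificate f cE cI pE pI d (f - r%:MP).
Proof.
move=> hyp; have [q q0 Jq] := algebraic_objective.
(* The values of f at feasible points are roots of q, hence bounded below. *)
have fcNy : (fc != -oo)%E.
  rewrite -ltNye; apply: lt_le_trans (ltNyr (- cauchy_bound q)) _.
  apply: le_ereal_inf_tmp => _ [u [[uE _] [uphi _]] <-]; rewrite lee_fin.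
  have rq : root q f.@[u] by rewrite /root -meval_at_objective (eq_ideal_zero Jq).
  by have := cauchy_boundP q0 (eqP rq); rewrite ltr_norml => /andP[/ltW].
case fcE : fc fcNy => [g||] // _.
  have [a [b [qE ha hb]]] := split_roots g q0.
  (* The extra factor makes [b'] nonconstant, as [penalty_constant] requires, and adds no root below
     g. *)
  pose b' := b * ('X - g%:P).
  have b0 : b != 0 by apply: contraNneq q0 => e; rewrite qE e mulr0.
  have sb : (1 < size b')%N.
    rewrite /b' size_mul ?polyXsubC_eq0 // size_XsubC addn2 /= ltnS.
    by rewrite size_poly_gt0.
  have nb t : t < g -> ~~ root b' t.
    move=> tg; rewrite /b' rootM negb_or hb //= root_XsubC; by rewrite lt_eqF.
  have [u uz|mu [h [Mmu e]]] := @infeasible_certificate (at_f a) hyp.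
    by rewrite meval_at_objective fcE lte_fin => /eqP /ha.
  (* Multiplying -1 = mu + a(f) h by b'(f)^2 leaves b'(f)^2 mu plus a multiple of a(f) b'(f) = (f -
     g) q(f), which is in J. *)
  have Mb : M (- at_f b' ^+ 2).
    have -> : - at_f b' ^+ 2 = at_f b' ^+ 2 * mu + at_f b' * h * ((f - g%:MP) * at_f q).
      have -> : (f - g%:MP) * at_f q = at_f a * at_f b'.
        rewrite qE /b' !rmorphM rmorphB /= map_polyX map_polyC.
        by rewrite !(hornerM, hornerD, hornerN, hornerX, hornerC); ring.
      by transitivity (at_f b' ^+ 2 * (mu + at_f a * h)); [rewrite -e mulrN1|ring].
    apply: (qmodD qM); first exact: (qmodMX qM).
    by apply: eq_ideal_qmod; do 2! apply: (idealM hJ).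
  have [d1 c1] := qmod_certificate Mb.
  (* This size bounds X - r + C b'^2 for every r and C, so the degree of the two squares does not
     depend on r. *)
  have [d2 hd2] := at_objective_degree (maxn 2 (size (b' ^+ 2)%R)).
  exists (maxn d1 d2) => r; rewrite lte_fin => rg.
  have e0 : 0 < g - r by rewrite subr_gt0.
  have [C C0 hC] := penalty_constant e0 sb nb.
  pose P := 'X - r%:P + C *: b' ^+ 2.
  have [x|s1 [s2 [PE sz1 sz2]]] := @pos_poly_two_squares R P.
    have := hC x; rewrite /P !(hornerD, hornerN, hornerZ, horner_exp, hornerX, hornerC).
    by congr (0 < _); rewrite addrA subrK.
  have sP : (size P <= maxn 2 (size (b' ^+ 2)%R))%N.
    apply: leq_trans (size_polyD _ _) _; rewrite size_XsubC geq_max leq_maxl /=.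
    by apply: leq_trans (size_scale_leq _ _) _; rewrite leq_maxr.
  have PE' : f - r%:MP + C%:MP * at_f b' ^+ 2 = at_f s1 ^+ 2 + at_f s2 ^+ 2.
    have := congr1 (fun q => at_f q) PE; rewrite /P !rmorphD /= map_polyZ !rmorphXn rmorphN /=.
    by rewrite map_polyX map_polyC !(hornerD, hornerN, hornerZ, horner_exp, hornerX, hornerC).
  have -> : f - r%:MP = at_f s1 ^+ 2 + at_f s2 ^+ 2 + C%:MP * - at_f b' ^+ 2.
    by rewrite -PE'; ring.
  apply: certificateD; first apply: certificateD.
  - by apply: certificateW (leq_maxr _ _) _; apply: certificate_sqr; apply: hd2; apply: leq_trans sz1 sP.
  - by apply: certificateW (leq_maxr _ _) _; apply: certificate_sqr; apply: hd2; apply: leq_trans sz2 sP.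
  - by apply: certificateW (leq_maxl _ _) _; apply: certificateZ.
have [u uz _|mu [h [Mmu e]]] := @infeasible_certificate 0 hyp.
  by rewrite fcE ltry.
have M1 : M (- 1) by rewrite e mul0r addr0.
have [d1 c1] := qmod_certificate M1.
exists (d1 + pdeg f + pdeg f)%N => r _.
have half (c : R) : deg_le (pdeg f) ((2^-1)%:MP * (f + c%:MP)).
  rewrite -[pdeg f]add0n; apply: deg_leM; first exact: deg_leC.
  by apply: deg_leD; [apply: deg_le_pdeg|apply: deg_leC].
(* With -1 in M, any polynomial is certified as ((h + 1)/2)^2 + ((h - 1)/2)^2 (-1), here for h = f -
   r; the degree of h does not grow with r. *)
have -> : f - r%:MP = ((2^-1)%:MP * (f + (1 - r)%:MP)) ^+ 2 + ((2^-1)%:MP * (f + (- 1 - r)%:MP)) ^+ 2 * - 1.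
  transitivity ((4 * 2^-1 ^+ 2)%:MP * (f - r%:MP)).
    by rewrite (_ : 4 * 2^-1 ^+ 2 = 1 :> R) ?mul1r //; field.
  by rewrite rmorphM rmorphXn /= rmorph_nat !rmorphB rmorphN rmorph1; ring.
apply: certificateD; last exact: certificate_mulX.
by apply: certificateW (certificate_sqr _ _ _ _ _ (half _)); rewrite -addnA addnCA leq_addr.
Qed.

End FiniteConvergence.

Theorem theorem3p3 (R : realType) (n mE mI : nat) (f : {mpoly R[n]})
  (cE : 'I_mE -> {mpoly R[n]}) (cI : 'I_mI -> {mpoly R[n]})
  (pE : 'I_mE -> {mpoly R[n]}) (pI : 'I_mI -> {mpoly R[n]}) :
  (exists u, crit_point f cE cI u) ->
  assumptionA f cE cI pE pI ->
  [\/ archimedean (fun p => exists p1 p2, p = p1 + p2 /\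
                      IQ cE cI p1 /\ IQ (phi f cE cI pE pI) (psi pI) p2),
      archimedean (IQ cE cI)
    | assumptionB f cE cI pE pI] ->
  (exists k0 : nat, forall k : nat, (k0 <= k)%N ->
     fk f cE cI pE pI k = fc f cE cI pE pI /\ fk' f cE cI pE pI k = fc f cE cI pE pI) /\
  ((exists u, feasible cE cI u /\ crit_point f cE cI u /\ (f.@[u])%:E = fmin f cE cI) ->
   exists k0 : nat, forall k : nat, (k0 <= k)%N ->
     fk f cE cI pE pI k = fmin f cE cI /\ fk' f cE cI pE pI k = fmin f cE cI).
Proof.
move=> _ aA hyp.
have MIQ1 p : IQ cE cI p -> relaxation_qmod f cE cI pE pI p.
  by apply: IQ_relaxation_qmod => i; [left; exists i|constructor 2; exists i].
have MIQ2 p : IQ (phi f cE cI pE pI) (psi pI) p -> relaxation_qmod f cE cI pE pI p.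
  by apply: IQ_relaxation_qmod => i; [right; exists i|constructor 3; exists i].
have hyp' : relaxation_archimedean f cE cI pE pI \/ assumptionB f cE cI pE pI.
  case: hyp => [[p [[p1 [p2 [-> [h1 h2]]]] cp]]|[p [h1 cp]]|hB]; last by right.
    left; exists (p1 + p2) => //; apply: qmodD (relaxation_qmodP _ _ _ _ _) _ _ _ _.
      exact: MIQ1.
    exact: MIQ2.
  by left; exists p => //; apply: MIQ1.
have [d /relaxations_tight tight] := objective_certificate hyp'.
split=> // -[u [fu [cu uE]]].
suff -> : fmin f cE cI = fc f cE cI pE pI by [].
have umin x : feasible cE cI x -> f.@[u] <= f.@[x].
  by move=> fx; rewrite -lee_fin uE; apply: ereal_inf_lbound; exists x.
apply/eqP; rewrite eq_le; apply/andP; split.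
  by apply: le_ereal_inf_tmp => _ [x [fx _] <-]; apply: ereal_inf_lbound; exists x.
rewrite -uE; apply: feasible_c_ge; split=> //; split; first exact: crit_point_phi.
exact: minimizer_multiplier_ge0 aA cu fu umin.
Qed.
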